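(* Suppose the adjustment costs satisfy $\mathcal{D}_p\ge\mathcal{C}_+/\alpha$ and $\mathcal{I}_p<\mathcal{C}_-/\alpha$. Then there exists a threshold $L$ such that the optimal policy is given by $$\dot P(t)=\begin{cases}\theta_u, & \text{if } P(t)-D(t)<L,\\ 0, & \text{if } P(t)-D(t)\ge L.\end{cases}$$ Moreover, the value of $L$ is characterized by $$L=\begin{cases}\frac{1}{s_2}\ln\left[\frac{(\alpha\mathcal{I}_p+\mathcal{C}_+)(s_1-r_2)}{(\mathcal{C}_++\mathcal{C}_-)s_1}\right]\ge 0, & \text{if } B_3\le B_2,\\[2mm] \frac{1}{-r_1}\ln\left[\frac{(\mathcal{C}_++\mathcal{C}_-)(-r_2)}{(\mathcal{C}_--\alpha\mathcal{I}_p)(s_1-r_2)}\right]<0, & \text{if } B_3>B_2.\end{cases}$$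
   Context: Parameters: discount rate $\alpha>0$; $b\in\mathbb{R}$; $\sigma>0$; finite rate bounds $\theta_\ell<0<\theta_u$; per-unit adjustment costs $\mathcal{I}_p\ge 0$ (increase) and $\mathcal{D}_p\ge 0$ (decrease); per-unit reward and cost $\mathcal{R}_p>\mathcal{C}_p\ge 0$ of the primary resource, and $\mathcal{R}_s>\mathcal{C}_s\ge 0$ of the secondary resource. The primary resource has higher cost than the secondary resource, $\mathcal{C}_p>\mathcal{C}_s$ (so $\mathcal{C}_p>0$). Put $\mathcal{N}_p=\mathcal{R}_p-\mathcal{C}_p$, $\mathcal{N}_s=\mathcal{R}_s-\mathcal{C}_s$, $\mathcal{C}_+=\mathcal{C}_p$, $\mathcal{C}_-=\mathcal{N}_p-\mathcal{N}_s$. Notation: $x^+=\max\{x,0\}$, $x^-=-\min\{x,0\}$. Demand is $dD(t)=b\,dt+\sigma\,dW(t)$, with $W$ a one-dimensional standard Brownian motion. A control policy is a process $P$ (primary capacity) with absolutely continuous paths, adapted to the filtration generated by $\{D(s):s\le t\}$, with given $P(0)$, and with $\theta_\ell\le\dot P(t)\le\theta_u$ for $t\ge 0$. Let $X(t)=P(t)-D(t)$, $X(0)=x$, so $dX(t)=dP(t)-b\,dt-\sigma\,dW(t)$. The stochastic control problem is to minimize over control policies $$\mathbb{E}_x\left[\int_0^\infty e^{-\alpha t}\left\{\left(\mathcal{C}_+X(t)^++\mathcal{C}_-X(t)^-\right)dt+\left(\mathcal{I}_p\mathbf{1}_{\{\dot P(t)>0\}}-\mathcal{D}_p\mathbf{1}_{\{\dot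 P(t)<0\}}\right)dP(t)\right\}\right],$$ where $\mathbb{E}_x$ is expectation given $X(0)=x$. A policy is optimal if it attains the minimum, for every initial $x$. Constants: $r_{1}=\frac{b+\sqrt{b^2+2\alpha\sigma^2}}{\sigma^2}>0$, $r_2=\frac{b-\sqrt{b^2+2\alpha\sigma^2}}{\sigma^2}<0$; $s_1=\frac{b-\theta_u+\sqrt{(b-\theta_u)^2+2\alpha\sigma^2}}{\sigma^2}>0$, $s_2=\frac{b-\theta_u-\sqrt{(b-\theta_u)^2+2\alpha\sigma^2}}{\sigma^2}<0$; $B_2=(\mathcal{C}_--\alpha\mathcal{I}_p)(s_1-r_2)$, $B_3=(\mathcal{C}_++\mathcal{C}_-)(-r_2)$. *)

(* Defs.v *)
From HB Require Import structures.
From mathcomp Require Import all_boot all_order all_algebra.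
From mathcomp Require Import all_classical all_reals all_analysis.

Set Implicit Arguments.
Unset Strict Implicit.
Unset Printing Implicit Defensive.

Import Order.TTheory GRing.Theory Num.Theory.
Import numFieldNormedType.Exports.

Local Open Scope classical_set_scope.
Local Open Scope ring_scope.

(* A real-valued process with time set [0, +oo[ is a
   function [R -> T -> R]; its values at negative times are never used. *)

Section processes.
Context {d : measure_display} {T : measurableType d} {R : realType}.

(* The second parameter of [normal_prob] is the standard deviation. *)
Record standard_brownian_motion (Pr : probability T R) (W : R -> T -> R) : Prop := {
  bm_measurable : forall t : R, 0 <= t -> measurable_fun [set: T] (W t) ;
  bm_zero : forall w, W 0 w = 0 ;
  bm_continuous : forall w, {within `[0, +oo[%classic, continuous (W ^~ w)} ;
  bm_gaussian : forall s t : R, 0 <= s -> s < t ->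
    forall B : set R, measurable B ->
    Pr ((fun w => W t w - W s w) @^-1` B) = normal_prob 0 (Num.sqrt (t - s)) B ;
  bm_independent : forall (n : nat) (t : nat -> R) (B : nat -> set R),
    0 <= t 0%N -> {homo t : i j / (i <= j)%N >-> i <= j} ->
    (forall i, measurable (B i)) ->
    Pr (\bigcap_(i in `I_n) ((fun w => W (t i.+1) w - W (t i) w) @^-1` B i)) =
    (\prod_(i < n) Pr ((fun w => (W (t i.+1) w - W (t i) w)%R) @^-1` B i))%E }.

Definition natural_filtration (D : R -> T -> R) (t : R) : set_system T :=
  <<s \bigcup_(s in `[0, t]%classic)
        preimage_set_system [set: T] (D s) (@measurable _ R) >>.

Definition adapted (F : R -> set_system T) (P : R -> T -> R) : Prop :=
  forall t : R, 0 <= t -> forall B : set R, measurable B -> F t (P t @^-1` B).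

End processes.

Definition abs_continuous_on {R : realType} (a b : R) (f : R -> R) : Prop :=
  forall e : R, 0 < e -> exists2 del : R, 0 < del &
    forall (n : nat) (u v : 'I_n -> R),
      (forall i, a <= u i /\ u i <= v i /\ v i <= b) ->
      trivIset [set: 'I_n] (fun i => `]u i, v i[%classic) ->
      \sum_(i < n) (v i - u i) < del ->
      \sum_(i < n) `|f (v i) - f (u i)| < e.

Section control.
Context {d : measure_display} {T : measurableType d} {R : realType}.
Implicit Types (D P : R -> T -> R).

(* The solution of dD = b dt + sigma dW with D(0) = d0. *)
Definition demand (b sigma d0 : R) (W : R -> T -> R) : R -> T -> R :=
  fun t w => d0 + b * t + sigma * W t w.

(* [derive1] is two-sided, hence meaningless at t = 0, but rates are only
   ever constrained or integrated up to Lebesgue-null sets of times. *)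
Definition rate P : R -> T -> R := fun t w => derive1 (P ^~ w) t.

(* Differentiability at almost every t already follows from absolute
   continuity; it is repeated because [derive1] is a total function. *)
Record control_policy (thl thu : R) D (p0 : R) P : Prop := {
  policy_init : forall w, P 0 w = p0 ;
  policy_adapted : adapted (natural_filtration D) P ;
  policy_abs_continuous : forall w (M : R), 0 < M -> abs_continuous_on 0 M (P ^~ w) ;
  policy_rate : forall w, {ae (@lebesgue_measure R), forall t : R, 0 <= t ->
    derivable (P ^~ w) t 1 /\ thl <= rate P t w <= thu} }.

(* dP(t) is written P'(t) dt, the paths of P being absolutely continuous.
   The cost is defined with values in [\bar R]. *)
Definition cost (alpha Cplus Cminus Ip Dp : R) (Pr : probability T R) D P : \bar R :=
  (\int[Pr]_w \int[@lebesgue_measure R]_(t in `[0%R, +oo[)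
    (let X := (P t w - D t w)%R in
     let p := rate P t w in
     (expR (- (alpha * t)) *
       ((Cplus * Num.max X 0 + Cminus * - Num.min X 0) +
        (Ip * (0 < p)%R%:R - Dp * (p < 0)%R%:R) * p))%R)%:E)%E.

Definition optimal_policy (alpha Cplus Cminus Ip Dp thl thu : R)
    (Pr : probability T R) D (p0 : R) P : Prop :=
  control_policy thl thu D p0 P /\
  forall Q, control_policy thl thu D p0 Q ->
    (cost alpha Cplus Cminus Ip Dp Pr D P <=
     cost alpha Cplus Cminus Ip Dp Pr D Q)%E.

(* The feedback equation cannot be required for every t or every path: P'
   need not exist when P - D crosses L, and for some exceptional continuous
   paths of D no P solves the equation at almost every t. *)
Definition threshold_policy (thu L : R) (Pr : probability T R) D P : Prop :=
  {ae Pr, forall w, {ae (@lebesgue_measure R), forall t : R, 0 <= t ->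
    rate P t w = if P t w - D t w < L then thu else 0}}.

End control.

(* Main.v *)
(** A solution [V] of the Hamilton-Jacobi-Bellman equation is obtained by fitting
    exponentials at 0 and at [L]. Ito's formula is replaced by a second-order Taylor
    expansion of [V] over time steps of length [h]: as the increment of [W] is independent
    of the past, with mean 0 and variance [h], the equation yields, for every policy,
      [E V(X(t + h)) = (1 + alpha h) E V(X(t)) - E A(t) + O(h^(3/2))],
    where the one-step cost [A(t)] is built from the surplus frozen at time [t] and from the
    minimum of the Hamiltonian. The cost incurred during the step is at least [A(t)], up to
    a multiple of the integral of [|X - X(t)|] over the step, whose expectation is
    O(h^(3/2)); for the threshold policy the converse bound also holds. Discounting and
    summing over the steps telescopes to [V(X(0))] with an error O(sqrt h).

    A threshold policy exists because the limit superior of the Euler scheme moves at rate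
    [thu] below the threshold and is constant above it, while Brownian motion almost surely
    spends no time on a Lipschitz curve, even a random one, so that the times at which the
    limit sits on the threshold are negligible. *)

Require Import Defs.
From HB Require Import structures.
From mathcomp Require Import all_boot all_order all_algebra.
From mathcomp Require Import all_classical all_reals all_analysis.
From mathcomp Require Import measurable_realfun ring lra.

Set Implicit Arguments.
Unset Strict Implicit.
Unset Printing Implicit Defensive.

Import Order.TTheory GRing.Theory Num.Theory.
Import numFieldNormedType.Exports.

Local Open Scope classical_set_scope.
Local Open Scope ring_scope.

(** The value function has four free coefficients and the unknown [L]; continuity of [v] and [z] at
    0 and at [L] and the switching condition [v = - Ip] at [L] are five equations for them.
    Continuity of [z] also makes [z] Lipschitz, whence a cubic Taylor remainder, of mean O(h^(3/2));
    a jump of [z] would only allow the bound O(h), which is too large for 1/h steps per unit of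
    time. An arbitrary policy enters a step only through the surplus at its start, known at that
    time, and through an increment of the capacity that is bounded path by path. Rates are defined
    up to null sets of times, and the time integral of the cost is not shown to be measurable in the
    path. The lower bound therefore places an integrable function below the cost and uses
    monotonicity for nonnegative functions; the upper bound uses a measurable majorant that holds
    almost surely. *)

(** * Taylor bounds for the exponential *)

Section exponential_taylor.
Context {R : realType}.
Implicit Types (x u : R).

Lemma is_derive_ge0 (g g' : R -> R) (b : R) : 0 <= b -> g 0 = 0 ->
  (forall x, is_derive x 1 g (g' x)) ->
  (forall x, 0 <= x -> 0 <= g' x) -> 0 <= g b.
Proof.
move=> b0 g0 dg g'0.
have [|c] := @MVT_segment R g g' 0 b b0 (fun x _ => dg x).
  apply: continuous_subspaceT => y.
  by apply: differentiable_continuous; apply/derivable1_diffP; case: (dg y).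
rewrite in_itv/= => /andP[c0 cb]; rewrite g0 !subr0 => ->.
by rewrite mulr_ge0// g'0.
Qed.

Lemma expR_sub1_le x : 0 <= x -> expR x - 1 <= x * expR x.
Proof.
move=> x0; have := expR_ge1Dx (- x); rewrite expRN.
have e0 := expR_gt0 x.
by rewrite -(ler_pM2r e0) mulVf ?gt_eqF// mulrDl mul1r mulNr; lra.
Qed.

(** In this and the next three bounds the difference of the two sides vanishes at 0, and its
    derivative is controlled by the bound one order lower; the constants are not sharp. *)
Lemma expR_taylor1_ge0 x : 0 <= x ->
  0 <= expR x - 1 - x <= x ^+ 2 * expR x.
Proof.
move=> x0; apply/andP; split; first by have := expR_ge1Dx x; lra.
rewrite -subr_ge0.
apply: (@is_derive_ge0 (fun y => y ^+ 2 * expR y - (expR y - 1 - y))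
  (fun y => y ^+ 2 * expR y + expR y * (y *+ 2) - (expR y - 1)) x x0).
- by rewrite expR0; ring.
- by move=> y; apply: is_derive_eq; rewrite /GRing.scale /=; ring.
- move=> y y0; have h := expR_sub1_le y0; have e0 := expR_gt0 y.
  have : 0 <= y * expR y by rewrite mulr_ge0// ltW.
  have : 0 <= y ^+ 2 * expR y by rewrite mulr_ge0 ?sqr_ge0// ltW.
  by rewrite mulr2n mulrDr; lra.
Qed.

Lemma expR_taylor2_ge0 x : 0 <= x ->
  0 <= expR x - 1 - x - x ^+ 2 / 2 <= x ^+ 3 * expR x.
Proof.
move=> x0; apply/andP; split.
- apply: (@is_derive_ge0 (fun y => expR y - 1 - y - y ^+ 2 / 2)
    (fun y => expR y - 1 - y) x x0).
  + by rewrite expR0; ring.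
  + by move=> y; apply: is_derive_eq; rewrite /GRing.scale /=; field.
  + by move=> y /expR_taylor1_ge0/andP[].
- rewrite -subr_ge0; apply: (@is_derive_ge0
    (fun y => y ^+ 3 * expR y - (expR y - 1 - y - y ^+ 2 / 2))
    (fun y => y ^+ 3 * expR y + 3 * y ^+ 2 * expR y - (expR y - 1 - y)) x x0).
  + by rewrite expR0; ring.
  + by move=> y; apply: is_derive_eq; rewrite /GRing.scale /=; field.
  + move=> y y0; have /andP[_] := expR_taylor1_ge0 y0; have e0 := expR_gt0 y.
    have : 0 <= y ^+ 2 * expR y by rewrite mulr_ge0 ?sqr_ge0// ltW.
    have : 0 <= y ^+ 3 * expR y by rewrite mulr_ge0 ?exprn_ge0// ltW.
    lra.
Qed.

Lemma expR_taylor1_le0 x : 0 <= x -> 0 <= expR (- x) - 1 + x <= x ^+ 2.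
Proof.
move=> x0; apply/andP; split; first by have := expR_ge1Dx (- x); lra.
rewrite -subr_ge0.
apply: (@is_derive_ge0 (fun y => y ^+ 2 - (expR (- y) - 1 + y))
  (fun y => y *+ 2 + expR (- y) - 1) x x0).
- by rewrite oppr0 expR0; ring.
- by move=> y; apply: is_derive_eq; rewrite /GRing.scale /=; ring.
- by move=> y y0; have := expR_ge1Dx (- y); rewrite mulr2n; lra.
Qed.

Lemma expR_taylor2_le0 x : 0 <= x ->
  0 <= 1 - x + x ^+ 2 / 2 - expR (- x) <= x ^+ 3.
Proof.
move=> x0; apply/andP; split.
- apply: (@is_derive_ge0 (fun y => 1 - y + y ^+ 2 / 2 - expR (- y))
    (fun y => expR (- y) - 1 + y) x x0).
  + by rewrite oppr0 expR0; ring.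
  + by move=> y; apply: is_derive_eq; rewrite /GRing.scale /=; field.
  + by move=> y /expR_taylor1_le0/andP[].
- rewrite -subr_ge0; apply: (@is_derive_ge0
    (fun y => y ^+ 3 - (1 - y + y ^+ 2 / 2 - expR (- y)))
    (fun y => 3 * y ^+ 2 - (expR (- y) - 1 + y)) x x0).
  + by rewrite oppr0 expR0; ring.
  + by move=> y; apply: is_derive_eq; rewrite /GRing.scale /=; field.
  + move=> y y0; have /andP[_] := expR_taylor1_le0 y0.
    have := sqr_ge0 y; lra.
Qed.

(** Only an upper bound on [u] enters here and in the next two bounds, so that they are uniform on
    half-lines along which the exponent tends to minus infinity. *)
Lemma expR_taylor0 u M : 0 <= M -> u <= M -> `|expR u - 1| <= `|u| * expR M.
Proof.
move=> M0 uM; have M1 : 1 <= expR M by rewrite -expR0 ler_expR.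
have [u0|/ltW u0] := leP 0 u.
  rewrite ger0_norm ?subr_ge0 -?expR0 ?ler_expR// expR0 ger0_norm//.
  apply: (le_trans (expR_sub1_le u0)).
  by rewrite ler_wpM2l// ler_expR.
rewrite ler0_norm ?subr_le0 -?expR0 ?ler_expR// expR0 ler0_norm//.
have := expR_ge1Dx u; nra.
Qed.

Lemma expR_taylor1 u M : 0 <= M -> u <= M ->
  `|expR u - 1 - u| <= `|u| ^+ 2 * expR M.
Proof.
move=> M0 uM; have M1 : 1 <= expR M by rewrite -expR0 ler_expR.
have [u0|/ltW u0] := leP 0 u.
  have /andP[h1 h2] := expR_taylor1_ge0 u0.
  rewrite !ger0_norm//; apply: (le_trans h2).
  by rewrite ler_wpM2l ?sqr_ge0// ler_expR.
have Nu0 : 0 <= - u by rewrite oppr_ge0.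
have /andP[] := expR_taylor1_le0 Nu0; rewrite opprK sqrrN => h1 h2.
rewrite ger0_norm// ler0_norm// sqrrN; apply: (le_trans h2).
by rewrite ler_peMr// sqr_ge0.
Qed.

Lemma expR_taylor2 u M : 0 <= M -> u <= M ->
  `|expR u - 1 - u - u ^+ 2 / 2| <= `|u| ^+ 3 * expR M.
Proof.
move=> M0 uM; have M1 : 1 <= expR M by rewrite -expR0 ler_expR.
have [u0|/ltW u0] := leP 0 u.
  have /andP[h1 h2] := expR_taylor2_ge0 u0.
  rewrite !ger0_norm//; apply: (le_trans h2).
  by rewrite ler_wpM2l ?exprn_ge0// ler_expR.
have Nu0 : 0 <= - u by rewrite oppr_ge0.
have /andP[] := expR_taylor2_le0 Nu0; rewrite !opprK sqrrN => h1 h2.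
rewrite ler0_norm; last by lra.
rewrite (ler0_norm u0); apply: le_trans (_ : (- u) ^+ 3 <= _).
  by move: h2; lra.
by rewrite ler_peMr// exprn_ge0.
Qed.

(** Cubing [x / 3 <= expR (x / 3)] gives the constant 27. *)
Lemma cube_le_expR x : 0 <= x -> x ^+ 3 <= 27 * expR x.
Proof.
move=> x0; have -> : expR x = expR (x / 3) ^+ 3.
  by rewrite -expRM_natl; congr expR; field.
have -> : 27 = 3 ^+ 3 :> R by ring.
rewrite -exprMn lerXn2r ?nnegrE ?mulr_ge0 ?expR_ge0//.
have := expR_ge1Dx (x / 3); lra.
Qed.

End exponential_taylor.

(** * Second-order Taylor bounds and their gluing *)

Section jets.
Context {R : realType}.
Implicit Types (K : R) (S : R -> Prop) (V v z : R -> R).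

(** A Whitney jet of order two on [S], with [v] and [z] in place of the first two derivatives of
    [V]. Being algebraic, the notion passes from two adjacent intervals to their union. *)
Definition jet K S V v z := forall x y, S x -> S y ->
  [/\ `|z y - z x| <= K * `|y - x|,
      `|v y - v x| <= K * `|y - x|,
      `|v y - v x - z x * (y - x)| <= K * `|y - x| ^+ 2 &
      `|V y - V x - v x * (y - x) - z x * (y - x) ^+ 2 / 2|
        <= K * `|y - x| ^+ 3].

Lemma jet_le K K' S V v z : K <= K' -> jet K S V v z -> jet K' S V v z.
Proof.
move=> KK' J x y Sx Sy; have [h1 h2 h3 h4] := J x y Sx Sy.
by split; [apply: (le_trans h1)|apply: (le_trans h2)|apply: (le_trans h3)
  |apply: (le_trans h4)]; rewrite ler_wpM2r ?exprn_ge0.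
Qed.

Lemma jet_ext K S V v z V' v' z' :
  (forall x, S x -> [/\ V x = V' x, v x = v' x & z x = z' x]) ->
  jet K S V v z -> jet K S V' v' z'.
Proof.
move=> E J x y Sx Sy; have [<- <- <-] := E x Sx; have [<- <- <-] := E y Sy.
exact: J.
Qed.

Lemma jetD K1 K2 S V1 v1 z1 V2 v2 z2 :
  jet K1 S V1 v1 z1 -> jet K2 S V2 v2 z2 ->
  jet (K1 + K2) S (V1 \+ V2) (v1 \+ v2) (z1 \+ z2).
Proof.
move=> J1 J2 x y Sx Sy; have [h1 h2 h3 h4] := J1 x y Sx Sy.
have [g1 g2 g3 g4] := J2 x y Sx Sy; rewrite /=.
have add (a b c A B C : R) : c = a + b -> C = A + B ->
    `|a| <= A -> `|b| <= B -> `|c| <= C.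
  by move=> -> -> aA bB; apply: le_trans (ler_normD _ _) (lerD aA bB).
by split; [apply: add h1 g1|apply: add h2 g2|apply: add h3 g3
  |apply: add h4 g4]; ring.
Qed.

Lemma jet_affine S (m k : R) :
  jet 0 S (fun x => m + k * x) (fun=> k) (fun=> 0).
Proof.
move=> x y _ _; split; rewrite ?mul0r normr_le0; apply/eqP; ring.
Qed.

(** Once the exponential at [x] is factored out, the bounds are those on [expR u] for
    [u = rho * (y - x)]. The bound on the increment of [v] costs a factor [rho ^+ 2] and the three
    others [rho ^+ 3], hence the sum in the constant. *)
Lemma jet_exp S (q rho x0 M : R) :
  (forall x, S x -> rho * (x - x0) <= M) ->
  jet (`|q| * (`|rho| ^+ 2 + `|rho| ^+ 3) * expR M) S
    (fun x => q * expR (rho * (x - x0)))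
    (fun x => q * rho * expR (rho * (x - x0)))
    (fun x => q * rho ^+ 2 * expR (rho * (x - x0))).
Proof.
move=> SM x y Sx Sy.
set u := rho * (y - x).
(* With this [m], the product [E * expR m] is the larger of the exponentials at [x] and at [y],
   hence at most [expR M]. *)
set m := Num.max u 0.
have m0 : 0 <= m by rewrite le_max lexx orbT.
have um : u <= m by rewrite le_max lexx.
have EE : expR (rho * (y - x0)) = expR (rho * (x - x0)) * expR u.
  by rewrite -expRD; congr expR; rewrite /u; ring.
set E := expR (rho * (x - x0)) in EE *.
have E0 : 0 < E by exact: expR_gt0.
have EM : E * expR m <= expR M.
  rewrite /m; have [u0|u0] := leP u 0.
    by rewrite expR0 mulr1 /E ler_expR SM.
  by rewrite -EE ler_expR SM.
have nu : `|u| = `|rho| * `|y - x| by rewrite /u normrM.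
have aux n (e : R) (c : R) : `|e| <= `|u| ^+ n * expR m -> 0 <= c ->
  c * `|rho| ^+ n <= `|q| * (`|rho| ^+ 2 + `|rho| ^+ 3) ->
  c * (E * `|e|) <= `|q| * (`|rho| ^+ 2 + `|rho| ^+ 3) * expR M * `|y - x| ^+ n.
  move=> he c0 hc.
  apply: (@le_trans _ _ (c * (E * (`|u| ^+ n * expR m)))).
    by rewrite ler_wpM2l// ler_wpM2l// ltW.
  rewrite nu exprMn.
  have -> : c * (E * (`|rho| ^+ n * `|y - x| ^+ n * expR m)) =
    c * `|rho| ^+ n * (E * expR m) * `|y - x| ^+ n by ring.
  rewrite ler_wpM2r ?exprn_ge0// ler_pM//.
    by rewrite mulr_ge0 ?exprn_ge0.
  by rewrite mulr_ge0 ?expR_ge0.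
have t0 := expR_taylor0 m0 um.
have t1 := expR_taylor1 m0 um.
have t2 := expR_taylor2 m0 um.
rewrite EE; split.
- have -> : q * rho ^+ 2 * (E * expR u) - q * rho ^+ 2 * E =
    q * rho ^+ 2 * (E * (expR u - 1)) by ring.
  rewrite !normrM (gtr0_norm E0) -[X in _ <= _ * X]expr1; apply: aux => //.
  have -> : `|q| * (`|rho| * `|rho|) * `|rho| ^+ 1 = `|q| * `|rho| ^+ 3 by ring.
  by rewrite ler_wpM2l// lerDr exprn_ge0.
- have -> : q * rho * (E * expR u) - q * rho * E =
    q * rho * (E * (expR u - 1)) by ring.
  rewrite !normrM (gtr0_norm E0) -[X in _ <= _ * X]expr1; apply: aux => //.
  by rewrite expr1 -mulrA -expr2 ler_wpM2l// lerDl exprn_ge0.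
- have -> : q * rho * (E * expR u) - q * rho * E - q * rho ^+ 2 * E * (y - x) =
    q * rho * (E * (expR u - 1 - u)) by rewrite /u; ring.
  rewrite !normrM (gtr0_norm E0); apply: aux => //.
  by rewrite -mulrA -exprS ler_wpM2l// lerDr exprn_ge0.
- have -> : q * (E * expR u) - q * E - q * rho * E * (y - x) -
     q * rho ^+ 2 * E * (y - x) ^+ 2 / 2 =
    q * (E * (expR u - 1 - u - u ^+ 2 / 2)) by rewrite /u; ring.
  rewrite !normrM (gtr0_norm E0); apply: aux => //.
  by rewrite ler_wpM2l// lerDr exprn_ge0.
Qed.

(** Expanding at the intermediate point [c] leaves cross terms, which are dominated by the mixed
    terms of [K * (d1 + d2) ^+ n]; so the constant [K] does not grow. *)
Lemma jet_through K S1 S2 V v z c x y : jet K S1 V v z -> jet K S2 V v z ->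
  S1 x -> S1 c -> S2 c -> S2 y -> `|y - x| = `|c - x| + `|y - c| ->
  [/\ `|z y - z x| <= K * `|y - x|,
      `|v y - v x| <= K * `|y - x|,
      `|v y - v x - z x * (y - x)| <= K * `|y - x| ^+ 2 &
      `|V y - V x - v x * (y - x) - z x * (y - x) ^+ 2 / 2|
        <= K * `|y - x| ^+ 3].
Proof.
move=> J1 J2 Sx Sc1 Sc2 Sy ->.
have [a1 a2 a3 a4] := J1 x c Sx Sc1; have [b1 b2 b3 b4] := J2 c y Sc2 Sy.
set d1 := `|c - x| in a1 a2 a3 a4 *; set d2 := `|y - c| in b1 b2 b3 b4 *.
have d10 : 0 <= d1 := normr_ge0 _.
have d20 : 0 <= d2 := normr_ge0 _.
split.
- have -> : z y - z x = (z c - z x) + (z y - z c) by ring.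
  by apply: (le_trans (ler_normD _ _)); rewrite mulrDr lerD.
- have -> : v y - v x = (v c - v x) + (v y - v c) by ring.
  by apply: (le_trans (ler_normD _ _)); rewrite mulrDr lerD.
- have -> : v y - v x - z x * (y - x) = (v c - v x - z x * (c - x)) +
    (v y - v c - z c * (y - c)) + (z c - z x) * (y - c) by ring.
  apply: (le_trans (ler_normD _ _)).
  apply: (le_trans (lerD (ler_normD _ _) (lexx _))).
  rewrite normrM -/d2.
  have h : `|z c - z x| * d2 <= K * d1 * d2 by rewrite ler_wpM2r.
  apply: (le_trans (lerD (lerD a3 b3) h)).
  have K0 : 0 <= K * d1 * d2 by apply: le_trans h; rewrite mulr_ge0.
  by move: K0; rewrite sqrrD; lra.
- have -> : V y - V x - v x * (y - x) - z x * (y - x) ^+ 2 / 2 =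
    (V c - V x - v x * (c - x) - z x * (c - x) ^+ 2 / 2) +
    (V y - V c - v c * (y - c) - z c * (y - c) ^+ 2 / 2) +
    ((v c - v x - z x * (c - x)) * (y - c) +
     (z c - z x) * ((y - c) ^+ 2 / 2)) by field.
  apply: (le_trans (ler_normD _ _)).
  apply: (le_trans (lerD (ler_normD _ _) (ler_normD _ _))).
  have d22 : `|(y - c) ^+ 2 / 2| = d2 ^+ 2 / 2.
    by rewrite normrM normfV normrX (ger0_norm (_ : 0 <= 2)).
  rewrite [`|(v c - _ - _) * _|]normrM [`|(z c - z x) * _|]normrM d22 -/d2.
  have h : `|z c - z x| * (d2 ^+ 2 / 2) <= K * d1 * (d2 ^+ 2 / 2).
    by rewrite ler_wpM2r// divr_ge0 ?exprn_ge0.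
  have h' : `|v c - v x - z x * (c - x)| * d2 <= K * d1 ^+ 2 * d2.
    by rewrite ler_wpM2r.
  apply: (le_trans (lerD (lerD a4 b4) (lerD h' h))).
  have K0 : 0 <= K * d1 * (d2 ^+ 2 / 2).
    by apply: le_trans h; rewrite mulr_ge0// divr_ge0 ?exprn_ge0.
  have K1 : 0 <= K * d1 ^+ 2 * d2 by apply: le_trans h'; rewrite mulr_ge0.
  have -> : K * (d1 + d2) ^+ 3 = K * d1 ^+ 3 + K * d2 ^+ 3 +
    3 * (K * d1 ^+ 2 * d2) + 6 * (K * d1 * (d2 ^+ 2 / 2)) by field.
  lra.
Qed.

Lemma jet_glue K S1 S2 V v z c : jet K S1 V v z -> jet K S2 V v z ->
  S1 c -> S2 c -> (forall x, S1 x -> x <= c) -> (forall x, S2 x -> c <= x) ->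
  jet K (fun x => S1 x \/ S2 x) V v z.
Proof.
move=> J1 J2 c1 c2 le1 le2 x y [Sx|Sx] [Sy|Sy].
- exact: J1.
- apply: (jet_through J1 J2 Sx c1 c2 Sy).
  have := le1 _ Sx; have := le2 _ Sy => *.
  by rewrite !ger0_norm; lra.
- apply: (jet_through J2 J1 Sx c2 c1 Sy).
  have := le1 _ Sy; have := le2 _ Sx => *.
  by rewrite !ler0_norm; lra.
- exact: J2.
Qed.

End jets.

(** * Exponential pieces of the value function *)

Section gluing.
Context {R : realType}.
Implicit Types (x k a rho : R).

Definition glue3 (c1 c2 : R) (f1 f2 f3 : R -> R) x :=
  if x < c1 then f1 x else if x < c2 then f2 x else f3 x.

Lemma glue3E (c1 c2 : R) (f1 f2 f3 : R -> R) : c1 <= c2 ->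
  f1 c1 = f2 c1 -> f2 c2 = f3 c2 ->
  [/\ forall x, x <= c1 -> glue3 c1 c2 f1 f2 f3 x = f1 x,
      forall x, c1 <= x <= c2 -> glue3 c1 c2 f1 f2 f3 x = f2 x &
      forall x, c2 <= x -> glue3 c1 c2 f1 f2 f3 x = f3 x].
Proof.
move=> c12 e1 e2; rewrite /glue3; split=> x.
- rewrite le_eqVlt => /orP[/eqP->|->//]; rewrite ltxx.
  case: ltP => // c21; rewrite e1; move: e2.
  by rewrite (le_anti (introT andP (conj c12 c21))).
- case/andP=> c1x; rewrite ltNge c1x /= le_eqVlt => /orP[/eqP->|->//].
  by rewrite ltxx e2.
- by move=> c2x; rewrite !ltNge (le_trans c12 c2x) c2x.
Qed.

(** Where the equation for [V] is linear, differentiating it gives [sigma ^+ 2 / 2 * v'' - beta * v'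
    - alpha * v + C = 0]. Its solutions are the constant [C / alpha] plus exponentials whose
    exponents satisfy [is_root]. *)
Definition exp_sum k a1 rho1 a2 rho2 (x0 x : R) :=
  k + a1 * expR (rho1 * (x - x0)) + a2 * expR (rho2 * (x - x0)).

Definition is_root (alpha sigma beta rho : R) :=
  sigma ^+ 2 / 2 * rho ^+ 2 = beta * rho + alpha.

(** Here [V] is given by the equation and not as an antiderivative of [v]. The characteristic
    equation identifies it with the antiderivative whose coefficients are [a1 / rho1] and
    [a2 / rho2], up to an affine term with slope [k]. *)
Lemma jet_piece (alpha sigma beta C e k a1 rho1 a2 rho2 x0 M : R)
    (S : R -> Prop) (V v z : R -> R) : alpha != 0 -> rho1 != 0 -> rho2 != 0 ->
  is_root alpha sigma beta rho1 -> is_root alpha sigma beta rho2 ->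
  alpha * k = C ->
  (forall x, S x -> rho1 * (x - x0) <= M /\ rho2 * (x - x0) <= M) ->
  (forall x, S x ->
    [/\ v x = exp_sum k a1 rho1 a2 rho2 x0 x,
        z x = exp_sum 0 (a1 * rho1) rho1 (a2 * rho2) rho2 x0 x &
        alpha * V x = sigma ^+ 2 / 2 * z x - beta * v x + C * x + e]) ->
  exists K, jet K S V v z.
Proof.
move=> al0 rho10 rho20 root1 root2 kC SM SE.
have J1 := @jet_exp R S (a1 / rho1) rho1 x0 M (fun x Sx => (SM x Sx).1).
have J2 := @jet_exp R S (a2 / rho2) rho2 x0 M (fun x Sx => (SM x Sx).2).
have J0 := @jet_affine R S ((e - beta * k) / alpha) k.
have J := jetD (jetD J0 J1) J2.
eexists; apply: jet_ext J => x Sx; have [vE zE VE] := SE x Sx; split => /=.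
- apply: (mulfI al0); rewrite VE zE vE -kC /exp_sum.
  set E1 := expR _; set E2 := expR _.
  have -> : sigma ^+ 2 / 2 * (0 + a1 * rho1 * E1 + a2 * rho2 * E2)
    = a1 / rho1 * (sigma ^+ 2 / 2 * rho1 ^+ 2) * E1 +
      a2 / rho2 * (sigma ^+ 2 / 2 * rho2 ^+ 2) * E2 by field; rewrite ?rho10 ?rho20.
  rewrite root1 root2; by field; rewrite ?rho10 ?rho20 ?al0.
- by rewrite vE /exp_sum; field; rewrite ?rho10 ?rho20.
- by rewrite zE /exp_sum; field; rewrite ?rho10 ?rho20.
Qed.

Lemma jet_glue3 (K1 K2 K3 c1 c2 : R) (V v z : R -> R) : c1 <= c2 ->
  jet K1 (fun x => x <= c1) V v z -> jet K2 (fun x => c1 <= x <= c2) V v z ->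
  jet K3 (fun x => c2 <= x) V v z -> exists K, jet K (fun=> True) V v z.
Proof.
move=> c12 J1 J2 J3; pose K := Num.max K1 (Num.max K2 K3).
have le1 : K1 <= K by rewrite le_max lexx.
have le2 : K2 <= K by rewrite !le_max lexx orbT.
have le3 : K3 <= K by rewrite !le_max lexx !orbT.
have J12 := jet_glue (jet_le le1 J1) (jet_le le2 J2) (lexx c1).
have {}J12 := J12 (introT andP (conj (lexx _) c12)) (fun x h => h)
  (fun x h => proj1 (andP h)).
have J := jet_glue J12 (jet_le le3 J3)
  (or_intror (introT andP (conj c12 (lexx _)))) (lexx c2).
exists K => x y _ _; apply: J => //.
- by move=> t [/le_trans->//|/andP[]].
- case: (leP x c1) => [|/ltW x1]; first by left; left.
  by case: (leP x c2) => [x2|/ltW]; [left; right; rewrite x1|right].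
- case: (leP y c1) => [|/ltW x1]; first by left; left.
  by case: (leP y c2) => [x2|/ltW]; [left; right; rewrite x1|right].
Qed.

End gluing.

(** * Solution of the Hamilton-Jacobi-Bellman equation *)

Section value_function.
Context {R : realType}.
Variables (alpha b sigma thu Ip Cplus Cminus : R).

Definition holding_cost (x : R) :=
  Cplus * Num.max x 0 + Cminus * - Num.min x 0.

(* [V] stands for the value function and [v], [z] for its first two derivatives;
   Taylor bounds replace differentiability, so that the pieces can be glued by
   algebra alone. *)
Record hjb_solution (L K : R) (V v z : R -> R) : Prop := {
  hjb_taylor : forall x y,
    `|V y - V x - v x * (y - x) - z x * (y - x) ^+ 2 / 2| <= K * `|y - x| ^+ 3 ;
  hjb_v_lip : forall x y, `|v y - v x| <= K * `|y - x| ;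
  hjb_z_lip : forall x y, `|z y - z x| <= K * `|y - x| ;
  hjb_v_bound : forall x, `|v x| <= K ;
  hjb_z_bound : forall x, `|z x| <= K ;
  hjb_eq : forall x, alpha * V x = sigma ^+ 2 / 2 * z x - b * v x +
    holding_cost x + thu * Num.min (v x + Ip) 0 ;
  hjb_v_ub : forall x, v x <= Cplus / alpha ;
  hjb_v_below : forall x, x < L -> v x <= - Ip ;
  hjb_v_above : forall x, L <= x -> - Ip <= v x }.

(** The Lipschitz bounds of a jet make [z] bounded, and they give a lower bound of [v] on the
    compact interval from [c1] to [c2]; outside it [m] is one. *)
Lemma hjb_solution_jet (L K c1 c2 m : R) (V v z : R -> R) : c1 <= c2 ->
  jet K (fun=> True) V v z ->
  (forall x, alpha * V x = sigma ^+ 2 / 2 * z x - b * v x +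
    holding_cost x + thu * Num.min (v x + Ip) 0) ->
  (forall x, v x <= Cplus / alpha) ->
  (forall x, x < L -> v x <= - Ip) ->
  (forall x, L <= x -> - Ip <= v x) ->
  (forall x, (x <= c1 \/ c2 <= x) -> m <= v x) ->
  exists K', hjb_solution L K' V v z.
Proof.
move=> c12 J eqV vub vlo vhi mv.
have K0 : 0 <= K.
  have [h _ _ _] := J 0 1 I I.
  by move: h; rewrite subr0 normr1 mulr1; apply: le_trans.
have zb x : `|z x| <= K + K.
  have [_ h1 h2 _] := J x (x + 1) I I.
  move: h1 h2; rewrite addrAC subrr add0r normr1 expr1n !mulr1 => h1 h2.
  have -> : z x = (v (x + 1) - v x) - (v (x + 1) - v x - z x) by ring.
  by rewrite (le_trans (ler_normB _ _))// lerD.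
have vlb x : m - K * (c2 - c1) <= v x.
  have h0 : 0 <= K * (c2 - c1) by rewrite mulr_ge0// subr_ge0.
  case: (leP x c1) => [xc|xc]; first by have := mv x (or_introl xc); lra.
  case: (leP c2 x) => [cx|cx]; first by have := mv x (or_intror cx); lra.
  have [_ h _ _] := J c1 x I I.
  have := mv c1 (or_introl (lexx _)).
  have xc0 : 0 <= x - c1 by rewrite subr_ge0 ltW.
  move: h; rewrite (ger0_norm xc0) ler_norml => /andP[h _] h'.
  have : K * (x - c1) <= K * (c2 - c1) by rewrite ler_wpM2l// lerD2r ltW.
  by move: h h'; lra.
pose K' := K + K + `|Cplus / alpha| + `|m - K * (c2 - c1)|.
have KK' : K <= K'.
  rewrite /K' -!addrA lerDl !addr_ge0//.
exists K'; split => //.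
- by move=> x y; have [_ _ _ h] := jet_le KK' J (x := x) (y := y) I I.
- by move=> x y; have [_ h _ _] := jet_le KK' J (x := x) (y := y) I I.
- by move=> x y; have [h _ _ _] := jet_le KK' J (x := x) (y := y) I I.
- move=> x; have := vub x; have := vlb x; rewrite ler_norml /K'.
  have := ler_norm (Cplus / alpha); have := ler_norm (- (m - K * (c2 - c1))).
  rewrite normrN.
  have := normr_ge0 (Cplus / alpha); have := normr_ge0 (m - K * (c2 - c1)).
  by move=> *; apply/andP; split; lra.
- by move=> x; apply: (le_trans (zb x)); rewrite /K' -addrA lerDl addr_ge0.
Qed.

Hypotheses (alpha0 : 0 < alpha) (sigma0 : 0 < sigma) (thu0 : 0 < thu)
  (Ip0 : 0 <= Ip) (Cplus0 : 0 < Cplus) (CminusI : alpha * Ip < Cminus).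
Variables (r1 r2 s1 s2 : R).
Hypotheses (r10 : 0 < r1) (r20 : r2 < 0) (s10 : 0 < s1) (s20 : s2 < 0).
Hypotheses (root_r1 : is_root alpha sigma b r1)
  (root_r2 : is_root alpha sigma b r2)
  (root_s1 : is_root alpha sigma (b - thu) s1)
  (root_s2 : is_root alpha sigma (b - thu) s2).

Let sigma20 : 0 < sigma ^+ 2 / 2.
Proof. by rewrite divr_gt0 ?exprn_gt0. Qed.

(** Eliminating the squares between the two characteristic equations leaves an identity whose sides
    would have opposite signs if the order were reversed. The same argument orders the negative
    roots. *)
Lemma root_order_pos : s1 < r1.
Proof.
rewrite ltNge; apply/negP => rs.
have E : sigma ^+ 2 / 2 * r1 * s1 * (s1 - r1)
  = - thu * (r1 * s1) + alpha * (r1 - s1).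
  have -> : sigma ^+ 2 / 2 * r1 * s1 * (s1 - r1) =
    r1 * (sigma ^+ 2 / 2 * s1 ^+ 2) - s1 * (sigma ^+ 2 / 2 * r1 ^+ 2) by ring.
  by rewrite root_s1 root_r1; ring.
have h1 : 0 <= sigma ^+ 2 / 2 * r1 * s1 * (s1 - r1).
  by rewrite !mulr_ge0 ?subr_ge0// ltW.
have h2 : 0 < thu * (r1 * s1) by rewrite !mulr_gt0.
have h3 : 0 <= alpha * (s1 - r1) by rewrite mulr_ge0 ?subr_ge0// ltW.
by move: h1; rewrite E; lra.
Qed.

Lemma root_order_neg : s2 < r2.
Proof.
rewrite ltNge; apply/negP => rs.
have E : sigma ^+ 2 / 2 * (r2 * s2) * (s2 - r2)
  = - thu * (r2 * s2) + alpha * (r2 - s2).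
  have -> : sigma ^+ 2 / 2 * (r2 * s2) * (s2 - r2) =
    r2 * (sigma ^+ 2 / 2 * s2 ^+ 2) - s2 * (sigma ^+ 2 / 2 * r2 ^+ 2) by ring.
  by rewrite root_s2 root_r2; ring.
have h0 : 0 < r2 * s2 by rewrite nmulr_rgt0.
have h1 : 0 <= sigma ^+ 2 / 2 * (r2 * s2) * (s2 - r2).
  by rewrite mulr_ge0 ?subr_ge0// mulr_ge0 ?(ltW h0)// ltW.
have h2 : 0 < thu * (r2 * s2) by rewrite mulr_gt0.
have h3 : 0 <= alpha * (s2 - r2) by rewrite mulr_ge0 ?subr_ge0// ltW.
by move: h1; rewrite E; lra.
Qed.

Let min_le0 (x : R) : x <= - Ip -> Num.min (x + Ip) 0 = x + Ip.
Proof. by move=> h; apply/min_idPl; lra. Qed.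

Let min_ge0 (x : R) : - Ip <= x -> Num.min (x + Ip) 0 = 0.
Proof. by move=> h; apply/min_idPr; lra. Qed.

Let holding_pos (x : R) : 0 <= x -> holding_cost x = Cplus * x.
Proof.
by move=> h; rewrite /holding_cost (max_idPl h) (min_idPr h); ring.
Qed.

Let holding_neg (x : R) : x <= 0 -> holding_cost x = - Cminus * x.
Proof.
by move=> h; rewrite /holding_cost (max_idPr h) (min_idPl h); ring.
Qed.

(* [v] is a combination of exponentials with exponents [s1] on ]-oo, 0], [s1] and [s2]
   on [0, L], [r2] on [L, +oo[; the equation for [L] is the smooth fit at 0. *)
Lemma hjb_solution_nonneg (L : R) : 0 <= L ->
  (alpha * Ip + Cplus) * (s1 - r2) * expR (- (s2 * L)) = (Cplus + Cminus) * s1 ->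
  exists K V v z, hjb_solution L K V v z.
Proof.
move=> L0 EL; have [[[r1p r2n] s1p] s2n] := (r10, r20, s10, s20).
have s2r2 := root_order_neg.
have al0 : alpha != 0 by rewrite gt_eqF.
have s12 : s1 - s2 != 0 by rewrite subr_eq0 gt_eqF// (lt_trans s20).
(* [kp] and [km] are the limits of [v] at plus and minus infinity. [A] makes [v] equal to [- Ip] at
   [L], and [a], [c] match the value and the slope there. *)
pose kp := Cplus / alpha; pose km := - Cminus / alpha.
pose A := - (Ip + kp).
pose a := A * (r2 - s2) / (s1 - s2); pose c := A * (s1 - r2) / (s1 - s2).
have A0 : A < 0 by rewrite /A oppr_lt0 ltr_wpDl// divr_gt0.
have a0 : a < 0.
  by rewrite /a pmulr_llt0 ?invr_gt0 ?subr_gt0 ?nmulr_rlt0 ?subr_gt0//; lra.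
have c0 : c < 0.
  by rewrite /c pmulr_llt0 ?invr_gt0 ?subr_gt0 ?nmulr_rlt0 ?subr_gt0//; lra.
have acA : a + c = A by rewrite /a /c; field.
have acAr : a * s1 + c * s2 = A * r2 by rewrite /a /c; field.
have Ar0 : 0 < A * r2 by rewrite nmulr_rgt0.
pose e1 := expR (s1 * (0 - L)); pose e2 := expR (s2 * (0 - L)).
pose B := kp - km + a * e1 + c * e2.
(* [B] matches the values of [v] at 0; that the slopes match as well is exactly the equation [EL]
   for [L]. *)
have BE : B * s1 = a * s1 * e1 + c * s2 * e2.
  have : s1 * (kp - km) + (s1 - s2) * c * e2 = 0.
    have -> : e2 = expR (- (s2 * L)) by rewrite /e2; congr expR; ring.
    have -> : s1 * (kp - km) = (Cplus + Cminus) * s1 / alpha.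
      by rewrite /kp /km; field.
    by rewrite -EL /c /A /kp; field; rewrite s12.
  by rewrite /B; lra.
have e1le : e1 <= 1 by rewrite expR_le1 pmulr_rle0//; lra.
have e2ge : 1 <= e2 by rewrite -expR0 ler_expR nmulr_rge0//; lra.
have B0 : 0 < B.
  rewrite -(pmulr_lgt0 _ s10) BE.
  have h1 : 0 <= a * s1 * (e1 - 1).
    by rewrite mulr_le0 ?subr_le0// nmulr_rle0// ltW.
  have h2 : c * s2 <= c * s2 * e2 by rewrite ler_peMr// nmulr_rge0 ?ltW.
  by lra.
(* The outer pieces get a second exponential with coefficient 0, so that [jet_piece] covers all
   three. *)
pose v1 := exp_sum km B s1 0 s1 0.
pose z1 := exp_sum 0 (B * s1) s1 (0 * s1) s1 0.
pose v2 := exp_sum kp a s1 c s2 L.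
pose z2 := exp_sum 0 (a * s1) s1 (c * s2) s2 L.
pose v3 := exp_sum kp A r2 0 r2 L.
pose z3 := exp_sum 0 (A * r2) r2 (0 * r2) r2 L.
have v12 : v1 0 = v2 0.
  by rewrite /v1 /v2 /exp_sum -/e1 -/e2 subrr !mulr0 expR0 /B; ring.
have z12 : z1 0 = z2 0.
  by rewrite /z1 /z2 /exp_sum -/e1 -/e2 subrr !mulr0 expR0 BE; ring.
have v23 : v2 L = v3 L.
  by rewrite /v2 /v3 /exp_sum subrr !mulr0 expR0 -acA; ring.
have z23 : z2 L = z3 L.
  by rewrite /z2 /z3 /exp_sum subrr !mulr0 expR0 -acAr; ring.
pose v := glue3 0 L v1 v2 v3; pose z := glue3 0 L z1 z2 z3.
have [vE1 vE2 vE3] := glue3E L0 v12 v23.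
have [zE1 zE2 zE3] := glue3E L0 z12 z23.
rewrite -/v -/z in vE1 vE2 vE3 zE1 zE2 zE3.
(* Both coefficients are negative, so [v2] is concave and lies below its tangent at [L], whose slope
   [A * r2] is positive. *)
have v2le x : 0 <= x <= L -> v2 x <= - Ip.
  move=> /andP[x0 xL].
  have h1 : a * expR (s1 * (x - L)) <= a * (1 + s1 * (x - L)).
    by rewrite ler_nM2l// expR_ge1Dx.
  have h2 : c * expR (s2 * (x - L)) <= c * (1 + s2 * (x - L)).
    by rewrite ler_nM2l// expR_ge1Dx.
  have h3 : (a * s1 + c * s2) * (x - L) <= 0.
    by rewrite acAr pmulr_rle0//; lra.
  have : kp + (a + c) = - Ip by rewrite acA /A; ring.
  by rewrite /v2 /exp_sum; lra.
have v1le x : x <= 0 -> v1 x <= - Ip.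
  move=> x0; apply: le_trans (v2le 0 _); last by rewrite lexx.
  rewrite -v12 /v1 /exp_sum !mul0r !addr0 subrr mulr0 expR0 lerD2l ler_pM2l//.
  by rewrite expR_le1 subr0 pmulr_rle0.
have v3ge x : L <= x -> - Ip <= v3 x <= kp.
  move=> Lx; rewrite /v3 /exp_sum mul0r addr0.
  have h1 : expR (r2 * (x - L)) <= 1 by rewrite expR_le1 nmulr_rle0 ?subr_ge0.
  have h2 := expR_gt0 (r2 * (x - L)).
  have h3 : A * 1 <= A * expR (r2 * (x - L)) by rewrite ler_nM2l.
  have h4 : A * expR (r2 * (x - L)) <= 0 by rewrite nmulr_rle0// ltW.
  by apply/andP; split; move: h3 h4; rewrite /A; lra.
have kp0 : 0 < kp by rewrite divr_gt0.
have vlo x : x < L -> v x <= - Ip.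
  move=> xL; case: (leP x 0) => x0; first by rewrite vE1// v1le.
  by rewrite vE2 ?v2le// ?ltW.
have vhi x : L <= x -> - Ip <= v x.
  by move=> Lx; rewrite vE3//; case/andP: (v3ge x Lx).
(* [V] is defined by the equation itself; the jets obtained below show that [v] and [z] act as its
   derivatives. *)
pose V x := (sigma ^+ 2 / 2 * z x - b * v x + holding_cost x +
  thu * Num.min (v x + Ip) 0) / alpha.
have VE x : alpha * V x = sigma ^+ 2 / 2 * z x - b * v x + holding_cost x +
    thu * Num.min (v x + Ip) 0 by rewrite /V mulrC divfK.
have [K1 J1] : exists K, jet K (fun x => x <= 0) V v z.
  apply: (@jet_piece _ alpha sigma (b - thu) (- Cminus) (thu * Ip)
    km B s1 0 s1 0 0) => //; rewrite ?gt_eqF//.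
  - by rewrite /km; field.
  - by move=> x x0; rewrite subr0 pmulr_rle0.
  - move=> x x0; rewrite VE vE1// zE1//; split=> //.
    by rewrite min_le0 ?v1le// holding_neg//; ring.
have [K2 J2] : exists K, jet K (fun x => 0 <= x <= L) V v z.
  apply: (@jet_piece _ alpha sigma (b - thu) Cplus (thu * Ip)
    kp a s1 c s2 L (- (s2 * L))) => //; rewrite ?(gt_eqF s10) ?(lt_eqF s20)//.
  - by rewrite /kp; field.
  - move=> x /andP[x0 xL]; split.
      apply: (@le_trans _ _ 0); first by rewrite pmulr_rle0// subr_le0.
      by rewrite -mulNr mulr_ge0// oppr_ge0 ltW.
    by rewrite mulrBr lerBlDr addrC subrr nmulr_rle0.
  - move=> x x0; rewrite VE vE2// zE2//; split=> //.
    by rewrite min_le0 ?v2le// holding_pos ?(andP x0).1//; ring.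
have [K3 J3] : exists K, jet K (fun x => L <= x) V v z.
  apply: (@jet_piece _ alpha sigma b Cplus 0
    kp A r2 0 r2 L 0) => //; rewrite ?(lt_eqF r20)//.
  - by rewrite /kp; field.
  - by move=> x xL; split; rewrite nmulr_rle0// subr_ge0.
  - move=> x x0; rewrite VE vE3// zE3//; split=> //.
    rewrite min_ge0 ?(andP (v3ge _ _)).1// holding_pos; last exact: le_trans x0.
    by ring.
have [K J] := jet_glue3 L0 J1 J2 J3.
have [||||K' H] := @hjb_solution_jet L K 0 L (Num.min km (- Ip)) V v z L0 J VE.
- move=> x; case: (leP L x) => [Lx|/vlo]; last by have := Ip0; rewrite -/kp; lra.
  by rewrite vE3//; case/andP: (v3ge x Lx).
- exact: vlo.
- exact: vhi.
- move=> x [x0|xL]; rewrite ge_min.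
    rewrite vE1// /v1 /exp_sum mul0r addr0 lerDl.
    by rewrite mulr_ge0 ?expR_ge0// ltW.
  by rewrite vhi ?orbT.
by exists K', V, v, z.
Qed.

(* [v] is a combination of exponentials with exponents [s1] on ]-oo, L], [r1] and [r2]
   on [L, 0], [r2] on [0, +oo[. *)
Lemma hjb_solution_neg (L : R) : L <= 0 ->
  (Cminus - alpha * Ip) * (s1 - r2) * expR (- (r1 * L)) =
    (Cplus + Cminus) * - r2 ->
  exists K V v z, hjb_solution L K V v z.
Proof.
move=> L0 EL; have [[[r1p r2n] s1p] s2n] := (r10, r20, s10, s20).
have s1r1 := root_order_pos.
have al0 : alpha != 0 by rewrite gt_eqF.
have r12 : r1 - r2 != 0 by rewrite subr_eq0 gt_eqF// (lt_trans r20).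
(* As before, [B] gives [v = - Ip] at [L] and [a], [c] match value and slope there; [E] matches the
   values at 0, and [EL] expresses the match of the slopes. *)
pose kp := Cplus / alpha; pose km := - Cminus / alpha.
pose B := - km - Ip.
pose a := B * (s1 - r2) / (r1 - r2); pose c := B * (r1 - s1) / (r1 - r2).
have B0 : 0 < B.
  by rewrite /B /km subr_gt0 mulNr opprK ltr_pdivlMr// mulrC.
have r12' : 0 < (r1 - r2)^-1 by rewrite invr_gt0; lra.
have a0 : 0 < a by rewrite /a !mulr_gt0//; lra.
have c0 : 0 < c by rewrite /c !mulr_gt0//; lra.
have acB : a + c = B by rewrite /a /c; field.
have acBs : a * r1 + c * r2 = B * s1 by rewrite /a /c; field.
have Bs0 : 0 < B * s1 by rewrite mulr_gt0.
pose e1 := expR (r1 * (0 - L)); pose e2 := expR (r2 * (0 - L)).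
pose E := km - kp + a * e1 + c * e2.
have EE : E * r2 = a * r1 * e1 + c * r2 * e2.
  have : r2 * (km - kp) = (r1 - r2) * a * e1.
    have -> : e1 = expR (- (r1 * L)) by rewrite /e1; congr expR; ring.
    have -> : r2 * (km - kp) = (Cplus + Cminus) * - r2 / alpha.
      by rewrite /kp /km; field.
    by rewrite -EL /a /B /km; field; rewrite r12.
  by rewrite /E; lra.
have e1ge : 1 <= e1 by rewrite -expR0 ler_expR mulr_ge0//; lra.
have e2le : e2 <= 1 by rewrite expR_le1 nmulr_rle0//; lra.
have E0 : E < 0.
  rewrite -(nmulr_lgt0 _ r20) EE.
  have h1 : a * r1 <= a * r1 * e1 by rewrite ler_peMr// mulr_ge0 ?ltW.
  have h2 : 0 <= c * r2 * (e2 - 1).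
    by rewrite mulr_le0 ?subr_le0// pmulr_rle0// ltW.
  by lra.
pose v1 := exp_sum km B s1 0 s1 L.
pose z1 := exp_sum 0 (B * s1) s1 (0 * s1) s1 L.
pose v2 := exp_sum km a r1 c r2 L.
pose z2 := exp_sum 0 (a * r1) r1 (c * r2) r2 L.
pose v3 := exp_sum kp E r2 0 r2 0.
pose z3 := exp_sum 0 (E * r2) r2 (0 * r2) r2 0.
have v12 : v1 L = v2 L.
  by rewrite /v1 /v2 /exp_sum subrr !mulr0 expR0 -acB; ring.
have z12 : z1 L = z2 L.
  by rewrite /z1 /z2 /exp_sum subrr !mulr0 expR0 -acBs; ring.
have v23 : v2 0 = v3 0.
  by rewrite /v2 /v3 /exp_sum -/e1 -/e2 subrr !mulr0 expR0 /E; ring.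
have z23 : z2 0 = z3 0.
  by rewrite /z2 /z3 /exp_sum -/e1 -/e2 subrr !mulr0 expR0 EE; ring.
pose v := glue3 L 0 v1 v2 v3; pose z := glue3 L 0 z1 z2 z3.
have [vE1 vE2 vE3] := glue3E L0 v12 v23.
have [zE1 zE2 zE3] := glue3E L0 z12 z23.
rewrite -/v -/z in vE1 vE2 vE3 zE1 zE2 zE3.
have v1le x : x <= L -> v1 x <= - Ip.
  move=> xL; have : expR (s1 * (x - L)) <= 1.
    by rewrite expR_le1 pmulr_rle0// subr_le0.
  rewrite -(ler_pM2l B0) /v1 /exp_sum /B; lra.
(* Both coefficients are positive now: [v2] is convex and lies above its tangent at [L], of positive
   slope [B * s1]. *)
have v2ge x : L <= x <= 0 -> - Ip <= v2 x.
  move=> /andP[Lx x0].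
  have h1 : a * (1 + r1 * (x - L)) <= a * expR (r1 * (x - L)).
    by rewrite ler_pM2l// expR_ge1Dx.
  have h2 : c * (1 + r2 * (x - L)) <= c * expR (r2 * (x - L)).
    by rewrite ler_pM2l// expR_ge1Dx.
  have h3 : 0 <= (a * r1 + c * r2) * (x - L).
    by rewrite acBs mulr_ge0 ?subr_ge0// ltW.
  have : km + (a + c) = - Ip by rewrite acB /B; ring.
  by rewrite /v2 /exp_sum; lra.
have v3ge x : 0 <= x -> - Ip <= v3 x <= kp.
  move=> x0; rewrite /v3 /exp_sum mul0r addr0.
  have h1 : expR (r2 * (x - 0)) <= 1 by rewrite expR_le1 nmulr_rle0 ?subr_ge0.
  have h2 := expR_gt0 (r2 * (x - 0)).
  have h3 : E * 1 <= E * expR (r2 * (x - 0)) by rewrite ler_nM2l.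
  have h4 : E * expR (r2 * (x - 0)) <= 0 by rewrite nmulr_rle0// ltW.
  have := v2ge 0; rewrite v23 L0 lexx => /(_ isT).
  rewrite /v3 /exp_sum subrr mulr0 expR0 => h5.
  by apply/andP; split; move: h3 h4 h5; lra.
(* By convexity the slope of [v2] stays at least [B * s1], so [v2] is largest at 0, where it equals
   [v3]. *)
have v2le x : L <= x <= 0 -> v2 x <= kp.
  move=> /andP[Lx x0].
  suff : v2 x <= v2 0.
    by rewrite v23 => /le_trans; apply; case/andP: (v3ge 0 (lexx _)).
  have f1 : 1 + r1 * (0 - x) <= expR (r1 * (0 - x)) by exact: expR_ge1Dx.
  have f2 : 1 + r2 * (0 - x) <= expR (r2 * (0 - x)) by exact: expR_ge1Dx.
  have g1 : 1 <= expR (r1 * (x - L)).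
    by rewrite -expR0 ler_expR mulr_ge0 ?subr_ge0// ltW.
  have g2 : expR (r2 * (x - L)) <= 1 by rewrite expR_le1 nmulr_rle0 ?subr_ge0.
  have g2' := expR_ge0 (r2 * (x - L)).
  have E1 : e1 = expR (r1 * (x - L)) * expR (r1 * (0 - x)).
    by rewrite -expRD; congr expR; ring.
  have E2 : e2 = expR (r2 * (x - L)) * expR (r2 * (0 - x)).
    by rewrite -expRD; congr expR; ring.
  rewrite /v2 /exp_sum -/e1 -/e2 E1 E2.
  move: f1 f2 g1 g2 g2'; set p := expR _; set q := expR _; set p' := expR _.
  set q' := expR _ => f1 f2 g1 g2 g2'.
  have y0 : 0 <= 0 - x by lra.
  have k1 : r1 * (0 - x) <= p' * p - p'.
    have : 0 <= r1 * (0 - x) by rewrite mulr_ge0// ltW.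
    nra.
  have k2 : r2 * (0 - x) <= q' * q - q'.
    have : r2 * (0 - x) <= 0 by rewrite nmulr_rle0.
    nra.
  have k3 : 0 <= (a * r1 + c * r2) * (0 - x) by rewrite acBs mulr_ge0// ltW.
  have k4 : a * (r1 * (0 - x)) <= a * (p' * p - p') by rewrite ler_pM2l.
  have k5 : c * (r2 * (0 - x)) <= c * (q' * q - q') by rewrite ler_pM2l.
  lra.
have kp0 : 0 < kp by rewrite divr_gt0.
have vlo x : x < L -> v x <= - Ip.
  by move=> /ltW xL; rewrite vE1// v1le.
have vhi x : L <= x -> - Ip <= v x.
  move=> Lx; case: (leP x 0) => [x0|/ltW x0]; first by rewrite vE2 ?v2ge ?Lx.
  by rewrite vE3//; case/andP: (v3ge x x0).
pose V x := (sigma ^+ 2 / 2 * z x - b * v x + holding_cost x +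
  thu * Num.min (v x + Ip) 0) / alpha.
have VE x : alpha * V x = sigma ^+ 2 / 2 * z x - b * v x + holding_cost x +
    thu * Num.min (v x + Ip) 0 by rewrite /V mulrC divfK.
have [K1 J1] : exists K, jet K (fun x => x <= L) V v z.
  apply: (@jet_piece _ alpha sigma (b - thu) (- Cminus) (thu * Ip)
    km B s1 0 s1 L 0) => //; rewrite ?gt_eqF//.
  - by rewrite /km; field.
  - by move=> x x0; rewrite pmulr_rle0// subr_le0.
  - move=> x x0; rewrite VE vE1// zE1//; split=> //.
    rewrite min_le0 ?v1le// holding_neg; last exact: le_trans L0.
    by ring.
have [K2 J2] : exists K, jet K (fun x => L <= x <= 0) V v z.
  apply: (@jet_piece _ alpha sigma b (- Cminus) 0
    km a r1 c r2 L (- (r1 * L))) => //; rewrite ?(gt_eqF r10) ?(lt_eqF r20)//.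
  - by rewrite /km; field.
  - move=> x /andP[Lx x0]; split.
      by rewrite mulrBr lerBlDr addrC subrr pmulr_rle0.
    apply: (@le_trans _ _ 0); first by rewrite nmulr_rle0// subr_ge0.
    by rewrite -mulrN mulr_ge0 ?oppr_ge0// ltW.
  - move=> x x0; rewrite VE vE2// zE2//; split=> //.
    by rewrite min_ge0 ?v2ge// holding_neg ?(andP x0).2//; ring.
have [K3 J3] : exists K, jet K (fun x => 0 <= x) V v z.
  apply: (@jet_piece _ alpha sigma b Cplus 0
    kp E r2 0 r2 0 0) => //; rewrite ?(lt_eqF r20)//.
  - by rewrite /kp; field.
  - by move=> x xL; split; rewrite nmulr_rle0// subr_ge0.
  - move=> x x0; rewrite VE vE3// zE3//; split=> //.
    by rewrite min_ge0 ?(andP (v3ge _ _)).1// holding_pos//; ring.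
have [K J] := jet_glue3 L0 J1 J2 J3.
have [||||K' H] := @hjb_solution_jet L K L 0 (Num.min km (- Ip)) V v z L0 J VE.
- move=> x; case: (leP L x) => [Lx|/vlo]; last by have := Ip0; rewrite -/kp; lra.
  case: (leP x 0) => [x0|/ltW x0]; first by rewrite vE2 ?v2le ?Lx.
  by rewrite vE3//; case/andP: (v3ge x x0).
- exact: vlo.
- exact: vhi.
- move=> x [xL|x0]; rewrite ge_min.
    rewrite vE1// /v1 /exp_sum mul0r addr0 lerDl.
    by rewrite mulr_ge0 ?expR_ge0// ltW.
  by rewrite vhi ?orbT// (le_trans L0).
by exists K', V, v, z.
Qed.

End value_function.

(** * Characteristic roots and the formula for the threshold *)

Section threshold_formula.
Context {R : realType}.

(** Since [alpha * sigma ^+ 2] is positive, the square root exceeds the absolute value of [beta],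
    and the roots have opposite signs. *)
Lemma char_roots (alpha sigma beta : R) : 0 < alpha -> 0 < sigma ->
  let q := Num.sqrt (beta ^+ 2 + 2 * alpha * sigma ^+ 2) in
  [/\ 0 < (beta + q) / sigma ^+ 2, (beta - q) / sigma ^+ 2 < 0,
      is_root alpha sigma beta ((beta + q) / sigma ^+ 2) &
      is_root alpha sigma beta ((beta - q) / sigma ^+ 2)].
Proof.
move=> al0 si0 q.
have s2 : 0 < sigma ^+ 2 by rewrite exprn_gt0.
have k0 : 0 < 2 * alpha * sigma ^+ 2 by rewrite !mulr_gt0.
have qq : q ^+ 2 = beta ^+ 2 + 2 * alpha * sigma ^+ 2.
  by rewrite sqr_sqrtr// addr_ge0 ?sqr_ge0// ltW.
have bq : `|beta| < q.
  rewrite -(ltr_pXn2r (n := 2)) ?nnegrE ?sqrtr_ge0// qq real_normK ?num_real//.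
  by rewrite ltrDl.
move: bq; rewrite ltr_norml => /andP[b1 b2].
have sn0 : sigma != 0 by rewrite gt_eqF.
split.
- by rewrite divr_gt0//; lra.
- by rewrite pmulr_llt0 ?invr_gt0//; lra.
- rewrite /is_root.
  have -> : sigma ^+ 2 / 2 * ((beta + q) / sigma ^+ 2) ^+ 2 =
    (beta ^+ 2 + 2 * beta * q + q ^+ 2) / (2 * sigma ^+ 2) by field.
  by rewrite qq; field.
- rewrite /is_root.
  have -> : sigma ^+ 2 / 2 * ((beta - q) / sigma ^+ 2) ^+ 2 =
    (beta ^+ 2 - 2 * beta * q + q ^+ 2) / (2 * sigma ^+ 2) by field.
  by rewrite qq; field.
Qed.

Lemma hjb_solution_exists (alpha b sigma thu Ip Cplus Cminus : R) :
  0 < alpha -> 0 < sigma -> 0 < thu -> 0 <= Ip -> 0 < Cplus ->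
  alpha * Ip < Cminus ->
  let r1 := (b + Num.sqrt (b ^+ 2 + 2 * alpha * sigma ^+ 2)) / sigma ^+ 2 in
  let r2 := (b - Num.sqrt (b ^+ 2 + 2 * alpha * sigma ^+ 2)) / sigma ^+ 2 in
  let s1 := (b - thu + Num.sqrt ((b - thu) ^+ 2 + 2 * alpha * sigma ^+ 2))
              / sigma ^+ 2 in
  let s2 := (b - thu - Num.sqrt ((b - thu) ^+ 2 + 2 * alpha * sigma ^+ 2))
              / sigma ^+ 2 in
  let B2 := (Cminus - alpha * Ip) * (s1 - r2) in
  let B3 := (Cplus + Cminus) * (- r2) in
  exists L : R,
    (exists K V v z,
      hjb_solution alpha b sigma thu Ip Cplus Cminus L K V v z) /\
    (B3 <= B2 ->
      L = s2^-1 * ln ((alpha * Ip + Cplus) * (s1 - r2) / ((Cplus + Cminus) * s1))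
      /\ 0 <= L) /\
    (B2 < B3 ->
      L = (- r1)^-1 * ln ((Cplus + Cminus) * (- r2)
                           / ((Cminus - alpha * Ip) * (s1 - r2)))
      /\ L < 0).
Proof.
move=> al0 si0 th0 Ip0 Cp0 CI r1 r2 s1 s2 B2 B3.
have [r10 r20 rr1 rr2] := char_roots b al0 si0.
have [s10 s20 rs1 rs2] := char_roots (b - thu) al0 si0.
rewrite -/r1 -/r2 -/s1 -/s2 in r10 r20 rr1 rr2 s10 s20 rs1 rs2.
have aI : 0 <= alpha * Ip by rewrite mulr_ge0// ltW.
have sr : 0 < s1 - r2 by lra.
have CC : 0 < Cplus + Cminus by lra.
case: (leP B3 B2) => [B32|B23]; last first.
  pose X := (Cplus + Cminus) * (- r2) / ((Cminus - alpha * Ip) * (s1 - r2)).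
  have den : 0 < (Cminus - alpha * Ip) * (s1 - r2) by rewrite mulr_gt0// subr_gt0.
  have X1 : 1 < X by rewrite /X ltr_pdivlMr// mul1r.
  have L0 : (- r1)^-1 * ln X < 0.
    by rewrite invrN mulNr oppr_lt0 mulr_gt0 ?invr_gt0// ln_gt0.
  exists ((- r1)^-1 * ln X); split; last by split.
  apply: (hjb_solution_neg al0 si0 th0 Ip0 Cp0 CI r10 r20 s10 s20 rr1 rr2 rs1).
    exact: ltW.
  have -> : - (r1 * ((- r1)^-1 * ln X)) = ln X by field; rewrite gt_eqF.
  rewrite lnK ?posrE ?(lt_trans _ X1)// /X mulrCA divff ?mulr1//.
  by rewrite gt_eqF.
pose X := (alpha * Ip + Cplus) * (s1 - r2) / ((Cplus + Cminus) * s1).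
have den : 0 < (Cplus + Cminus) * s1 by rewrite mulr_gt0.
have num : 0 < (alpha * Ip + Cplus) * (s1 - r2) by rewrite mulr_gt0//; lra.
have X0 : 0 < X by rewrite /X divr_gt0.
(* As [(alpha * Ip + Cplus) + (Cminus - alpha * Ip) = Cplus + Cminus], the condition [B3 <= B2] says
   precisely that the argument of the logarithm is at most 1. *)
have X1 : X <= 1.
  rewrite /X ler_pdivrMr// mul1r; move: B32; rewrite /B2 /B3.
  by rewrite !(mulrDl, mulrDr, mulrBl, mulrBr); lra.
have L0 : 0 <= s2^-1 * ln X.
  by apply: mulr_le0; rewrite ?invr_le0 ?(ltW s20) ?ln_le0.
exists (s2^-1 * ln X); split; last by split.
apply: (hjb_solution_nonneg al0 si0 th0 Ip0 Cp0 r10 r20 s10 s20 rr2 rs1 rs2 L0).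
have -> : - (s2 * (s2^-1 * ln X)) = - ln X by field; rewrite lt_eqF.
rewrite expRN lnK ?posrE// /X invf_div mulrCA divff ?mulr1//.
by rewrite gt_eqF.
Qed.

End threshold_formula.

(** * Absolute continuity and the fundamental theorem of calculus *)

Section absolute_continuity.
Context {R : realType}.
Notation mu := (@lebesgue_measure R).
Implicit Types (f : R -> R) (a b c x : R).

(* The list is ordered from right to left. *)
Fixpoint interval_chain a x (l : seq (R * R)) : Prop :=
  if l is uv :: l' then [/\ uv.2 <= x, uv.1 <= uv.2 & interval_chain a uv.1 l']
  else a <= x.

Lemma interval_chain_le a x l : interval_chain a x l -> a <= x.
Proof.
elim: l x => //= uv l IH x [h1 h2 /IH h3].
exact: le_trans h3 (le_trans h2 h1).
Qed.

Lemma interval_chain_mono a x y l : x <= y ->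
  interval_chain a x l -> interval_chain a y l.
Proof.
by case: l => [|uv l] /= xy; [move=> /le_trans; apply|
  case=> h1 h2 h3; split=> //; exact: le_trans xy].
Qed.

Lemma interval_chain_nth a x l i : interval_chain a x l -> (i < size l)%N ->
  [/\ a <= (nth (0, 0) l i).1, (nth (0, 0) l i).1 <= (nth (0, 0) l i).2 &
      (nth (0, 0) l i).2 <= x].
Proof.
elim: l x i => //= uv l IH x [|i] [h1 h2 h3] /=.
  by move=> _; split=> //; exact: interval_chain_le h3.
rewrite ltnS => /(IH _ _ h3)[k1 k2 k3]; split => //.
exact: le_trans k3 (le_trans h2 h1).
Qed.

Lemma interval_chain_disj a x l i j : interval_chain a x l -> (i < j)%N ->
  (j < size l)%N -> (nth (0, 0) l j).2 <= (nth (0, 0) l i).1.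
Proof.
elim: l x i j => //= uv l IH x [|i] [|j] //= [h1 h2 h3].
  by move=> _; rewrite ltnS => /(interval_chain_nth h3)[].
by rewrite !ltnS; exact: IH h3.
Qed.

Lemma interval_chain_triv a x l : interval_chain a x l ->
  trivIset [set: 'I_(size l)]
    (fun i => `](nth (0, 0) l i).1, (nth (0, 0) l i).2[%classic).
Proof.
move=> C; apply/trivIsetP => i j _ _ ij; apply/seteqP; split => // t /= [].
rewrite !in_itv/= => /andP[a1 a2] /andP[b1 b2].
have [ltij|ltji|eqij] := ltngtP (i : nat) (j : nat).
- have := interval_chain_disj C ltij (ltn_ord j); lra.
- have := interval_chain_disj C ltji (ltn_ord i); lra.
- by move: ij; rewrite (val_inj eqij) eqxx.
Qed.

(* The exceptional set [N] is covered by an open set [U] of small measure. The points [x]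
   reachable from [a] by steps that either obey the slope bound or lie inside [U] form a
   set closed under suprema and open to the right, and [f] varies little over the steps
   inside [U] by absolute continuity. *)
Lemma abs_continuous_on_le f a b c (N : set R) : a <= b ->
  abs_continuous_on a b f -> measurable N -> mu N = 0%E ->
  (forall t, a <= t <= b -> ~ N t -> derivable f t 1 /\ derive1 f t <= c) ->
  f b - f a <= c * (b - a).
Proof.
move=> ab ac mN N0 Nf; apply/ler_addgt0Pr => eps eps0.
(* Of the allowance [eps], a share [e] per unit of length is spent on the slope, and a share [2 * e]
   on the steps inside [U]. *)
pose e := eps / (b - a + 2).
have ba2 : 0 < b - a + 2 by lra.
have e0 : 0 < e by rewrite /e divr_gt0.
pose c' := `|c| + e.
have c'0 : 0 < c' by rewrite /c' ltr_wpDl.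
have [del del0 acd] := ac e e0.
(* The second bound keeps [c'] times the total length of the steps inside [U] below [e]. *)
pose del' := Num.min del (e / c').
have del'0 : 0 < del' by rewrite lt_min del0 divr_gt0.
have [U [oU NU muU]] : exists U : set R, [/\ open U, N `<=` U &
    (mu U < del'%:E)%E].
  have [U [oU NU UN]] := lebesgue_regularity_outer mN
    (eq_ind_r (fun y => (y < +oo)%E) (ltry 0) N0) del'0.
  exists U; split => //; apply: le_lt_trans UN.
  have mU : measurable U by exact: open_measurable.
  rewrite -[X in (mu X <= _)%E](setDUK NU) measureU//.
  - by rewrite [X in (X + _)%E]N0 add0e.
  - exact: measurableD.
  - by rewrite setDIK.
have mU : measurable U by exact: open_measurable.
(* The term with [c'] offsets the amount [(c + e) * (y - x)] charged over the same interval, which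
   may be negative when [c] is. *)
pose cost (l : seq (R * R)) :=
  \sum_(uv <- l) (`|f uv.2 - f uv.1| + c' * (uv.2 - uv.1)).
pose good x := a <= x /\ exists l, [/\ interval_chain a x l,
  (forall uv, uv \in l -> `]uv.1, uv.2[%classic `<=` U) &
  f x - f a <= (c + e) * (x - a) + cost l].
have good_a : good a.
  split=> //; exists [::]; split=> //=.
  by rewrite /cost big_nil !subrr mulr0 addr0.
have step x y : good x -> x <= y ->
    (f y - f x <= (c + e) * (y - x)) \/ `]x, y[%classic `<=` U -> good y.
  move=> [ax [l [Cl lU fx]]] xy [h|h].
    split; first exact: le_trans xy.
    by exists l; split=> //; [exact: interval_chain_mono Cl|lra].
  split; first exact: le_trans xy.
  exists ((x, y) :: l); split=> //=.
    by move=> uv; rewrite inE => /orP[/eqP ->//|/lU].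
  rewrite /cost big_cons /= -/(cost l).
  have h1 : f y - f x <= `|f y - f x| by exact: ler_norm.
  have h2 : - c * (y - x) <= `|c| * (y - x).
    by rewrite ler_wpM2r ?subr_ge0// -normrN ler_norm.
  by have : 0 <= e * (y - x) by [rewrite mulr_ge0 ?subr_ge0// ltW];
    rewrite /c'; lra.
have local s : a <= s <= b -> exists2 eta, 0 < eta &
    (forall x, good x -> x <= s -> s - x < eta -> good s) /\
    (good s -> forall y, s <= y -> y - s < eta -> good y).
  move=> asb; have [Ns|Ns] := pselect (N s).
    have /nbhs_ballP[eta /= eta0 HU] := open_nbhs_nbhs (conj oU (NU s Ns)).
    exists eta => //; split.
      move=> x gx xs sx; apply: (step _ _ gx xs); right => t /=.
      rewrite in_itv/= => /andP[t1 t2]; apply: HU.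
      rewrite /ball/= ger0_norm; lra.
    move=> gs y sy ys; apply: (step _ _ gs sy); right => t /=.
    rewrite in_itv/= => /andP[t1 t2]; apply: HU.
    rewrite /ball/= ler0_norm; lra.
  have [df dfc] := Nf s asb Ns.
  have : (fun h : R => h^-1 *: (f (h *: (1:R) + s) - f s)) @ 0^' --> derive1 f s.
    by rewrite derive1E; exact: df.
  move=> /cvgrPdist_lt /(_ e e0).
  rewrite /dnbhs /within /= => /nbhs_ballP[eta /= eta0 Heta].
  have key h : h != 0 -> `|h| < eta ->
      `|derive1 f s - (f (h + s) - f s) / h| < e.
    move=> h0 hn; have := Heta h; rewrite /ball/= sub0r normrN => /(_ hn h0).
    by rewrite /GRing.scale/= mulr1 mulrC.
  exists eta => //; split.
    move=> x gx xs sx; apply: (step _ _ gx xs); left.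
    have [->|xns] := eqVneq x s; first by rewrite !subrr mulr0.
    have xs0 : x - s < 0 by rewrite subr_lt0 lt_neqAle xns.
    have := key (x - s); rewrite subrK (ltr0_norm xs0) opprB.
    move=> /(_ (ltr0_neq0 xs0) sx); rewrite ltr_norml => /andP[h _].
    have : (f x - f s) / (x - s) < c + e by move: h; lra.
    by rewrite ltr_ndivrMr// => h'; lra.
  move=> gs y sy ys; apply: (step _ _ gs sy); left.
  have [->|yns] := eqVneq y s; first by rewrite !subrr mulr0.
  have ys0 : 0 < y - s by rewrite subr_gt0 lt_neqAle eq_sym yns.
  have := key (y - s); rewrite subrK (gtr0_norm ys0).
  move=> /(_ (lt0r_neq0 ys0) ys); rewrite ltr_norml => /andP[h _].
  have : (f y - f s) / (y - s) < c + e by move: h; lra.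
  by rewrite ltr_pdivrMr// => /ltW.
have good_b : good b.
  pose S := [set x | x <= b /\ good x].
  have Sa : S a by split.
  have Sub : has_ubound S by exists b => x [].
  have hS : has_sup S by split; [exists a|].
  pose s := sup S.
  have as_ : a <= s by exact: ub_le_sup.
  have sb : s <= b by apply: ge_sup => [|x []//]; exists a.
  have [eta eta0 [L1 L2]] := local s (introT andP (conj as_ sb)).
  have gs : good s.
    have [x [xb gx] sx] := sup_adherent eta0 hS.
    by apply: (L1 x) => //; [exact: ub_le_sup|rewrite -/s in sx; lra].
  have [sb'|bs] := ltP s b; last by rewrite (le_anti (introT andP (conj bs sb))).
  pose y := Num.min b (s + eta / 2).
  have sy : s < y by rewrite lt_min sb' ltrDl divr_gt0.
  have gy : good y.
    apply: (L2 gs); first exact: ltW.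
    have : y <= s + eta / 2 by rewrite ge_min lexx orbT.
    by move=> *; lra.
  have : y <= s by apply: ub_le_sup => //; split=> //; rewrite ge_min lexx.
  by move=> *; lra.
have [_ [l [Cl lU fb]]] := good_b.
have lenE : \sum_(i < size l) ((nth (0, 0) l i).2 - (nth (0, 0) l i).1)
    < del'.
  rewrite -lte_fin; apply: le_lt_trans muU.
  have mI (i : 'I_(size l)) : measurable
      `](nth (0, 0) l i).1, (nth (0, 0) l i).2[%classic.
    exact: measurable_itv.
  have := interval_chain_triv Cl => tI.
  rewrite -sumEFin; apply: (@le_trans _ _ (mu (\big[setU/set0]_(i < size l)
     `](nth (0, 0) l i).1, (nth (0, 0) l i).2[%classic))).
    rewrite measure_bigsetU_ord//.
    apply: lee_sum => i _.
    apply: (@le_trans _ _ (mu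
      `](nth (0, 0) l i).1, (nth (0, 0) l i).2[%classic)) => //.
    rewrite lebesgue_measure_itv/= lte_fin.
    have [_ h _] := interval_chain_nth Cl (ltn_ord i).
    case: ifPn => // /negPf hn.
    by move: h; rewrite le_eqVlt hn orbF => /eqP->; rewrite subrr.
  apply: le_measure; rewrite ?inE//.
    by apply: bigsetU_measurable.
  elim/big_ind : _ => [//|P Q PU QU t [/PU|/QU]//|i _ t].
  by apply: lU; exact: mem_nth.
have lenE' : \sum_(i < size l) ((nth (0, 0) l i).2 - (nth (0, 0) l i).1) < del.
  by apply: lt_le_trans lenE _; rewrite ge_min lexx.
have := acd (size l) (fun i => (nth (0, 0) l i).1) (fun i => (nth (0, 0) l i).2)
  _ (interval_chain_triv Cl) lenE'.
move=> /(_ (fun i => let: And3 h1 h2 h3 :=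
  interval_chain_nth Cl (ltn_ord i) in conj h1 (conj h2 h3))) fl.
have costE : cost l < e + e.
  rewrite /cost big_split/= -mulr_sumr (big_nth (0, 0)) big_mkord.
  apply: ltrD => //.
  rewrite (big_nth (0, 0)) big_mkord.
  rewrite -ltr_pdivlMl// mulrC; apply: (lt_le_trans lenE).
  by rewrite ge_min lexx orbT.
apply: (le_trans fb); rewrite mulrDl -addrA lerD2l.
have -> : eps = e * (b - a + 2) by rewrite /e divfK// gt_eqF.
by lra.
Qed.

Lemma lipschitz_abs_continuous f a b (M : R) : 0 <= M ->
  (forall x y, a <= x -> x <= y -> y <= b -> `|f y - f x| <= M * (y - x)) ->
  abs_continuous_on a b f.
Proof.
move=> M0 fM e e0; exists (e / (M + 1)); first by rewrite divr_gt0// ltr_wpDl.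
move=> n u v uv _ suv; apply: (@le_lt_trans _ _ (M * \sum_(i < n) (v i - u i))).
  rewrite mulr_sumr; apply: ler_sum => i _.
  by have [h1 [h2 h3]] := uv i; exact: fM.
apply: (@le_lt_trans _ _ ((M + 1) * \sum_(i < n) (v i - u i))).
  rewrite ler_wpM2r ?lerDl//.
  by apply: sumr_ge0 => i _; have [_ [h _]] := uv i; rewrite subr_ge0.
by rewrite -ltr_pdivlMl 1?mulrC// ltr_wpDl.
Qed.

Lemma lipschitz_derivative0 f a b (M : R) (N : set R) : a <= b -> 0 <= M ->
  (forall x y, a <= x -> x <= y -> y <= b -> `|f y - f x| <= M * (y - x)) ->
  measurable N -> mu N = 0%E ->
  (forall t, a <= t <= b -> ~ N t -> is_derive t 1 f 0) -> f b = f a.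
Proof.
move=> ab M0 fM mN N0 f'0; apply/le_anti/andP; split.
  have := @abs_continuous_on_le f a b 0 N ab (lipschitz_abs_continuous M0 fM) mN N0.
  rewrite mul0r subr_le0; apply=> t tab Nt; have [h1 h2] := f'0 t tab Nt.
  by split; rewrite // derive1E h2.
have fM' x y : a <= x -> x <= y -> y <= b ->
    `|(- f) y - (- f) x| <= M * (y - x).
  by move=> ax xy yb; rewrite /GRing.opp/= -opprD normrN fM.
have := @abs_continuous_on_le (- f) a b 0 N ab (lipschitz_abs_continuous M0 fM') mN N0.
rewrite mul0r subr_le0 /GRing.opp/= lerN2; apply=> t tab Nt.
have /is_deriveN[h1 h2] := f'0 t tab Nt.
by split; rewrite // derive1E h2 oppr0.
Qed.

Lemma normr_Rintegral_le (D : set R) (q : R -> R) (M : R) : measurable D ->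
  mu.-integrable D (EFin \o q) -> (mu D < +oo)%E -> (forall t, D t -> `|q t| <= M) ->
  `|\int[mu]_(t in D) q t|%R <= M * fine (mu D).
Proof.
move=> mD iq Doo qM; apply: (le_trans (@le_normr_Rintegral _ _ _ mu D q mD iq)).
rewrite -Rintegral_cst//; apply: le_Rintegral => //.
- exact: integrable_norm.
- apply: measurable_bounded_integrable => //.
  exists `|M|; split; first exact: num_real.
  by move=> x Mx t _ /=; exact: ltW.
Qed.

(** By Lebesgue differentiation the integral of [p] has derivative [p] almost everywhere, so its
    difference with [f] is Lipschitz with derivative 0 almost everywhere, hence constant. *)
Lemma lipschitz_FTC f (p : R -> R) a b (M : R) (N : set R) : a <= b -> 0 <= M ->
  (forall x y, a <= x -> x <= y -> y <= b -> `|f y - f x| <= M * (y - x)) ->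
  measurable_fun `[a, b] p -> (forall t, a <= t <= b -> `|p t| <= M) ->
  measurable N -> mu N = 0%E ->
  (forall t, a <= t <= b -> ~ N t -> is_derive t 1 f (p t)) ->
  (\int[mu]_(t in `[a, b]) p t = f b - f a)%R.
Proof.
move=> ab M0 fM mp pM mN N0 f'p.
pose q := p \_ `[a, b].
have mq : measurable_fun setT q by apply/(measurable_restrictT _ _).1.
have qM t : `|q t| <= M.
  rewrite /q patchE; case: ifPn => [|_]; last by rewrite normr0.
  by rewrite inE/= in_itv/= => /pM.
have iq (A : set R) : measurable A -> (mu A < +oo)%E ->
    mu.-integrable A (EFin \o q).
  move=> mA Aoo; apply: measurable_bounded_integrable => //.
    exact: measurable_funTS.
  exists M; split; first exact: num_real.
  by move=> x Mx t _ /=; apply: (le_trans (qM t)); exact: ltW.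
have itvoo (x y : R) : (mu `[x, y]%classic < +oo)%E.
  by rewrite lebesgue_measure_itv/=; case: ifP => _; rewrite ?ltry// -EFinB ltry.
have iqxy x y : mu.-integrable `[x, y] (EFin \o q) by apply: iq.
have locq : locally_integrable [set: R] q.
  split => //; first exact: openT.
  move=> K _ cK; have mK := compact_measurable cK.
  rewrite -ge0_fin_numE; last by apply: integral_ge0.
  apply: integrable_fin_num => //.
  apply: (@integrable_norm _ _ _ mu K q).
  by apply: iq => //; exact: compact_finite_measure.
pose F x := (\int[mu]_(t in `[a, x]) q t)%R.
have [N2 [mN2 N20 F'q]] := FTC1 (a := BLeft a) (fun y => iqxy a y) locq.
have FM x y : a <= x -> x <= y -> y <= b -> `|F y - F x| <= M * (y - x).
  move=> ax xy yb.
  rewrite /F (Rintegral_itvB (iqxy a y)) ?bnd_simp//.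
  have mxy : (mu `]x, y]%classic < +oo)%E.
    apply: le_lt_trans (itvoo x y); apply: le_measure; rewrite ?inE//.
    by apply: subset_itvr; rewrite bnd_simp.
  apply: (le_trans (normr_Rintegral_le _ _ mxy (fun t _ => qM t))) => //.
    exact: iq.
  rewrite lebesgue_measure_itv/= lte_fin; case: ifP => // _.
  by rewrite /= mulr0 mulr_ge0// subr_ge0.
have : (f - F) b = (f - F) a.
  (* The end point [a] joins the exceptional set because [FTC1] differentiates at points beyond [a]
     only. *)
  apply: (@lipschitz_derivative0 (f - F) a b (M + M) (N `|` N2 `|` [set a])) => //.
  - by rewrite addr_ge0.
  - move=> x y ax xy yb.
    have -> : (f - F) y - (f - F) x = (f y - f x) - (F y - F x).
      by rewrite !fctE; ring.
    by apply: (le_trans (ler_normB _ _)); rewrite mulrDl lerD ?fM ?FM.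
  - by apply: measurableU => //; exact: measurableU.
  - apply: (@null_set_setU _ _ _ mu) => //; first exact: measurableU.
      exact: (@null_set_setU _ _ _ mu N N2).
    exact: lebesgue_measure_set1.
  - move=> t tab /not_orP[/not_orP[Nt N2t] ta].
    have := f'p t tab Nt.
    have [dF F'] : derivable F t 1 /\ derive1 F t = q t.
      apply: contrapT => h; apply: N2t; apply: F'q => /= h'; apply: h; apply: h'.
      rewrite /= lte_fin lt_neqAle (andP tab).1 andbT.
      by apply/eqP => at_; apply: ta.
    have qp : q t = p t by rewrite /q patchE mem_set//= in_itv.
    have F'' : is_derive t 1 F (p t).
      by apply: DeriveDef => //; rewrite -derive1E F'.
    move=> h; apply: is_derive_eq; by rewrite subrr.
rewrite !fctE.
have -> : F a = 0 by rewrite /F set_itv1 Rintegral_set1.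
have -> : F b = (\int[mu]_(t in `[a, b]) p t)%R.
  by apply: eq_Rintegral => t tab; rewrite /q patchE tab.
by lra.
Qed.

Lemma abs_continuous_on_sub f a b a' b' : a <= a' -> b' <= b ->
  abs_continuous_on a b f -> abs_continuous_on a' b' f.
Proof.
move=> aa bb ac e e0; have [del del0 H] := ac e e0; exists del => // n u v uv.
apply: H => i; have [h1 [h2 h3]] := uv i.
by split; [exact: le_trans h1|split=> //; exact: le_trans bb].
Qed.

Lemma abs_continuous_onN f a b :
  abs_continuous_on a b f -> abs_continuous_on a b (- f).
Proof.
move=> ac e e0; have [del del0 H] := ac e e0; exists del => // n u v h1 h2 h3.
have := H n u v h1 h2 h3; congr (_ < _); apply: eq_bigr => i _.
by rewrite !fctE -opprD normrN.
Qed.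

Lemma lipschitz_continuous_fun f (M : R) :
  (forall x y, `|f y - f x| <= M * `|y - x|) -> continuous f.
Proof.
move=> fM x.
have M0 : 0 <= M.
  by have := fM 0 1; rewrite subr0 normr1 mulr1; exact: le_trans.
apply/cvgrPdist_lt => e e0; near=> y.
rewrite distrC; apply: (le_lt_trans (fM x y)).
apply: (@le_lt_trans _ _ ((M + 1) * `|y - x|)).
  by rewrite ler_wpM2r// lerDl.
rewrite -ltr_pdivlMl ?ltr_wpDl// mulrC distrC.
near: y; exists (e / (M + 1)); last by [].
by rewrite /= divr_gt0// ltr_wpDl.
Unshelve. all: by end_near. Qed.

(** The derivative is the limit of the difference quotients with increment [n.+1%:R^-1]. Extending
    [f] by its value at 0 makes these quotients continuous on the whole line. *)
Lemma measurable_derive1 f (M : R) (N : set R) :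
  (forall x y, 0 <= x -> x <= y -> `|f y - f x| <= M * (y - x)) ->
  measurable N -> (forall t, 0 <= t -> ~ N t -> derivable f t 1) ->
  measurable_fun (`[0, +oo[ `\` N) (derive1 f).
Proof.
move=> fM mN df.
pose g t := f (Num.max t 0).
have M0 : 0 <= M.
  by have := fM 0 1 (lexx _) ler01; rewrite subr0 mulr1; exact: le_trans.
have gM x y : x <= y -> `|g y - g x| <= M * (y - x).
  move=> xy; apply: (le_trans (fM _ _ _ _)).
  - by rewrite le_max lexx orbT.
  - by rewrite ge_max !le_max xy lexx orbT.
  - rewrite ler_wpM2l//.
    by case: (leP x 0) => hx; case: (leP y 0) => hy; lra.
have cg : continuous g.
  apply: (@lipschitz_continuous_fun g M) => x y.
  have [xy|/ltW yx] := leP x y; first by rewrite (ger0_norm (_ : 0 <= y - x)) ?subr_ge0// gM.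
  by rewrite distrC (distrC y) (ger0_norm (_ : 0 <= x - y)) ?subr_ge0// gM.
have mg : measurable_fun setT g := continuous_measurable_fun cg.
pose q n t := n.+1%:R * (g (t + n.+1%:R^-1) - g t).
apply: (@measurable_fun_cvg _ _ _ _ q).
- move=> n; apply: measurable_funTS; apply: measurable_funM => //.
  apply: measurable_funB => //; apply: measurableT_comp => //.
  exact: measurable_funD.
- move=> t [/=]; rewrite in_itv/= andbT => t0 Nt.
  have dt := df t t0 Nt.
  have : (fun h : R => h^-1 *: (f (h *: (1:R) + t) - f t)) @ 0^' --> derive1 f t.
    by rewrite derive1E; exact: dt.
  move=> /cvgrPdist_lt H; apply/cvgrPdist_lt => e /H.
  rewrite /dnbhs /within /= => /nbhs_ballP[eta /= eta0 Heta].
  near=> n.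
  have n0 : 0 < n.+1%:R^-1 :> R by rewrite invr_gt0.
  have := Heta n.+1%:R^-1; rewrite /ball/= sub0r normrN (gtr0_norm n0).
  rewrite /GRing.scale/= invrK mulr1 [_^-1 + t]addrC /q /g.
  rewrite (max_idPl t0) (max_idPl (addr_ge0 t0 (ltW n0))).
  apply; last by rewrite gt_eqF.
  by near: n; exact: near_infty_natSinv_lt (PosNum eta0).
Unshelve. all: by end_near. Qed.

End absolute_continuity.

(** * Increments of admissible policies *)

Section policies.
Context {d : measure_display} {T : measurableType d} {R : realType}.
Notation mu := (@lebesgue_measure R).

(** Bounds on the rate at almost every time carry over to increments because the paths are
    absolutely continuous; the lower bound is the upper one for [- P]. *)
Lemma policy_increment (thl thu p0 : R) (D P : R -> T -> R) (w : T) (s t : R) :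
  control_policy thl thu D p0 P -> 0 <= s -> s <= t ->
  thl * (t - s) <= P t w - P s w <= thu * (t - s).
Proof.
move=> [_ _ acP /(_ w)[N [mN N0 NP]]] s0 st.
have t0 : 0 <= t := le_trans s0 st.
have ac : abs_continuous_on s t (P ^~ w).
  apply: abs_continuous_on_sub (acP w (t + 1) _); first exact: s0.
    by rewrite lerDl.
  by rewrite ltr_wpDl.
have dP u : s <= u <= t -> ~ N u ->
    derivable (P ^~ w) u 1 /\ thl <= derive1 (P ^~ w) u <= thu.
  move=> /andP[su _] Nu; apply: contrapT => h; apply: Nu; apply: NP => /=.
  by move=> h'; apply: h; apply: h'; exact: le_trans su.
apply/andP; split; last first.
  apply: (abs_continuous_on_le st ac mN N0) => u su Nu.
  by have [? /andP[]] := dP u su Nu.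
have := abs_continuous_on_le (c := - thl) st (abs_continuous_onN ac) mN N0.
rewrite !fctE => H; suff : - P t w - - P s w <= - thl * (t - s) by lra.
apply: H => u su Nu; have [h1 /andP[h2 _]] := dP u su Nu.
split; first exact: derivableN.
by rewrite derive1E deriveN// -derive1E lerN2.
Qed.

End policies.

Section nonneg_integrals.
Context {d : measure_display} {T : measurableType d} {R : realType}.
Variable mu : {measure set T -> \bar R}.

(* The integral of a nonnegative function is a supremum over simple functions,
   so monotonicity needs no measurability. *)
Lemma ge0_le_integral_nonmeas (D : set T) (f g : T -> \bar R) :
  (forall x, D x -> (0 <= f x)%E) -> (forall x, D x -> (f x <= g x)%E) ->
  (\int[mu]_(x in D) f x <= \int[mu]_(x in D) g x)%E.
Proof.
move=> f0 fg; have g0 x : D x -> (0 <= g x)%E.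
  by move=> Dx; exact: le_trans (f0 _ Dx) (fg _ Dx).
rewrite !ge0_integralE//; apply: ge_ereal_sup => _ [h /= hf <-].
apply: ereal_sup_ubound; exists h => //= x; apply: (le_trans (hf x)).
by apply: lee_restrict => //.
Qed.

End nonneg_integrals.

(** * Integrals against a Gaussian law *)

Section gaussian_density.
Context {R : realType}.
Notation mu := (@lebesgue_measure R).
Variables (m s : R).

Import HBNNSimple.

Let pdf0 x : (0 <= (normal_pdf m s x)%:E)%E.
Proof. by rewrite lee_fin normal_pdf_ge0. Qed.

Let mpdf : measurable_fun setT (fun x => (normal_pdf m s x)%:E).
Proof. by apply/measurable_EFinP; exact: measurable_normal_pdf. Qed.

Let integral_normal_indic E : measurable E ->
  (\int[normal_prob m s]_x (\1_E x)%:E =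
   \int[mu]_x ((\1_E x)%:E * (normal_pdf m s x)%:E))%E.
Proof.
move=> mE; rewrite integral_indic//= setIT /normal_prob integral_mkcond.
apply: eq_integral => x _; rewrite patchE indicE; case: ifPn => xE.
  by rewrite mul1e.
by rewrite mul0e.
Qed.

Let integral_normal_nnsfun (f : {nnsfun (measurableTypeR R) >-> R}) :
  (\int[normal_prob m s]_x (f x)%:E =
   \int[mu]_x ((f x)%:E * (normal_pdf m s x)%:E))%E.
Proof.
under [LHS]eq_integral do rewrite fimfunE -fsumEFin//.
rewrite [LHS]ge0_integral_fsum//; last 2 first.
  - by move=> r; exact/measurable_EFinP/measurableT_comp.
  - by move=> n x _; rewrite EFinM nnfun_muleindic_ge0.
under [RHS]eq_integral.
  move=> x xD; rewrite fimfunE -fsumEFin// ge0_mule_fsuml; last first.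
    by move=> r; rewrite EFinM nnfun_muleindic_ge0.
  over.
rewrite [RHS]ge0_integral_fsum//; last 2 first.
  - move=> r; apply: emeasurable_funM => //.
    by apply/measurable_EFinP; apply/measurableT_comp.
  - by move=> n x _; rewrite mule_ge0// EFinM nnfun_muleindic_ge0.
apply: eq_fsbigr => r _.
rewrite integralZl_indic_nnsfun// integral_normal_indic//.
under [RHS]eq_integral do rewrite EFinM -muleA.
have [r0|r0] := leP 0 r.
  rewrite ge0_integralZl//.
  - by apply: emeasurable_funM => //; exact/measurable_EFinP.
  - by move=> x _; rewrite mule_ge0// lee_fin.
have fr : f @^-1` [set r] = set0.
  apply/seteqP; split => // x /= fx; move: r0; rewrite -fx ltNge.
  by rewrite fun_ge0.
rewrite [in RHS]fr [in LHS]fr.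
rewrite !integral0_eq ?mule0// => x _; rewrite indic0 mul0e//.
by rewrite mule0.
Qed.

(** The usual passage from indicators to simple functions and, by monotone convergence, to
    nonnegative measurable functions. *)
Lemma ge0_integral_normal_prob (f : measurableTypeR R -> \bar R) :
  measurable_fun setT f -> (forall x, 0 <= f x)%E ->
  (\int[normal_prob m s]_x f x =
   \int[mu]_x (f x * (normal_pdf m s x)%:E))%E.
Proof.
move=> mf f0.
pose f_ := nnsfun_approx measurableT mf.
have mf_ n : measurable_fun setT (fun x => (f_ n x)%:E * (normal_pdf m s x)%:E)%E.
  by apply: emeasurable_funM => //; exact/measurable_EFinP.
transitivity (lim (\int[normal_prob m s]_x (f_ n x)%:E @[n --> \oo])%E).
  rewrite -monotone_convergence//=.
  - apply: eq_integral => ? /[!inE] xD; apply/esym/cvg_lim => //=.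
    exact: cvg_nnsfun_approx.
  - by move=> n; exact/measurable_EFinP/measurable_funTS.
  - by move=> n ? _; rewrite lee_fin.
  - by move=> ? _ ? ? mn; rewrite lee_fin; exact/lefP/nd_nnsfun_approx.
rewrite [RHS](_ : _ = lim
    (\int[mu]_x ((f_ n x)%:E * (normal_pdf m s x)%:E) @[n --> \oo])%E); last first.
  rewrite -monotone_convergence//=.
  - apply: eq_integral => x /[!inE] xD; apply/esym/cvg_lim => //.
    rewrite muleC; under eq_cvg do rewrite muleC.
    by apply: cvgeZl => //; exact: cvg_nnsfun_approx.
  - by move=> n x _; rewrite mule_ge0// lee_fin.
  - move=> x _ a b ab; rewrite lee_wpmul2r// lee_fin.
    exact/lefP/nd_nnsfun_approx.
by apply: congr_lim; apply/funext => n /=; exact: integral_normal_nnsfun.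
Qed.

End gaussian_density.

Section gaussian_moments.
Context {d : measure_display} {T : measurableType d} {R : realType}.
Notation mu := (@lebesgue_measure R).
Variables (Pr : probability T R) (Y : T -> R) (r : R).
Hypotheses (r0 : 0 < r) (mY : measurable_fun setT Y).
Hypothesis lawY : forall B : set R, measurable B ->
  Pr (Y @^-1` B) = normal_prob 0 r B.

Lemma ge0_integral_gaussian (g : measurableTypeR R -> \bar R) :
  measurable_fun setT g -> (forall x, 0 <= g x)%E ->
  (\int[Pr]_w g (Y w) = \int[mu]_x (g x * (normal_pdf 0 r x)%:E))%E.
Proof.
move=> mg g0; rewrite -ge0_integral_normal_prob//.
have := @ge0_integral_pushforward _ _ _ (measurableTypeR R) _ _ mY Pr setT g
  measurableT mg (fun x _ => g0 x).
rewrite preimage_setT => <-.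
apply: eq_measure_integral => A mA _.
exact: lawY.
Qed.

(** Completing the square absorbs the exponential into a Gaussian density of mean [l * r ^+ 2]. *)
Lemma gaussian_mgf (l : R) :
  (\int[Pr]_w (expR (l * Y w))%:E = (expR (l ^+ 2 * r ^+ 2 / 2))%:E)%E.
Proof.
rewrite (ge0_integral_gaussian (g := fun x => (expR (l * x))%:E)); first last.
- by move=> x; rewrite lee_fin expR_ge0.
- by apply/measurable_EFinP; apply: measurableT_comp.
transitivity (\int[mu]_x ((expR (l ^+ 2 * r ^+ 2 / 2))%:E *
    (normal_pdf (l * r ^+ 2) r x)%:E))%E.
  apply: eq_integral => x _; rewrite -!EFinM; congr EFin.
  rewrite /normal_pdf (gt_eqF r0) /normal_fun.
  rewrite [LHS]mulrCA [RHS]mulrCA -!expRD; congr (_ * expR _).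
  by field; rewrite gt_eqF.
rewrite ge0_integralZl//.
- by rewrite integral_normal_pdf mule1.
- by apply/measurable_EFinP; exact: measurable_normal_pdf.
- by move=> x _; rewrite lee_fin normal_pdf_ge0.
Qed.

Lemma integrable_gaussian_exp (l : R) :
  Pr.-integrable setT (EFin \o (fun w => expR (l * Y w))).
Proof.
apply/integrableP; split.
  apply/measurable_EFinP; apply: measurableT_comp => //.
  exact: measurable_funM.
under eq_integral do rewrite /= ger0_norm ?expR_ge0//.
by rewrite gaussian_mgf ltry.
Qed.

Lemma Rintegral_gaussian_exp (l : R) :
  (\int[Pr]_w expR (l * Y w) = expR (l ^+ 2 * r ^+ 2 / 2))%R.
Proof. by rewrite /Rintegral gaussian_mgf. Qed.

(** The interval has length [2 * c], and the density is at most its peak, which is at most [r^-1]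
    because [2 * pi >= 1]. *)
Lemma gaussian_small_ball (c : R) : 0 <= c ->
  (Pr [set w | (`|Y w| <= c)%R] <= (2 * c / r)%:E)%E.
Proof.
move=> c0; have -> : [set w | `|Y w| <= c] = Y @^-1` `[- c, c].
  by apply/seteqP; split => w /=; rewrite in_itv/= ler_norml.
rewrite lawY// /normal_prob.
apply: (@le_trans _ _ (\int[mu]_(x in `[(- c)%R, c]) (r^-1)%:E)%E).
  apply: ge0_le_integral => //.
  - by move=> x _; rewrite lee_fin normal_pdf_ge0.
  - by apply/measurable_EFinP/measurable_funTS; exact: measurable_normal_pdf.
  - move=> x _; rewrite lee_fin; apply: (le_trans (normal_pdf_ub _ _ _)).
      by rewrite gt_eqF.
    rewrite /normal_peak lef_pV2 ?posrE ?sqrtr_gt0//; last first.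
      by rewrite pmulrn_lgt0// mulr_gt0 ?pi_gt0// exprn_gt0.
    rewrite -[leLHS](ger0_norm (ltW r0)) -sqrtr_sqr ler_sqrt; last first.
      by rewrite pmulrn_lge0// mulr_ge0 ?pi_ge0// sqr_ge0.
    rewrite -mulr_natr -mulrA ler_peMr ?sqr_ge0//.
    by have := @pi_ge2 R; lra.
rewrite integral_cst//= lebesgue_measure_itv/= lte_fin.
case: ifPn => [cc|_]; last by rewrite mule0 lee_fin mulr_ge0 ?mulr_ge0// invr_ge0 ltW.
by rewrite -EFinD -EFinM lee_fin opprK mulrC; lra.
Qed.

End gaussian_moments.

(** * Expectations, and the moments of a Gaussian variable *)

Section more_gaussian_moments.
Context {d : measure_display} {T : measurableType d} {R : realType}.
Variables (Pr : probability T R).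
Implicit Types f g : T -> R.

Definition L1 (f : T -> R) := Pr.-integrable setT (EFin \o f).

Local Notation "'E[ f ]" := (Rintegral Pr setT f) (at level 0).

Lemma L1_meas f : L1 f -> measurable_fun setT f.
Proof. by move=> /measurable_int/measurable_EFinP. Qed.

Lemma L1D f g : L1 f -> L1 g -> L1 (fun w => f w + g w).
Proof. by move=> hf hg; exact: (integrableD _ hf hg). Qed.

Lemma L1B f g : L1 f -> L1 g -> L1 (fun w => f w - g w).
Proof. by move=> hf hg; exact: (integrableB _ hf hg). Qed.

Lemma L1Z (c : R) f : L1 f -> L1 (fun w => c * f w).
Proof. by move=> hf; exact: (integrableZl _ c hf). Qed.

Lemma L1_cst (c : R) : L1 (fun=> c).
Proof. exact: finite_measure_integrable_cst. Qed.

Lemma L1_norm f : L1 f -> L1 (fun w => `|f w|).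
Proof. exact: integrable_norm. Qed.

Lemma L1_le f g : measurable_fun setT f -> L1 g -> (forall w, `|f w| <= g w) ->
  L1 f.
Proof.
move=> mf ig fg; apply: (le_integrable _ _ _ ig) => //.
  exact/measurable_EFinP.
by move=> w _; rewrite /= lee_fin; apply: (le_trans (fg w)); exact: ler_norm.
Qed.

Lemma L1_bounded f (M : R) : measurable_fun setT f -> (forall w, `|f w| <= M) -> L1 f.
Proof. by move=> mf fM; exact: L1_le (L1_cst M) fM. Qed.

Lemma L1_mul_bounded f g (M : R) : measurable_fun setT f ->
  (forall w, `|f w| <= M) -> L1 g -> L1 (fun w => f w * g w).
Proof.
move=> mf fM ig; apply: (L1_le (g := fun w => M * `|g w|)).
- by apply: measurable_funM => //; exact: L1_meas.
- by apply: L1Z; exact: L1_norm.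
- by move=> w; rewrite normrM ler_wpM2r.
Qed.

Lemma L1_sum (I : Type) (s : seq I) (f : I -> T -> R) :
  (forall i, L1 (f i)) -> L1 (fun w => \sum_(i <- s) f i w).
Proof.
move=> If; elim: s => [|i s IH].
  by under [fun w => _]eq_fun do rewrite big_nil; exact: L1_cst.
by under [fun w => _]eq_fun do rewrite big_cons; exact: L1D.
Qed.

Lemma ED f g : L1 f -> L1 g -> 'E[fun w => f w + g w] = 'E[f] + 'E[g].
Proof. by move=> hf hg; rewrite RintegralD. Qed.

Lemma EB f g : L1 f -> L1 g -> 'E[fun w => f w - g w] = 'E[f] - 'E[g].
Proof. by move=> hf hg; rewrite RintegralB. Qed.

Lemma EZ c f : L1 f -> 'E[fun w => c * f w] = c * 'E[f].
Proof. by move=> hf; rewrite RintegralZl. Qed.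

Lemma E_cst c : 'E[fun=> c] = c.
Proof. rewrite Rintegral_cst//.
by rewrite [X in fine X](_ : _ = 1%E) ?mulr1//; exact: probability_setT. Qed.

Lemma E_le f g : L1 f -> L1 g -> (forall w, f w <= g w) -> 'E[f] <= 'E[g].
Proof. by move=> hf hg fg; apply: le_Rintegral. Qed.

Lemma E_sum (I : Type) (s : seq I) (f : I -> T -> R) : (forall i, L1 (f i)) ->
  'E[fun w => \sum_(i <- s) f i w] = \sum_(i <- s) 'E[f i].
Proof.
move=> If; elim: s => [|i s IH].
  by rewrite big_nil; under [fun w => _]eq_fun do rewrite big_nil; exact: E_cst.
rewrite big_cons -IH -ED//; last exact: L1_sum.
by under [fun w => _]eq_fun do rewrite big_cons.
Qed.

Lemma E_norm_le f g : L1 f -> L1 g -> (forall w, `|f w| <= g w) ->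
  `|'E[f]| <= 'E[g].
Proof.
move=> hf hg fg; apply: (le_trans (le_normr_Rintegral _ hf)) => //.
by apply: E_le => //; exact: L1_norm.
Qed.

Variables (Y : T -> R) (r : R).
Hypotheses (r0 : 0 < r) (mY : measurable_fun setT Y).
Hypothesis lawY : forall B : set R, measurable B ->
  Pr (Y @^-1` B) = normal_prob 0 r B.

Let L1exp l : L1 (fun w => expR (l * Y w)).
Proof. apply: integrable_gaussian_exp. exact: r0. exact: mY. exact: lawY. Qed.

Let Eexp l : 'E[fun w => expR (l * Y w)] = expR (l ^+ 2 * r ^+ 2 / 2).
Proof. exact: Rintegral_gaussian_exp. Qed.

Let cosh_ l w := expR (l * Y w) + expR (- l * Y w).

Let L1cosh l : L1 (cosh_ l).
Proof. by apply: L1D. Qed.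

Let Ecosh l : 'E[cosh_ l] = 2 * expR (l ^+ 2 * r ^+ 2 / 2).
Proof. rewrite ED//.
by rewrite !Eexp sqrrN; ring. Qed.

Let expR_norm_le l w : 0 <= l -> expR (l * `|Y w|) <= cosh_ l w.
Proof.
move=> l0; rewrite /cosh_; have [y0|y0] := ger0P (Y w).
  by rewrite lerDl expR_ge0.
by rewrite mulrN mulNr lerDr expR_ge0.
Qed.

Lemma L1_gaussian_abs3 : L1 (fun w => `|Y w| ^+ 3).
Proof.
apply: (L1_le (g := fun w => 27 * cosh_ 1 w)).
- by apply: measurable_funX; apply: measurableT_comp.
- exact: L1Z.
- move=> w; rewrite ger0_norm ?exprn_ge0//.
  apply: (le_trans (cube_le_expR (normr_ge0 (Y w)))).
  by rewrite ler_wpM2l//; have := expR_norm_le w ler01; rewrite mul1r.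
Qed.

(** Rescaling by [r] before the comparison with the exponential yields the power [r ^+ 3]. The
    factor 54 is 27 for the cube times 2 for the two signs of [Y]. *)
Lemma E_gaussian_abs3 : 'E[fun w => `|Y w| ^+ 3] <= 54 * expR 1 * r ^+ 3.
Proof.
have h w : `|Y w| ^+ 3 <= 27 * r ^+ 3 * cosh_ r^-1 w.
  have -> : `|Y w| ^+ 3 = r ^+ 3 * (`|Y w| / r) ^+ 3.
    by rewrite expr_div_n mulrC divfK// gt_eqF// exprn_gt0.
  have r1 : 0 <= r^-1 by rewrite invr_ge0 ltW.
  have -> : 27 * r ^+ 3 * cosh_ r^-1 w = r ^+ 3 * (27 * cosh_ r^-1 w) by ring.
  rewrite ler_wpM2l ?exprn_ge0 ?(ltW r0)//.
  have := cube_le_expR (mulr_ge0 (normr_ge0 (Y w)) r1).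
  move=> h; apply: (le_trans h); rewrite ler_wpM2l//.
  by rewrite mulrC; exact: expR_norm_le.
have := E_le L1_gaussian_abs3 (L1Z (27 * r ^+ 3) (L1cosh r^-1)) h.
rewrite EZ// Ecosh; move=> /le_trans; apply.
have -> : r^-1 ^+ 2 * r ^+ 2 / 2 = 2^-1 :> R by field; rewrite gt_eqF.
have e1 : expR 2^-1 <= expR 1 :> R by rewrite ler_expR; lra.
have r3 : 0 < r ^+ 3 by rewrite exprn_gt0.
have : r ^+ 3 * expR 2^-1 <= r ^+ 3 * expR 1 by rewrite ler_pM2l.
by lra.
Qed.

Lemma L1_gaussian : L1 Y.
Proof.
apply: (L1_le (g := cosh_ 1)) => // w.
apply: le_trans (expR_norm_le w ler01); rewrite mul1r.
by have := expR_ge1Dx `|Y w|; lra.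
Qed.

Lemma E_gaussian_abs : 'E[fun w => `|Y w|] <= 2 * expR 1 * r.
Proof.
have h w : `|Y w| <= r * cosh_ r^-1 w.
  rewrite -ler_pdivrMl//.
  apply: le_trans (expR_norm_le w _); last by rewrite invr_ge0 ltW.
  by have := expR_ge1Dx (r^-1 * `|Y w|); lra.
have := E_le (L1_norm L1_gaussian) (L1Z r (L1cosh r^-1)) h.
rewrite EZ// Ecosh; move=> /le_trans; apply.
have -> : r^-1 ^+ 2 * r ^+ 2 / 2 = 2^-1 :> R by field; rewrite gt_eqF.
have e1 : expR 2^-1 <= expR 1 :> R by rewrite ler_expR; lra.
have : r * expR 2^-1 <= r * expR 1 by rewrite ler_pM2l.
by lra.
Qed.

Lemma L1_gaussian_sqr : L1 (fun w => Y w ^+ 2).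
Proof.
apply: (L1_le (g := fun w => 1 + `|Y w| ^+ 3)).
- exact: measurable_funX.
- by apply: L1D; [exact: L1_cst|exact: L1_gaussian_abs3].
- move=> w; rewrite normrX; set y := `|Y w|.
  have y0 : 0 <= y by exact: normr_ge0.
  by have [y1|/ltW y1] := leP y 1; nra.
Qed.

(* The mean and the variance are read off the expansion of the moment generating
   function at 0, which avoids integrating [x ^+ n] against the density. *)
Let gaussian_taylor l : `|l| <= 1 ->
  `|l * 'E[Y] + l ^+ 2 * ('E[fun w => Y w ^+ 2] - r ^+ 2) / 2|
    <= (108 * expR (2 * r ^+ 2) + (r ^+ 2 / 2) ^+ 2 * expR (r ^+ 2 / 2)) *
       `|l| ^+ 3.
Proof.
move=> l1.
pose q w := expR (l * Y w) - 1 - l * Y w - (l ^+ 2 / 2) * Y w ^+ 2.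
have L1q : L1 q.
  apply: L1B; last by apply: L1Z; exact: L1_gaussian_sqr.
  apply: L1B; last by apply: L1Z; exact: L1_gaussian.
  by apply: L1B => //; exact: L1_cst.
have Eq : 'E[q] = expR (l ^+ 2 * r ^+ 2 / 2) - 1 - l * 'E[Y] -
    (l ^+ 2 / 2) * 'E[fun w => Y w ^+ 2].
  rewrite EB; last by apply: L1Z; exact: L1_gaussian_sqr.
    rewrite EB; last by apply: L1Z; exact: L1_gaussian.
      rewrite EB ?E_cst ?Eexp//; last exact: L1_cst.
      by rewrite !EZ//; [exact: L1_gaussian_sqr|exact: L1_gaussian].
    by apply: L1B => //; exact: L1_cst.
  apply: L1B; last by apply: L1Z; exact: L1_gaussian.
  by apply: L1B => //; exact: L1_cst.
have qle w : `|q w| <= 27 * `|l| ^+ 3 * cosh_ 2 w.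
  have -> : q w = expR (l * Y w) - 1 - l * Y w - (l * Y w) ^+ 2 / 2.
    by rewrite /q; field.
  have lY : l * Y w <= `|Y w|.
    apply: (le_trans (ler_norm _)); rewrite normrM.
    by rewrite ler_piMl.
  apply: (le_trans (expR_taylor2 (normr_ge0 (Y w)) lY)).
  have -> : 27 * `|l| ^+ 3 * cosh_ 2 w = `|l| ^+ 3 * (27 * cosh_ 2 w) by ring.
  have -> : `|l * Y w| ^+ 3 * expR `|Y w| =
      `|l| ^+ 3 * (`|Y w| ^+ 3 * expR `|Y w|) by rewrite normrM; ring.
  rewrite ler_wpM2l ?exprn_ge0//.
  have h3 := cube_le_expR (normr_ge0 (Y w)).
  have h2 := expR_norm_le w (ler0n _ 2).
  have e2 : expR (2 * `|Y w|) = expR `|Y w| * expR `|Y w|.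
    by rewrite -expRD; congr expR; ring.
  apply: (@le_trans _ _ (27 * expR `|Y w| * expR `|Y w|)).
    by rewrite ler_wpM2r ?expR_ge0.
  by rewrite -mulrA -e2 ler_wpM2l.
have := E_norm_le L1q (L1Z (27 * `|l| ^+ 3) (L1cosh 2)) qle.
rewrite EZ// Ecosh Eq.
have -> : 2 ^+ 2 * r ^+ 2 / 2 = 2 * r ^+ 2 :> R by field.
move=> B1.
pose u := l ^+ 2 * r ^+ 2 / 2.
have l2 : l ^+ 2 <= 1.
  by rewrite -real_normK ?num_real// expr_le1.
have r2 : 0 <= r ^+ 2 / 2 by rewrite divr_ge0// sqr_ge0.
have uM : u <= r ^+ 2 / 2 by rewrite /u -mulrA ler_piMl.
have u0 : 0 <= u by rewrite /u -mulrA mulr_ge0 ?sqr_ge0.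
have B2 := expR_taylor1 r2 uM.
have B3 : `|u| ^+ 2 * expR (r ^+ 2 / 2) <=
    (r ^+ 2 / 2) ^+ 2 * expR (r ^+ 2 / 2) * `|l| ^+ 3.
  rewrite -[leRHS]mulrAC ler_wpM2r ?expR_ge0// ger0_norm//.
  have -> : u ^+ 2 = (r ^+ 2 / 2) ^+ 2 * (l ^+ 2) ^+ 2 by rewrite /u; ring.
  rewrite ler_wpM2l ?sqr_ge0//.
  have -> : l ^+ 2 = `|l| ^+ 2 by rewrite real_normK// num_real.
  by rewrite -exprM ler_wiXn2l.
have -> : l * 'E[Y] + l ^+ 2 * ('E[fun w => Y w ^+ 2] - r ^+ 2) / 2 =
  (expR u - 1 - u) - (expR u - 1 - l * 'E[Y] -
    (l ^+ 2 / 2) * 'E[fun w => Y w ^+ 2]) by rewrite /u; field.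
rewrite mulrDl; apply: (le_trans (ler_normB _ _)).
rewrite addrC; apply: lerD; last exact: le_trans B2 B3.
by apply: (le_trans B1); have := expR_ge0 (2 * r ^+ 2); have := exprn_ge0 3 (normr_ge0 l); nra.
Qed.

(** Adding the expansions at [l] and [- l] cancels the mean; division by [l ^+ 2] and [l] tending to
    0 identify the variance. Division of the remaining expansion by [l] then identifies the mean. *)
Lemma E_gaussian_moments : 'E[Y] = 0 /\ 'E[fun w => Y w ^+ 2] = r ^+ 2.
Proof.
have := gaussian_taylor; set C := (108 * _ + _) => H.
have C0 : 0 <= C.
  by have := H 1; rewrite normr1 !expr1n [C * _]mulr1 => /(_ (lexx _)); exact: le_trans.
set m1 := 'E[Y] in H *; set m2 := 'E[_] in H *.
have m2E : m2 = r ^+ 2.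
  apply/eqP; rewrite -subr_eq0 -normr_le0; apply/ler_addgt0Pr => e e0.
  pose l := Num.min 1 (e / (2 * C + 1)).
  have C1 : 0 < 2 * C + 1 by lra.
  have l0 : 0 < l by rewrite lt_min ltr01 divr_gt0.
  have ll : `|l| <= 1 by rewrite gtr0_norm// ge_min lexx.
  have H1 := H l ll; have H2 := H (- l).
  rewrite normrN sqrrN in H2; have {}H2 := H2 ll.
  have le : l * (2 * C + 1) <= e by rewrite -ler_pdivlMr// ge_min lexx orbT.
  rewrite (gtr0_norm l0) in H1 H2.
  have := le_trans (ler_normD _ _) (lerD H1 H2).
  have -> : l * m1 + l ^+ 2 * (m2 - r ^+ 2) / 2 +
     (- l * m1 + l ^+ 2 * (m2 - r ^+ 2) / 2) = l ^+ 2 * (m2 - r ^+ 2) by field.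
  rewrite normrM (ger0_norm (sqr_ge0 l)) => H3.
  have {}H3 : l ^+ 2 * `|m2 - r ^+ 2| <= l ^+ 2 * (2 * C * l).
    by apply: (le_trans H3); rewrite le_eqVlt; apply/orP; left; apply/eqP; ring.
  rewrite ler_pM2l ?exprn_gt0// in H3.
  by rewrite add0r; lra.
split=> //; apply/eqP; rewrite -normr_le0; apply/ler_addgt0Pr => e e0.
pose l := Num.min 1 (e / (C + 1)).
have C1 : 0 < C + 1 by lra.
have l0 : 0 < l by rewrite lt_min ltr01 divr_gt0.
have l1 : l <= 1 by rewrite ge_min lexx.
have ll : `|l| <= 1 by rewrite gtr0_norm.
have := H l ll; rewrite m2E subrr mulr0 mul0r addr0 normrM (gtr0_norm l0).
have -> : C * l ^+ 3 = l * (C * l ^+ 2) by ring.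
rewrite ler_pM2l// => H1.
have le : l * (C + 1) <= e by rewrite -ler_pdivlMr// ge_min lexx orbT.
have : C * l ^+ 2 <= C * l by rewrite ler_wpM2l// expr2 ler_piMl// ltW.
by rewrite add0r; lra.
Qed.

End more_gaussian_moments.

(** * Independence and products of expectations *)

Section independence.
Context {d : measure_display} {T : measurableType d} {R : realType}.
Variable Pr : probability T R.

Definition indep_of (F : set_system T) (Y : T -> R) :=
  forall A, F A -> forall B : set R, measurable B ->
    Pr (A `&` Y @^-1` B) = (Pr A * Pr (Y @^-1` B))%E.

(** For fixed [E], both [Pr (A & E)] and [Pr A * Pr E] are finite measures in [A]. They agree on a
    class closed under intersection that contains the whole space, hence on the sigma-algebra it
    generates. *)
Lemma indep_of_sigma (G : set_system T) (Y : T -> R) :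
  measurable_fun setT Y -> G setT -> setI_closed G -> G `<=` measurable ->
  indep_of G Y -> indep_of <<s G >> Y.
Proof.
move=> mY GT GI mG iG A GA B mB.
have mE : measurable (Y @^-1` B) by rewrite -[X in measurable X]setTI; exact: mY.
set E := Y @^-1` B in mE *.
pose m1 := mrestr Pr mE.
have PE : (0 <= fine (Pr E))%R by rewrite fine_ge0.
pose m2 := mscale (NngNum PE) Pr.
have PEE : Pr E = (fine (Pr E))%:E by rewrite fineK// fin_num_measure.
have m12 : forall A, <<s G >> A -> m1 A = m2 A.
  apply: (@g_sigma_algebra_measure_unique _ R T G mG (fun=> setT)) => //.
  - by rewrite bigcup_const//; exists 0%N.
  - move=> C GC; apply: (etrans (iG C GC B mB)).
    by rewrite muleC {1}PEE.
  - by move=> _; rewrite /= /mrestr setTI PEE ltry.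
by apply: (etrans (m12 A GA)); rewrite muleC [in RHS]PEE.
Qed.

(** Independence makes the law of the pair a product measure, to which Tonelli's theorem applies. *)
Lemma indep_ge0_integral (phi Y : T -> R) (f g : R -> \bar R) :
  measurable_fun setT phi -> measurable_fun setT Y ->
  (forall A B : set R, measurable A -> measurable B ->
    Pr (phi @^-1` A `&` Y @^-1` B) = (Pr (phi @^-1` A) * Pr (Y @^-1` B))%E) ->
  measurable_fun setT f -> measurable_fun setT g ->
  (forall x, 0 <= f x)%E -> (forall x, 0 <= g x)%E ->
  (\int[Pr]_w (f (phi w) * g (Y w)) =
   (\int[Pr]_w f (phi w)) * \int[Pr]_w g (Y w))%E.
Proof.
move=> mphi mY ind mf mg f0 g0.
pose phi' : {mfun T >-> R} := HB.pack phi (isMeasurableFun.Build _ _ _ _ _ mphi).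
pose Y' : {mfun T >-> R} := HB.pack Y (isMeasurableFun.Build _ _ _ _ _ mY).
have mpair : measurable_fun setT (fun w => (phi w, Y w)).
  exact: measurable_fun_pair.
pose pair' : {mfun T >-> (R * R)%type} :=
  HB.pack (fun w => (phi w, Y w)) (isMeasurableFun.Build _ _ _ _ _ mpair).
pose h (z : R * R) := (f z.1 * g z.2)%E.
have mh : measurable_fun setT h.
  apply: emeasurable_funM.
    by apply: measurableT_comp => //; exact: measurable_fst.
  by apply: measurableT_comp => //; exact: measurable_snd.
have h0 z : (0 <= h z)%E by rewrite mule_ge0.
transitivity (\int[distribution Pr pair']_z h z)%E.
  by rewrite (@ge0_integral_distribution _ _ _ _ _ Pr pair').
transitivity (\int[distribution Pr phi' \x distribution Pr Y']_z h z)%E.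
  apply: eq_measure_integral => X mX _.
  apply/esym; apply: (@product_measure_unique _ _ _ _ _ _ _ (distribution Pr pair')).
    move=> A B mA mB.
    rewrite /distribution /pushforward/= -ind//.
  exact: mX.
rewrite fubini_tonelli1// /fubini_F/=.
under eq_integral => x _.
  rewrite /h/= ge0_integralZl//.
  over.
rewrite ge0_integralZr//; last exact: integral_ge0.
by rewrite !ge0_integral_distribution.
Qed.

Local Notation "'E[ f ]" := (Rintegral Pr setT f) (at level 0).

(** The nonnegative case is reached by adding the bound [M] to [phi] and by splitting [g] into its
    positive and negative parts. *)
Lemma E_indep_mul (F : set_system T) (phi Y : T -> R) (M : R) :
  F `<=` measurable ->
  (forall B : set R, measurable B -> F (phi @^-1` B)) ->
  (forall w, `|phi w| <= M) -> measurable_fun setT Y -> indep_of F Y ->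
  forall g : R -> R, measurable_fun setT g -> L1 Pr (fun w => g (Y w)) ->
  'E[fun w => phi w * g (Y w)] = 'E[phi] * 'E[fun w => g (Y w)].
Proof.
move=> mF Fphi phiM mY ind g mg ig.
have mphi : measurable_fun setT phi.
  by move=> _ B mB; rewrite setTI; apply: mF; exact: Fphi.
have iphi : L1 Pr phi by apply: L1_bounded phiM.
have ind' A B : measurable A -> measurable B ->
    Pr (phi @^-1` A `&` Y @^-1` B) = (Pr (phi @^-1` A) * Pr (Y @^-1` B))%E.
  by move=> mA mB; apply: ind => //; exact: Fphi.
have pos (k : R -> R) : measurable_fun setT k -> (forall y, 0 <= k y) ->
    L1 Pr (fun w => k (Y w)) ->
    'E[fun w => phi w * k (Y w)] = 'E[phi] * 'E[fun w => k (Y w)].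
  move=> mk k0 ik.
  (* On the values of [phi] this is [x + M]; the maximum makes [f] nonnegative on the whole line. *)
  pose f x := Num.max (x + M) 0.
  have fphi w : f (phi w) = phi w + M.
    rewrite /f; apply/max_idPl; have := phiM w; rewrite ler_norml => /andP[h _].
    lra.
  have mf : measurable_fun setT f.
    by apply: measurable_maxr => //; exact: measurable_funD.
  have iphiM : L1 Pr (fun w => phi w + M) by apply: L1D => //; exact: L1_cst.
  have H : 'E[fun w => (phi w + M) * k (Y w)] =
      'E[fun w => phi w + M] * 'E[fun w => k (Y w)].
    rewrite /Rintegral -fineM ?integrable_fin_num//.
    congr fine.
    transitivity (\int[Pr]_w ((EFin \o f) (phi w) * (EFin \o k) (Y w)))%E.
      by apply: eq_integral => w _; rewrite /= fphi EFinM.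
    rewrite (@indep_ge0_integral phi Y (EFin \o f) (EFin \o k))//.
    - by congr (_ * _)%E; apply: eq_integral => w _; rewrite /= fphi.
    - exact/measurable_EFinP.
    - exact/measurable_EFinP.
    - by move=> x; rewrite lee_fin le_max lexx orbT.
  have iM : L1 Pr (fun w => M * k (Y w)) by exact: L1Z.
  have iphik : L1 Pr (fun w => phi w * k (Y w)) by exact: L1_mul_bounded phiM ik.
  move: H; under [fun w => _ * k (Y w)]eq_fun do rewrite mulrDl.
  have MkE : 'E[fun w => M * k (Y w)] = M * 'E[fun w => k (Y w)] by exact: EZ.
  have E1 : 'E[fun w => phi w * k (Y w) + M * k (Y w)] =
      'E[fun w => phi w * k (Y w)] + M * 'E[fun w => k (Y w)].
    by rewrite -MkE; exact: ED.
  have E2 : 'E[fun w => phi w + M] = 'E[phi] + M.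
    by rewrite -[in RHS](E_cst Pr M); apply: ED => //; exact: L1_cst.
  by rewrite E1 E2 mulrDl => /addIr.
pose gp y := Num.max (g y) 0; pose gn y := Num.max (- g y) 0.
have gE y : g y = gp y - gn y.
  by rewrite /gp /gn; case: (leP (g y) 0) => ?; case: (leP (- g y) 0) => ?; lra.
have mgp : measurable_fun setT gp by apply: measurable_maxr.
have mgn : measurable_fun setT gn.
  by apply: measurable_maxr => //; exact: measurable_funN.
have igp : L1 Pr (fun w => gp (Y w)).
  apply: L1_le (L1_norm ig) _; first exact: measurableT_comp.
  by move=> w; rewrite /gp ger0_norm ?le_max ?lexx ?orbT// ge_max ler_norm normr_ge0.
have ign : L1 Pr (fun w => gn (Y w)).
  apply: L1_le (L1_norm ig) _; first exact: measurableT_comp.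
  move=> w; rewrite /gn ger0_norm ?le_max ?lexx ?orbT// ge_max normr_ge0 andbT.
  by rewrite -normrN ler_norm.
have ephi (k : R -> R) : L1 Pr (fun w => k (Y w)) -> L1 Pr (fun w => phi w * k (Y w)).
  by move=> ik; exact: L1_mul_bounded phiM ik.
transitivity ('E[fun w => phi w * gp (Y w) - phi w * gn (Y w)]).
  by apply: eq_Rintegral => w _; rewrite gE mulrBr.
rewrite EB; [|exact: ephi|exact: ephi].
rewrite !pos//; [|by move=> y; rewrite le_max lexx orbT..].
rewrite -mulrBr -EB//; congr (_ * _).
by apply: eq_Rintegral => w _; rewrite gE.
Qed.

End independence.

(** * Independence of Brownian increments from the past demand *)

Section brownian_increments.
Context {d : measure_display} {T : measurableType d} {R : realType}.
Variables (Pr : probability T R) (W : R -> T -> R).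
Hypothesis hW : standard_brownian_motion Pr W.

Let mW t : 0 <= t -> measurable_fun setT (W t).
Proof. by move=> t0; exact: (bm_measurable hW). Qed.

Lemma measurable_increment (s t : R) : 0 <= s -> s <= t ->
  measurable_fun setT (fun w => W t w - W s w).
Proof.
by move=> s0 st; apply: measurable_funB; apply: mW => //; exact: le_trans st.
Qed.

Section increments.
Variables (t : nat -> R) (n : nat).
Hypotheses (t0 : t 0%N = 0) (tm : {homo t : i j / (i <= j)%N >-> i <= j}).

Let incr i w := W (t i.+1) w - W (t i) w.

Let tge0 i : 0 <= t i.
Proof. by rewrite -t0; apply: tm. Qed.

Let mincr i : measurable_fun setT (incr i).
Proof. by apply: measurable_increment => //; apply: tm. Qed.

Definition increment_boxes : set_system T :=
  [set A | exists B : nat -> set R, (forall i, measurable (B i)) /\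
    A = \bigcap_(i in `I_n) (incr i @^-1` B i)].

(** On boxes, independence compares the product formula for [n.+1] increments with the one for the
    first [n]; boxes are closed under intersection. *)
Lemma increment_boxes_indep : indep_of Pr <<s increment_boxes >> (incr n).
Proof.
apply: indep_of_sigma.
- exact: mincr.
- exists (fun=> setT); split=> //; apply/seteqP; split => // w _ i _ //.
- move=> _ _ [B [mB ->]] [B' [mB' ->]].
  exists (fun i => B i `&` B' i); split; first by move=> i; exact: measurableI.
  by rewrite -bigcapI; apply: eq_bigcapr => i _; rewrite preimage_setI.
- move=> _ [B [mB ->]]; apply: fin_bigcap_measurable => // i _.
  by rewrite -[X in measurable X]setTI; exact: mincr.
- move=> _ [B [mB ->]] C mC.
  (* One family of sets serves for both product formulas. *)
  pose B' i := if (i < n)%N then B i else C.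
  have mB' i : measurable (B' i) by rewrite /B'; case: ifP.
  have BE : \bigcap_(i in `I_n) (incr i @^-1` B i) =
      \bigcap_(i in `I_n) (incr i @^-1` B' i).
    by apply: eq_bigcapr => i /= ilt; rewrite /B' ilt.
  have := bm_independent hW n.+1 (t := t) (B := B') (tge0 0%N) tm mB'.
  have capS (F : nat -> set T) : \bigcap_(i in `I_n.+1) F i =
      \bigcap_(i in `I_n) F i `&` F n.
    by rewrite !bigcap_mkord big_ord_recr.
  rewrite capS big_ord_recr/=.
  rewrite {1 2}/B' ltnn -BE => ->.
  rewrite BE -(bm_independent hW n (t := t) (B := B') (tge0 0%N) tm mB').
  by have -> : B' n = C by rewrite /B' ltnn.
Qed.

(** [W (t i)] is the sum of the first [i] increments because [W] starts at 0. *)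
Lemma measurable_increment_boxes i : (i <= n)%N ->
  measurable_fun setT (W (t i) : g_sigma_algebraType increment_boxes -> R).
Proof.
elim: i => [_|i IH ilt].
  have -> : W (t 0%N) = cst 0 by apply/funext => w; rewrite t0 (bm_zero hW).
  exact: measurable_cst.
have -> : W (t i.+1) = (fun w => W (t i) w + incr i w).
  by apply/funext => w; rewrite /incr; ring.
apply: measurable_funD; first exact: (IH (ltnW ilt)).
move=> _ B mB; rewrite setTI; apply: sub_sigma_algebra.
exists (fun j => if j == i then B else setT); split.
  by move=> j; case: ifP.
apply/seteqP; split => w /=.
  by move=> Bw j _ /=; case: eqP => // ->.
by move=> /(_ i ilt)/=; rewrite eqxx.
Qed.

End increments.

Section filtration.
Variables (d0 b sigma s s' : R).
Hypotheses (s0 : 0 <= s) (ss : s <= s').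
Let D := demand b sigma d0 W.

Let mD t : 0 <= t -> measurable_fun setT (D t).
Proof.
move=> t0; apply: measurable_funD => //.
by apply: measurable_funM => //; exact: mW.
Qed.

Definition demand_boxes : set_system T :=
  [set A | exists (n : nat) (t : nat -> R) (B : nat -> set R),
    [/\ forall i, 0 <= t i <= s, forall i, measurable (B i) &
        A = \bigcap_(i in `I_n) (D (t i) @^-1` B i)]].

Lemma demand_boxesI : setI_closed demand_boxes.
Proof.
move=> _ _ [n [t [B [ht mB ->]]]] [n' [t' [B' [ht' mB' ->]]]].
exists (n + n')%N, (fun i => if (i < n)%N then t i else t' (i - n)%N),
  (fun i => if (i < n)%N then B i else B' (i - n)%N); split.
- by move=> i; case: ifP.
- by move=> i; case: ifP.
- apply/seteqP; split => w.
    move=> [h h'] i /= ilt; case: ifPn => ni; first exact: h.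
    by apply: h' => /=; rewrite ltn_subLR// leqNgt.
  move=> h; split=> i /= ilt.
    by have := h i (ltn_addr _ ilt); rewrite /= ilt.
  have := h (n + i)%N; rewrite /= ltn_add2l => /(_ ilt).
  by rewrite ltnNge leq_addr/= addKn.
Qed.

(** The times of a box, completed by 0, are sorted, so that the demand at each of them is determined
    by consecutive increments of [W] before [s]. *)
Lemma demand_boxes_indep :
  indep_of Pr demand_boxes (fun w => W s' w - W s w).
Proof.
move=> A [n [r [B [hr mB AE]]]] C mC.
pose tau := sort <=%R (0 :: [seq r i | i <- iota 0 n]).
have tau_sorted : sorted <=%R tau by apply: sort_sorted; exact: le_total.
have tau_mem x : (x \in tau) = (x \in 0 :: [seq r i | i <- iota 0 n]).
  by rewrite mem_sort.
have tau_itv x : x \in tau -> 0 <= x <= s.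
  rewrite tau_mem inE => /orP[/eqP->|/mapP[i _ ->]]; last exact: hr.
  by rewrite lexx s0.
pose m := size tau.
have m0 : (0 < m)%N by rewrite /m size_sort.
(* After the [m] sorted times come [s] and then constantly [s'], so that the increment of index [m]
   is the one from [s] to [s']. *)
pose t i := if (i < m)%N then nth 0 tau i else if i == m then s else s'.
have tS i : t i <= t i.+1.
  rewrite /t; case: (ltnP i.+1 m) => im1.
    by rewrite (ltnW im1); move/(sortedP 0) : tau_sorted; apply.
  case: (ltnP i m) => im.
    have -> : i.+1 == m by rewrite eqn_leq im im1.
    by have /andP[] := tau_itv _ (mem_nth 0 im).
  by rewrite (gtn_eqF (im : (m < i.+1)%N)); case: eqP.
have tm : {homo t : i j / (i <= j)%N >-> i <= j}.
  by apply: homo_leq => //; exact: le_trans.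
have t00 : t 0%N = 0.
  rewrite /t m0; apply/le_anti.
  have /andP[-> _] := tau_itv _ (mem_nth 0 m0); rewrite andbT.
  have /(nthP 0)[k km kE] : 0 \in tau by rewrite tau_mem mem_head.
  by rewrite -[leRHS]kE (sorted_leq_nth le_trans lexx 0 tau_sorted).
have -> : (fun w => W s' w - W s w) = (fun w => W (t m.+1) w - W (t m) w).
  by rewrite /t ltnn eqxx ltnNge leqnSn/= (gtn_eqF (ltnSn m)).
apply: (increment_boxes_indep t00 tm) => //.
rewrite AE; apply: (@fin_bigcap_measurable _ (g_sigma_algebraType (increment_boxes t m))) => //.
move=> i /= ilt.
have : r i \in tau by rewrite tau_mem inE map_f ?orbT// mem_iota.
move=> /(nthP 0)[k km rk].
have -> : r i = t k by rewrite /t km.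
have mDk : measurable_fun setT (D (t k) : g_sigma_algebraType (increment_boxes t m) -> R).
  apply: measurable_funD => //; apply: measurable_funM => //.
  by apply: measurable_increment_boxes => //; exact: ltnW.
by rewrite -[X in measurable X]setTI; exact: mDk.
Qed.

Lemma natural_filtration_measurable : natural_filtration D s `<=` measurable.
Proof.
apply: smallest_sub; first exact: sigma_algebra_measurable.
move=> A [r /=]; rewrite in_itv/= => /andP[r0 _] [B mB <-].
by rewrite setTI -[X in measurable X]setTI; exact: mD.
Qed.

Lemma natural_filtration_indep :
  indep_of Pr (natural_filtration D s) (fun w => W s' w - W s w).
Proof.
have sub : natural_filtration D s `<=` <<s demand_boxes >>.
  apply: smallest_sub; first exact: smallest_sigma_algebra.
  move=> A [r /= rs [B mB <-]].
  apply: sub_sigma_algebra; exists 1%N, (fun=> r), (fun=> B); split => //.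
  by rewrite setTI; apply/seteqP; split => w /=; [move=> h i|move/(_ 0%N); apply].
have H : indep_of Pr <<s demand_boxes >> (fun w => W s' w - W s w).
  apply: indep_of_sigma.
  - exact: measurable_increment.
  - exists 0%N, (fun=> 0), (fun=> setT); split => //.
      by move=> i; rewrite lexx s0.
    by apply/seteqP; split => // w _ i.
  - exact: demand_boxesI.
  - move=> _ [n [t [B [ht mB ->]]]]; apply: fin_bigcap_measurable => // i _.
    rewrite -[X in measurable X]setTI; apply: mD => //.
    by have /andP[] := ht i.
  - exact: demand_boxes_indep.
by move=> A /sub; exact: H.
Qed.

End filtration.

End brownian_increments.

(** * Joint measurability, and translates of compact sets *)

Section joint_measurability.
Context {d : measure_display} {T : measurableType d} {R : realType}.
Notation mu := (@lebesgue_measure R).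

(** Continuity relative to the half-line, in a form that never evaluates [f] at negative times. *)
Definition continuous_path (f : R -> R) := forall t, 0 <= t ->
  forall e, 0 < e -> exists2 del, 0 < del &
    forall s, 0 <= s -> `|s - t| < del -> `|f s - f t| < e.

Lemma continuous_path_within (f : R -> R) :
  {within `[0, +oo[%classic, continuous f} -> continuous_path f.
Proof.
move=> /subspace_continuousP cf t t0 e e0.
have /cvgrPdist_lt /(_ e e0) : f @ within `[0, +oo[%classic (nbhs t) --> f t.
  by apply: cf; rewrite /= in_itv/= t0.
rewrite /within/= => /nbhs_ballP[del /= del0 H]; exists del => // s s0 st.
rewrite distrC; apply: H; last by rewrite /= in_itv/= s0.
by rewrite /ball/= distrC.
Qed.

Lemma continuous_pathD (f g : R -> R) : continuous_path f -> continuous_path g ->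
  continuous_path (fun t => f t + g t).
Proof.
move=> cf cg t t0 e e0; have e2 : 0 < e / 2 by rewrite divr_gt0.
have [d1 d10 H1] := cf t t0 _ e2; have [d2 d20 H2] := cg t t0 _ e2.
exists (Num.min d1 d2); first by rewrite lt_min d10.
move=> s s0; rewrite lt_min => /andP[h1 h2].
have -> : f s + g s - (f t + g t) = (f s - f t) + (g s - g t) by ring.
apply: (le_lt_trans (ler_normD _ _)).
by have := H1 s s0 h1; have := H2 s s0 h2; lra.
Qed.

Lemma continuous_pathZ (c : R) (f : R -> R) : continuous_path f ->
  continuous_path (fun t => c * f t).
Proof.
move=> cf t t0 e e0.
have c1 : 0 < `|c| + 1 by rewrite ltr_wpDl.
have [del del0 H] := cf t t0 _ (divr_gt0 e0 c1); exists del => // s s0 st.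
rewrite -mulrBr normrM; apply: (@le_lt_trans _ _ ((`|c| + 1) * `|f s - f t|)).
  by rewrite ler_wpM2r// lerDl.
by rewrite mulrC -ltr_pdivlMr//; exact: H.
Qed.

Lemma continuous_pathB (f g : R -> R) : continuous_path f -> continuous_path g ->
  continuous_path (fun t => f t - g t).
Proof.
move=> cf cg; apply: continuous_pathD => //.
have -> : (fun t => - g t) = (fun t => -1 * g t) by apply/funext => t; rewrite mulN1r.
exact: continuous_pathZ.
Qed.

Lemma lipschitz_continuous_path (f : R -> R) (M : R) :
  (forall s t, 0 <= s -> s <= t -> `|f t - f s| <= M * (t - s)) ->
  continuous_path f.
Proof.
move=> fM t t0 e e0.
have M0 : 0 <= M.
  by have := fM 0 1 (lexx _) ler01; rewrite subr0 mulr1; exact: le_trans.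
have M1 : 0 < M + 1 by rewrite ltr_wpDl.
exists (e / (M + 1)); first by rewrite divr_gt0.
move=> s s0; rewrite ltr_pdivlMr// mulrC => h; apply: le_lt_trans h.
have H : `|f s - f t| <= M * `|s - t|.
  have [st|/ltW ts] := leP s t.
    by rewrite distrC (distrC s) (@ger0_norm _ (t - s)) ?subr_ge0// fM.
  by rewrite (@ger0_norm _ (s - t)) ?subr_ge0// fM.
by apply: (le_trans H); rewrite ler_wpM2r// lerDl.
Qed.

(** Freezing the path at its initial value for negative times gives continuity on the whole line,
    from which measurability and integrability are derived. *)
Lemma continuous_path_extend (f : R -> R) : continuous_path f ->
  continuous (fun t : R => f (Num.max t 0)).
Proof.
move=> cf t; apply/cvgrPdist_lt => e e0.
have t0 : 0 <= Num.max t 0 by rewrite le_max lexx orbT.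
have [del del0 H] := cf _ t0 e e0.
exists del => //= y; rewrite /ball_/= => ty; rewrite distrC; apply: H.
  by rewrite le_max lexx orbT.
apply: le_lt_trans ty; rewrite distrC.
by case: (leP t 0) => ?; case: (leP y 0) => ?; rewrite ?subrr ?normr0 ?normr_ge0//;
  rewrite ler_norml; have := ler_norm (t - y); have := ler_norm (y - t);
  rewrite (distrC y) => *; apply/andP; split; lra.
Qed.

(** With time rounded down to multiples of [n.+1%:R^-1], preimages are countable unions of
    rectangles; continuity of the paths gives the pointwise limit. *)
Lemma measurable_joint (X : R -> T -> R) :
  (forall t, 0 <= t -> measurable_fun setT (X t)) ->
  (forall w, continuous_path (X ^~ w)) ->
  measurable_fun setT (fun z : T * R => X (Num.max z.2 0) z.1).
Proof.
move=> mX cX.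
pose k n (t : R) := Num.truncn (n.+1%:R * Num.max t 0).
pose q n (t : R) : R := (k n t)%:R / n.+1%:R.
have kP n t : (k n t)%:R <= n.+1%:R * Num.max t 0 < (k n t).+1%:R.
  by apply: truncn_itv; rewrite mulr_ge0// le_max lexx orbT.
have mk n : measurable_fun setT (fun t : R => n.+1%:R * Num.max t 0).
  by apply: measurable_funM => //; exact: measurable_maxr.
apply: (@measurable_fun_cvg _ _ _ _ (fun n (z : T * R) => X (q n z.2) z.1)).
- move=> n _ B mB; rewrite setTI.
  have -> : (fun z : T * R => X (q n z.2) z.1) @^-1` B =
    \bigcup_j ((X (j%:R / n.+1%:R) @^-1` B) `*`
      ((fun t => n.+1%:R * Num.max t 0) @^-1` `[j%:R, j.+1%:R[)).
    apply/seteqP; split => [[w t]/= h|[w t] [j _ /= [h1 h2]]].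
      by exists (k n t) => //=; split=> //; rewrite in_itv/=; exact: kP.
    rewrite /q (_ : k n t = j)//.
    by apply: truncn_def; move: h2; rewrite in_itv.
  apply: bigcupT_measurable => j; apply: measurableX.
    by rewrite -[X in measurable X]setTI; apply: mX.
  by rewrite -[X in measurable X]setTI; exact: mk.
- move=> [w t] _ /=; set t' := Num.max t 0.
  have t'0 : 0 <= t' by rewrite le_max lexx orbT.
  apply/cvgrPdist_lt => e e0.
  have [del del0 H] := cX w t' t'0 e e0.
  near=> n; rewrite distrC; apply: H.
    by rewrite /q divr_ge0.
  have n0 : 0 < n.+1%:R :> R by [].
  have /andP[h1 h2] := kP n t; rewrite -/t' in h1 h2.
  have q1 : q n t <= t' by rewrite /q ler_pdivrMr// mulrC.
  have q2 : t' < q n t + n.+1%:R^-1.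
    by rewrite /q -[X in _ + X]mul1r -mulrDl natr1 ltr_pdivlMr// mulrC.
  rewrite ler0_norm ?subr_le0// opprB.
  apply: (@lt_trans _ _ n.+1%:R^-1); first by rewrite ltrBlDr addrC.
  by near: n; exact: near_infty_natSinv_lt (PosNum del0).
Unshelve. all: by end_near. Qed.

(** Tonelli's theorem gives both parts; the first makes the time integral of the deviation a random
    variable. *)
Lemma ge0_path_integral_le (Pr : probability T R) (X : R -> T -> R) (s s' c : R) :
  0 <= s -> s <= s' ->
  measurable_fun setT (fun z : T * R => X (Num.max z.2 0) z.1) ->
  (forall t, s <= t <= s' -> (\int[Pr]_w (`|X t w - X s w|)%:E <= c%:E)%E) ->
  measurable_fun setT (fun w => \int[mu]_(t in `[s, s']) (`|X t w - X s w|)%:E)%E /\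
  (\int[Pr]_w \int[mu]_(t in `[s, s']) (`|X t w - X s w|)%:E
    <= (c * (s' - s))%:E)%E.
Proof.
move=> s0 ss mX Xc.
pose f (z : T * R) : \bar R := ((`|X (Num.max z.2 0) z.1 - X s z.1|)%:E *
  (\1_(`[s, s']%classic) z.2)%:E)%E.
have mf : measurable_fun setT f.
  apply: emeasurable_funM.
    apply/measurable_EFinP; apply: measurableT_comp => //.
    apply: measurable_funB => //.
    have -> : (fun z : T * R => X s z.1) =
       (fun z : T * R => X (Num.max z.2 0) z.1) \o (fun z => (z.1, s)).
      by apply/funext => z /=; rewrite (max_idPl s0).
    apply: measurableT_comp => //; apply: measurable_fun_pair => //.
  apply/measurable_EFinP; apply: measurableT_comp => //.
have f0 z : (0 <= f z)%E by rewrite mule_ge0 ?lee_fin.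
have fE w t : f (w, t) = ((fun t => (`|X t w - X s w|)%:E) \_ `[s, s']) t.
  rewrite /f /= patchE indicE; case: ifPn => [|_]; last by rewrite mule0.
  rewrite inE/= in_itv/= => /andP[st _].
  by rewrite mule1 (max_idPl _)// (le_trans s0).
have E w : (\int[mu]_(t in `[s, s']) (`|X t w - X s w|)%:E =
    \int[mu]_t f (w, t))%E.
  by rewrite integral_mkcond; apply: eq_integral => t _; rewrite -fE.
split.
  rewrite (_ : (fun w => _) = fubini_F mu f); last exact/funext.
  exact: measurable_fun_fubini_tonelli_F.
under eq_integral => w _ do rewrite E.
rewrite (@fubini_tonelli _ _ _ _ _ Pr mu f mf f0).
apply: (@le_trans _ _ (\int[mu]_t ((fun=> c%:E) \_ `[s, s']) t)%E).
  apply: ge0_le_integral_nonmeas.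
    by move=> t _; apply: integral_ge0.
  move=> t _; under eq_integral => w _ do rewrite fE.
  rewrite patchE; case: ifPn => ts.
    apply: le_trans (Xc t _); last by move: ts; rewrite inE/= in_itv.
    apply: ge0_le_integral_nonmeas => w _; first by rewrite patchE ts lee_fin.
    by rewrite patchE ts.
  by rewrite integral0_eq// => w _; rewrite patchE (negbTE ts).
rewrite -integral_mkcond integral_cst//= lebesgue_measure_itv/= lte_fin.
case: ifPn => [_|]; first by rewrite -EFinD -EFinM.
rewrite -leNgt => s's; have -> : s' = s by lra.
by rewrite mule0 subrr mulr0.
Qed.

Lemma limn_einf_ge (u : (\bar R)^nat) (N : nat) (c : \bar R) :
  (forall n, (N <= n)%N -> (c <= u n)%E) -> (c <= limn_einf u)%E.
Proof.
move=> cu; apply: (@le_trans _ _ (einfs u N)).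
  by apply: le_ereal_inf_tmp => _ [n /= Nn <-]; exact: cu.
rewrite limn_einf_lim; have nd := nondecreasing_einfs u.
have -> := cvg_lim _ (ereal_nondecreasing_cvgn nd) => //.
by apply: ereal_sup_ubound; exists N.
Qed.

(** Translation preserves the length of intervals, and these determine the measure. *)
Lemma lebesgue_measure_shift (c : R) (A : set R) : measurable A ->
  mu ((fun x => x + c) @^-1` A) = mu A.
Proof.
move=> mA.
have mc : measurable_fun setT (fun x : measurableTypeR R => (x + c : measurableTypeR R)).
  exact: measurable_funD.
pose f : {mfun (measurableTypeR R) >-> (measurableTypeR R)} :=
  HB.pack (fun x : measurableTypeR R => (x + c : measurableTypeR R))
    (isMeasurableFun.Build _ _ _ _ _ mc).
apply/esym; apply: (@lebesgue_measure_unique R (pushforward mu f)) => // _ [[a b] _ <-].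
rewrite /= /pushforward.
have -> : f @^-1` `]a, b] = `]a - c, b - c]%classic.
  by apply/seteqP; split => x /=; rewrite !in_itv/= /f/= ltrBlDr lerBrDr.
rewrite !lebesgue_measure_itv/= !lte_fin ltrD2r.
by case: ifP => // _; rewrite -!EFinD; congr EFin; ring.
Qed.

(** By compactness all sufficiently small translates of [A] stay in an open [U] that exceeds [A] by
    a set of measure less than [e]. A translate has the measure of [A], and its part outside [A]
    lies in that excess. *)
Lemma compact_shift_overlap (A : set R) (u : nat -> R) (e : R) : compact A ->
  0 < e -> u @ \oo --> 0 ->
  \forall n \near \oo,
    (mu A <= mu (A `&` (fun x => (x + u n)%R) @^-1` A) + e%:E)%E.
Proof.
move=> cA e0 u0.
have mA : measurable A by exact: compact_measurable.
have [U [oU AU UA]] := lebesgue_regularity_outer mA (compact_finite_measure cA) e0.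
have mU : measurable U by exact: open_measurable.
have near_cov : \forall n \near \oo, A `<=` [set x | U (x - u n)].
  have /compact_near_coveringP cov := cA.
  apply: (cov nat \oo (fun n x => U (x - u n))) => x Ax.
  have /nbhs_ballP[r /= r0 HU] := open_nbhs_nbhs (conj oU (AU x Ax)).
  have r2 : 0 < r / 2 by rewrite divr_gt0.
  exists (ball x (r / 2), [set n | `|u n| < r / 2]); last first.
    move=> [y n] [/= xy un]; apply: HU; rewrite /ball/= in xy *.
    have -> : x - (y - u n) = (x - y) + u n by ring.
    by apply: (le_lt_trans (ler_normD _ _)); lra.
  split => /=; first exact: nbhsx_ballx.
  have /cvgrPdist_lt /(_ _ r2) := u0; apply: filterS => n /=.
  by rewrite sub0r normrN.
apply: filterS near_cov => n An.
set A' := _ @^-1` A.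
have mA' : measurable A'.
  rewrite -[A']setTI; have : measurable_fun setT (fun x : R => x + u n).
    exact: measurable_funD.
  by apply.
have A'U : A' `<=` U by move=> x /An /=; rewrite addrK.
rewrite -(lebesgue_measure_shift (u n) mA) -/A'.
rewrite -[X in (mu X <= _)%E](setUIDK A' A) measureU//.
- rewrite setIC leeD2l//; apply: (le_trans _ (ltW UA)).
  apply: le_measure; rewrite ?inE//; [exact: measurableD|exact: measurableD|].
  by apply: setSD.
- exact: measurableI.
- exact: measurableD.
- by apply/seteqP; split => x // [[_ h] [_ h']].
Qed.

End joint_measurability.

(** * Brownian motion against Lipschitz curves *)

Section level_sets.
Context {d : measure_display} {T : measurableType d} {R : realType}.
Notation mu := (@lebesgue_measure R).
Variables (Pr : probability T R) (W : R -> T -> R).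
Hypothesis hW : standard_brownian_motion Pr W.

Lemma brownian_continuous_path w : continuous_path (W ^~ w).
Proof. by apply: continuous_path_within; exact: (bm_continuous hW). Qed.

Lemma measurable_brownian_joint :
  measurable_fun setT (fun z : T * R => W (Num.max z.2 0) z.1).
Proof.
apply: measurable_joint; first exact: (bm_measurable hW).
exact: brownian_continuous_path.
Qed.

Lemma measurable_brownian_at (g : R -> R) : measurable_fun setT g ->
  (forall t, 0 <= g t) ->
  measurable_fun setT (fun z : T * R => W (g z.2) z.1).
Proof.
move=> mg g0.
have -> : (fun z : T * R => W (g z.2) z.1) =
    (fun z : T * R => W (Num.max z.2 0) z.1) \o (fun z => (z.1, g z.2)).
  by apply/funext => z /=; rewrite (max_idPl (g0 _)).
apply: measurableT_comp; first exact: measurable_brownian_joint.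
by apply: measurable_fun_pair => //; apply: measurableT_comp.
Qed.

Let slow (K M del : R) : set (T * R) :=
  [set z | 0 <= z.2 <= M /\
    `|W (Num.max z.2 0 + del) z.1 - W (Num.max z.2 0) z.1| <= K * del].

Let measurable_slow K M del : 0 <= del -> measurable (slow K M del).
Proof.
move=> del0.
have -> : slow K M del = ([set: T] `*` `[0, M]%classic) `&`
  (fun z : T * R => `|W (Num.max z.2 0 + del) z.1 - W (Num.max z.2 0) z.1|)
    @^-1` `]-oo, K * del].
  by apply/seteqP; split => -[w t] /=; rewrite !in_itv/=;
    [move=> [h1 h2]|move=> [[_ h1] h2]]; do ?split.
apply: measurableI; first exact: measurableX.
rewrite -[X in measurable X]setTI.
have : measurable_fun setT (fun z : T * R =>
    `|W (Num.max z.2 0 + del) z.1 - W (Num.max z.2 0) z.1|).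
  apply: measurableT_comp => //; apply: measurable_funB.
    apply: (measurable_brownian_at (g := fun t => Num.max t 0 + del)).
      by apply: measurable_funD => //; exact: measurable_maxr.
    by move=> t; rewrite addr_ge0// le_max lexx orbT.
  exact: measurable_brownian_joint.
by apply.
Qed.

(** By [gaussian_small_ball] each time is slow with probability at most [2 * (K * del) / sqrt del];
    Tonelli's theorem integrates this over the times up to [M]. *)
Let slow_le K M del : 0 <= K -> 0 <= M -> 0 < del ->
  (\int[Pr]_w mu [set t | slow K M del (w, t)] <=
    (M * (2 * K * Num.sqrt del))%:E)%E.
Proof.
move=> K0 M0 del0.
have mS := measurable_slow K M (ltW del0).
pose f (z : T * R) : \bar R := (\1_(slow K M del) z)%:E.
have mf : measurable_fun setT f by apply/measurable_EFinP.
have f0 z : (0 <= f z)%E by rewrite lee_fin.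
have -> : (\int[Pr]_w mu [set t | slow K M del (w, t)] =
    \int[Pr]_w \int[mu]_t f (w, t))%E.
  apply: eq_integral => w _.
  have mw : measurable [set t | slow K M del (w, t)].
    have := measurable_xsection w mS.
    by congr (measurable _); apply/seteqP; split => t; rewrite /xsection/= inE.
  transitivity (\int[mu]_t (\1_[set t | slow K M del (w, t)] t)%:E)%E.
    by rewrite integral_indic// setIT.
  by apply: eq_integral => t _; rewrite /f !indicE; congr ((nat_of_bool _)%:R%:E).
rewrite (@fubini_tonelli _ _ _ _ _ Pr mu f mf f0).
apply: (@le_trans _ _ (\int[mu]_t
    ((fun=> (2 * K * Num.sqrt del)%:E) \_ `[0%R, M]) t)%E).
  apply: ge0_le_integral_nonmeas; first by move=> t _; apply: integral_ge0.
  move=> t _; rewrite patchE; case: ifPn => tM; last first.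
    rewrite integral0_eq// => w _; rewrite /f indicE memNset//=.
    by move=> [tM' _]; move/negP: tM; apply; rewrite inE/= in_itv.
  have /andP[t0 tM'] : 0 <= t <= M by move: tM; rewrite inE/= in_itv.
  have ms : measurable [set w | (`|W (t + del) w - W t w| <= K * del)%R].
    have := measurable_increment hW t0 (_ : t <= t + del).
    rewrite lerDl (ltW del0) => /(_ isT) mi.
    have mn : measurable_fun setT (fun w => `|W (t + del) w - W t w|).
      exact: measurableT_comp.
    have := mn measurableT `]-oo, K * del]%classic (measurable_itv _).
    by rewrite setTI; congr (measurable _); apply/seteqP; split => w /=;
      rewrite in_itv.
  have -> : (\int[Pr]_w f (w, t) =
      Pr [set w | (`|W (t + del) w - W t w| <= K * del)%R])%E.
    transitivity (\int[Pr]_w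
        (\1_[set w | (`|W (t + del) w - W t w| <= K * del)%R] w)%:E)%E; last first.
      by rewrite integral_indic// setIT.
    apply: eq_integral => w _; rewrite /f !indicE; congr ((nat_of_bool _)%:R%:E).
    apply/idP/idP => h; move: h; rewrite !inE /slow/= (max_idPl t0); first by case.
    by move=> h; split => //; rewrite t0.
  have sd : 0 < Num.sqrt del by rewrite sqrtr_gt0.
  have := @gaussian_small_ball _ T R Pr (fun w => W (t + del) w - W t w)
    (Num.sqrt del) sd.
  move=> /(_ _ (K * del)).
  rewrite mulr_ge0 ?(ltW del0)// => H.
  apply: le_trans (H _ isT) _.
    move=> B mB; have := bm_gaussian hW t0 (_ : t < t + del) mB.
    by rewrite ltrDl del0 addrAC subrr add0r => /(_ isT).
  rewrite lee_fin le_eqVlt; apply/orP; left; apply/eqP.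
  rewrite -{1}(sqr_sqrtr (ltW del0)); field.
  by rewrite gt_eqF.
rewrite -integral_mkcond integral_cst//= lebesgue_measure_itv/= lte_fin.
case: ifPn => [_|_]; first by rewrite -EFinD -EFinM lee_fin subr0 mulrC.
by rewrite mule0 lee_fin !mulr_ge0// sqrtr_ge0.
Qed.

(* If the level set [A] had positive measure, so would [A `&` (A - u)] for all small
   [u > 0], uniformly in [u]; on that set the increment of [W] over [u] is at most
   [K * u], an event of probability O(sqrt u). *)
Lemma brownian_level_null (g : R -> T -> R) (K : R) : 0 <= K ->
  (forall w s t, 0 <= s -> s <= t -> `|g t w - g s w| <= K * (t - s)) ->
  {ae Pr, forall w, mu [set t | 0 <= t /\ W t w = g t w] = 0%E}.
Proof.
move=> K0 gK.
(* The cutoff at [M] makes the level set compact, as [compact_shift_overlap] requires. *)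
pose A (M : nat) w := [set t : R | 0 <= t <= M%:R /\ W t w = g t w].
pose u (n : nat) : R := n.+1%:R^-1.
have u_cvg : u @ \oo --> 0 by exact: cvg_harmonic.
have u0 n : 0 < u n by rewrite /u invr_gt0.
have cA M w : compact (A M w).
  apply: (@subclosed_compact R _ `[0, M%:R]%classic).
  - have cf : continuous (fun t : R => W (Num.max t 0) w - g (Num.max t 0) w).
      apply: (@continuous_path_extend R (fun t => W t w - g t w)).
      apply: continuous_pathB; first exact: brownian_continuous_path.
      apply: (@lipschitz_continuous_path _ _ K).
      exact: gK.
    have -> : A M w = `[0, M%:R]%classic `&`
        (fun t : R => W (Num.max t 0) w - g (Num.max t 0) w) @^-1` [set 0].
      apply/seteqP; split => t /=; rewrite in_itv/=.
        by move=> [/andP[t0 tM] e]; rewrite (max_idPl t0) e subrr t0.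
      by move=> [/andP[t0 tM]]; rewrite (max_idPl t0) => /subr0_eq; rewrite /A/= t0.
    apply: closedI; first exact: itv_closed.
    by move/continuous_closedP : cf; apply; exact: closed_eq.
  - exact: segment_compact.
  - by move=> t [h _]; rewrite /= in_itv.
pose e M n w := mu [set t | slow K M%:R (u n) (w, t)].
have me M n : measurable_fun setT (e M n).
  have := measurable_fun_xsection mu (measurable_slow K M%:R (ltW (u0 n))).
  congr (measurable_fun _ _); apply/funext => w; rewrite /e/=; congr (mu _).
  by apply/seteqP; split => t; rewrite /xsection/= inE.
(* Fatou's lemma: the expected measure of the slow times tends to 0 with [u n]. *)
have null M : {ae Pr, forall w, limn_einf (fun n => e M n w) = 0%E}.
  have le0 : (\int[Pr]_w limn_einf (fun n => e M n w) <= 0)%E.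
    apply: (le_trans (fatou Pr measurableT (me M) _)) => //.
    have c0 : (fun n => \int[Pr]_w e M n w)%E @ \oo --> 0%E.
      apply: (@squeeze_cvge _ _ _ _ (fun=> 0%E) _
        (fun n => (M%:R * (2 * K * Num.sqrt (u n)))%:E)).
      - apply: nearW => n; rewrite integral_ge0//=.
        by apply: slow_le.
      - exact: cvg_cst.
      - apply: cvg_EFin; first by apply: nearW.
        have : Num.sqrt (u n) @[n --> \oo] --> Num.sqrt (0 : R).
          by apply: (continuous_cvg _ _ u_cvg); exact: sqrt_continuous.
        rewrite sqrtr0 => s0.
        rewrite -[X in _ --> X](mulr0 M%:R); apply: cvgMr.
        by rewrite -[X in _ --> X](mulr0 (2 * K)); apply: cvgMr.
    by rewrite (cvg_limn_einf_sup c0).1.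
  have mlim : measurable_fun setT (fun w => limn_einf (fun n => e M n w)).
    have -> : (fun w => limn_einf (fun n => e M n w)) =
        (fun w => - limn_esup (fun n => - e M n w))%E.
      apply/funext => w; rewrite -[RHS]limn_einfN; congr limn_einf.
      by apply/funext => n /=; rewrite oppeK.
    apply: measurableT_comp => //; apply: measurable_fun_limn_esup => n.
    exact: measurableT_comp.
  have lim0 w : (0 <= limn_einf (fun n => e M n w))%E.
    by apply: (@limn_einf_ge _ _ 0%N) => n _.
  have /(ae_eq_integral_abs Pr measurableT mlim) :
      (\int[Pr]_w `|limn_einf (fun n => e M n w)| = 0)%E.
    under eq_integral do rewrite gee0_abs//.
    by apply/le_anti/andP; split => //; exact: integral_ge0.
  by apply: filterS => w /(_ I).
have := ae_foralln null; apply: filterS => w Hw.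
have A0 M : mu (A M w) = 0%E.
  have mA : measurable (A M w) by exact: compact_measurable (cA M w).
  have fA := compact_finite_measure (cA M w).
  apply/eqP; rewrite eq_le measure_ge0 andbT leNgt; apply/negP => A_gt0.
  have AE : mu (A M w) = (fine (mu (A M w)))%:E.
    by rewrite fineK// ge0_fin_numE.
  have a0 : 0 < fine (mu (A M w)) by rewrite -lte_fin -AE.
  set a := fine _ in AE a0.
  have a2 : 0 < a / 2 by rewrite divr_gt0.
  have [N _ HN] := compact_shift_overlap (cA M w) a2 u_cvg.
  (* Between two points of the level set [W] varies as much as [g], so the overlap of [A] with its
     translate consists of slow times. *)
  have eN n : (N <= n)%N -> ((a / 2)%:E <= e M n w)%E.
    move=> Nn; have := HN n Nn; rewrite /= AE => H.
    have sub : (mu (A M w `&` (fun x => (x + u n)%R) @^-1` A M w) <= e M n w)%E.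
      apply: le_measure; rewrite ?inE.
      - apply: measurableI => //; rewrite -[X in measurable X]setTI.
        have : measurable_fun setT (fun x : R => x + u n) by exact: measurable_funD.
        by apply.
      - have := measurable_xsection w (measurable_slow K M%:R (ltW (u0 n))).
        by congr (measurable _); apply/seteqP; split => t; rewrite /xsection/= inE.
      - move=> t [[tM e1] [_ e2]]; split => //=.
        have /andP[t0 _] := tM.
        rewrite (max_idPl t0) e1 e2; apply: (le_trans (gK w _ _ t0 _)).
          by rewrite lerDl ltW.
        by rewrite addrAC subrr add0r.
    have := le_trans H (leeD2r _ sub).
    by rewrite -leeBlDr// -EFinB; congr (_ <= _)%E; congr EFin; field.
  have : ((a / 2)%:E <= limn_einf (fun n => e M n w))%E.
    exact: (@limn_einf_ge _ _ N).
  by rewrite Hw lee_fin leNgt a2.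
have -> : [set t | 0 <= t /\ W t w = g t w] = \bigcup_M A M w.
  apply/seteqP; split => t /=.
    move=> [t0 e1]; exists (Num.truncn t).+1 => //; split => //=.
    by rewrite t0 ltW// truncnS_gt.
  by move=> [M _ [/andP[t0 _] e1]].
apply/measure_negligible.
  by apply: bigcupT_measurable => M; exact: compact_measurable (cA M w).
apply: negligible_bigcup => M; apply/negligibleP; last exact: A0.
exact: compact_measurable (cA M w).
Qed.

End level_sets.

(** * Limit superior of bounded sequences *)

Section limit_superior.
Context {R : realType}.
Implicit Types (u v : nat -> R).

Lemma bounded_range_has_bounds u m M : (forall n, m <= u n <= M) ->
  has_ubound (range u) /\ has_lbound (range u).
Proof.
by move=> uM; split; [exists M|exists m] => _ [n _ <-]; case/andP: (uM n).
Qed.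

Let has_sup_sdrop u m M n : (forall n, m <= u n <= M) -> has_sup (sdrop u n).
Proof.
move=> uM; split; first by exists (u n); exists n => //=.
by exists M => _ [k _ <-]; case/andP: (uM k).
Qed.

Let limn_sup_inf u m M : (forall n, m <= u n <= M) ->
  limn_sup u = inf (range (sups u)).
Proof.
move=> uM; have [ub lb] := bounded_range_has_bounds uM.
by apply: cvg_lim => //; apply: cvg_sups_inf.
Qed.

Let sups_has_inf u m M : (forall n, m <= u n <= M) -> has_inf (range (sups u)).
Proof.
move=> uM; split; first by exists (sups u 0%N), 0%N.
exists m => _ [n _ <-] /=; case/andP: (uM n) => mu _.
by apply: le_trans mu _; apply: ub_le_sup; [exact: (has_sup_sdrop n uM).2|exists n => /=].
Qed.

Lemma limn_sup_lt u m M x : (forall n, m <= u n <= M) -> limn_sup u < x ->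
  \forall n \near \oo, u n <= x.
Proof.
move=> uM; rewrite (limn_sup_inf uM) => /(inf_lt (sups_has_inf uM).1) [_ [N _ <-]] /ltW Nx.
exists N => // n /= Nn; apply: le_trans Nx.
by apply: ub_le_sup; [exact: (has_sup_sdrop N uM).2|exists n].
Qed.

Lemma limn_sup_le u m M x : (forall n, m <= u n <= M) ->
  (\forall n \near \oo, u n <= x) -> limn_sup u <= x.
Proof.
move=> uM [N _ Nx]; rewrite (limn_sup_inf uM).
apply: (@le_trans _ _ (sups u N)).
  by apply: ge_inf; [exact: (sups_has_inf uM).2|exists N].
by apply: ge_sup; [exact: (has_sup_sdrop N uM).1|move=> _ [n /= Nn <-]; exact: Nx].
Qed.

Lemma limn_sup_leD u v m M m' M' c : (forall n, m <= u n <= M) ->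
  (forall n, m' <= v n <= M') ->
  (forall e, 0 < e -> \forall n \near \oo, u n <= v n + c + e) ->
  limn_sup u <= limn_sup v + c.
Proof.
move=> uM vM uv; apply/ler_addgt0Pr => e e0.
have e2 : 0 < e / 2 by rewrite divr_gt0.
apply: (limn_sup_le uM).
have vl : limn_sup v < limn_sup v + e / 2 by rewrite ltrDl.
have h1 := limn_sup_lt vM vl; have h2 := uv _ e2.
by apply: filterS2 h1 h2 => n h1 h2; lra.
Qed.

End limit_superior.

(** * Euler scheme for the threshold equation *)

Section euler_scheme.
Context {R : realType}.
Variables (c p0 : R) (f : R -> R).
Hypotheses (c0 : 0 <= c) (cf : continuous_path f).

Fixpoint euler (h : R) (k : nat) : R :=
  if k is k'.+1 then
    euler h k' + (if euler h k' < f (k'%:R * h) then c * h else 0)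
  else p0.

Let euler_mono h k l : 0 <= h -> (k <= l)%N ->
  0 <= euler h l - euler h k <= c * h * (l%:R - k%:R).
Proof.
move=> h0 kl; rewrite -(subnK kl); move: (l - k)%N => i.
elim: i => [|i IH]; first by rewrite add0n !subrr mulr0 lexx.
have ch : 0 <= c * h by rewrite mulr_ge0.
by rewrite addSn /=; move: IH; rewrite -natr1 !mulrBr mulrDr mulr1; case: ifPn => _ *; lra.
Qed.

Let euler_up h k l : (k <= l)%N ->
  (forall i, (k <= i < l)%N -> euler h i < f (i%:R * h)) ->
  euler h l = euler h k + c * h * (l%:R - k%:R).
Proof.
move=> kl; rewrite -(subnK kl); move: (l - k)%N => i.
elim: i => [|i IH] H; first by rewrite add0n !subrr mulr0 addr0.
rewrite addSn /= IH; last by move=> j /andP[j1 j2]; apply: H; rewrite j1 ltnW.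
rewrite -IH; last by move=> j /andP[j1 j2]; apply: H; rewrite j1 ltnW.
rewrite (H (i + k)%N) ?leq_addl ?addSn ?ltnS ?leqnn//.
rewrite IH; last by move=> j /andP[j1 j2]; apply: H; rewrite j1 ltnW.
by rewrite -[(i + k).+1%:R]natr1; ring.
Qed.

(** The scheme moves only from a position below [f], hence below [m], and so overshoots [m] by at
    most one step. *)
Let euler_cap h k l m : 0 <= h -> (k <= l)%N ->
  (forall i, (k <= i < l)%N -> f (i%:R * h) <= m) ->
  euler h l <= Num.max (euler h k) (m + c * h).
Proof.
move=> h0 kl; have ch : 0 <= c * h by rewrite mulr_ge0.
rewrite -(subnK kl); move: (l - k)%N => i.
elim: i => [|i IH] H; first by rewrite add0n le_max lexx.
have {}IH := IH (fun j h => H j (match andP h with conj a b =>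
  introT andP (conj a (ltnW b)) end)).
rewrite addSn /=; case: ifPn => [e1|_]; last by rewrite addr0.
rewrite le_max; apply/orP; right; rewrite lerD2r.
apply: (le_trans (ltW e1)); apply: H.
by rewrite leq_addl addSn ltnS leqnn.
Qed.

Let h (n : nat) : R := n.+1%:R^-1.
Let k n (t : R) := Num.truncn (n.+1%:R * t).
Definition euler_path n t := euler (h n) (k n t).

Let h0 n : 0 < h n. Proof. by rewrite invr_gt0. Qed.

Let kP n t : 0 <= t -> (k n t)%:R * h n <= t < (k n t)%:R * h n + h n.
Proof.
move=> t0; have /truncn_itv : 0 <= n.+1%:R * t by rewrite mulr_ge0.
rewrite -/(k n t) => /andP[h1 h2]; apply/andP; split.
  by rewrite ler_pdivrMr// mulrC.
by rewrite -[X in _ + X]mul1r -mulrDl natr1 ltr_pdivlMr// mulrC.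
Qed.

Let k_mono n s t : s <= t -> (k n s <= k n t)%N.
Proof. by move=> st; apply: le_truncn; rewrite ler_wpM2l. Qed.

Let hcvg e : 0 < e -> \forall n \near \oo, h n < e.
Proof. by move=> e0; exact: near_infty_natSinv_lt (PosNum e0). Qed.

Let chcvg e : 0 < e -> \forall n \near \oo, c * h n <= e.
Proof.
move=> e0; have c1 : 0 < c + 1 by rewrite ltr_wpDl.
have := hcvg (divr_gt0 e0 c1); apply: filterS => n.
rewrite ltr_pdivlMr// => /ltW; apply: le_trans; rewrite mulrC ler_wpM2l ?lerDl//.
exact: ltW.
Qed.

(** The additional [c * h n] comes from rounding the times down to the grid. *)
Lemma euler_path_incr n s t : 0 <= s -> s <= t ->
  0 <= euler_path n t - euler_path n s <= c * (t - s) + c * h n.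
Proof.
move=> s0 st; have := euler_mono (ltW (h0 n)) (k_mono n st).
rewrite -/(euler_path n t) -/(euler_path n s) => /andP[-> H] /=.
apply: (le_trans H); rewrite -mulrDr -mulrA ler_wpM2l//.
have /andP[a1 a2] := kP n s0; have /andP[b1 b2] := kP n (le_trans s0 st).
by rewrite mulrBr ![h n * _]mulrC; lra.
Qed.

Let euler_path0 n : euler_path n 0 = p0.
Proof. by rewrite /euler_path /k mulr0 truncn0. Qed.

Lemma euler_path_bounded n t : 0 <= t -> p0 <= euler_path n t <= p0 + (c * t + c).
Proof.
move=> t0; have := euler_path_incr n (lexx 0) t0; rewrite euler_path0 subr0.
have hn1 : c * h n <= c by rewrite ler_piMr// invf_le1// ler1n.
by move=> /andP[]; move: (c * t) => *; lra.
Qed.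

(* A limit superior is enough: no convergence of the scheme has to be proved. *)
Definition euler_limit t := limn_sup (euler_path ^~ t).
Notation P := euler_limit.

Lemma euler_limit0 : P 0 = p0.
Proof.
rewrite /P (_ : euler_path ^~ 0 = fun=> p0); last by apply/funext => n; exact: euler_path0.
by rewrite (cvg_limn_inf_sup (cvg_cst _)).2.
Qed.

Let bdd t : 0 <= t -> forall n, p0 <= euler_path n t <= p0 + (c * t + c).
Proof. by move=> t0 n; exact: euler_path_bounded. Qed.

Lemma euler_limit_incr s t : 0 <= s -> s <= t -> 0 <= P t - P s <= c * (t - s).
Proof.
move=> s0 st; have t0 := le_trans s0 st; apply/andP; split.
  rewrite subr_ge0 -[P t]addr0.
  apply: (limn_sup_leD (bdd s0) (bdd t0)) => e e0; apply: nearW => n.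
  by have /andP[+ _] := euler_path_incr n s0 st; lra.
rewrite lerBlDl; apply: (limn_sup_leD (bdd t0) (bdd s0)) => e e0.
have := chcvg e0; apply: filterS => n hn.
by have /andP[_] := euler_path_incr n s0 st; move: (c * (t - s)) => *; lra.
Qed.

Let radius (r e : R) : 0 < r -> 0 < e ->
  exists2 del : R, 0 < del & del <= r / 2 /\ c * del <= e.
Proof.
move=> r0 e0; have c1 : 0 < c + 1 by rewrite ltr_wpDl.
exists (Num.min (r / 2) (e / (c + 1))); first by rewrite lt_min !divr_gt0.
split; first by rewrite ge_min lexx.
have : Num.min (r / 2) (e / (c + 1)) <= e / (c + 1) by rewrite ge_min lexx orbT.
have : 0 <= Num.min (r / 2) (e / (c + 1)) by rewrite le_min !divr_ge0// ltW.
by move: (Num.min _ _) => x x0; rewrite ler_pdivlMr// mulrDr mulr1 mulrC; lra.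
Qed.

(** The limit is Lipschitz and [f] is continuous, so the gap at [t] persists on a window, for the
    scheme with large [n] too. There every step moves up, so the limit grows at least at rate [c],
    which is also its largest possible rate. *)
Lemma euler_limit_up t : 0 <= t -> P t < f t ->
  exists2 del, 0 < del & forall s s', 0 <= s -> s <= s' -> t - del < s ->
    s' < t + del -> P s' = P s + c * (s' - s).
Proof.
move=> t0 Pf; pose e : R := (f t - P t) / 4.
have e0 : 0 < e by rewrite /e; lra.
have [d1 d10 fd] := cf t0 e0.
have [del del0 [deld cdel]] := radius d10 e0.
exists del => // s s' s0 ss ts st'.
have s'0 := le_trans s0 ss; have td0 : 0 <= t + del by lra.
apply/le_anti/andP; split.
  by have /andP[_] := euler_limit_incr s0 ss; lra.
rewrite -lerBrDr; rewrite -(addrC (- _)) addrC.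
apply: (limn_sup_leD (bdd s0) (bdd s'0)) => e1 e10.
(* The scheme is nondecreasing, so a bound at the right end of the window holds throughout it. *)
have Ptd : P (t + del) < P t + 2 * e.
  have ttd : t <= t + del by lra.
  have /andP[_] := euler_limit_incr t0 ttd.
  by rewrite addrAC subrr add0r; lra.
have h1 := limn_sup_lt (bdd td0) Ptd.
have h2 := chcvg e10.
have h3 := hcvg (_ : 0 < d1 / 2).
apply: filterS3 h1 h2 (h3 _); last by rewrite divr_gt0.
move=> n h1 h2' h3'.
have /(_ (k n s) (k n s') (k_mono n ss)) := @euler_up (h n).
rewrite -/(euler_path n s) -/(euler_path n s') => ->.
  have /andP[a1 a2] := kP n s0; have /andP[b1 b2] := kP n s'0.
  have : c * (s' - s) <= c * h n * ((k n s')%:R - (k n s)%:R) + c * h n.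
    by rewrite -mulrA -mulrDr ler_wpM2l// mulrBr ![h n * _]mulrC; lra.
  by lra.
move=> i /andP[ki ik].
have /andP[a1 a2] := kP n s0; have /andP[b1 b2] := kP n s'0.
have i1 : i%:R * h n <= t + del.
  have : (i%:R : R) <= (k n s')%:R by rewrite ler_nat ltnW.
  by move=> /(ler_wpM2r (ltW (h0 n))); lra.
have i2 : t - del - h n < i%:R * h n.
  have : ((k n s)%:R : R) <= i%:R by rewrite ler_nat.
  by move=> /(ler_wpM2r (ltW (h0 n))); lra.
have i0 : 0 <= i%:R * h n by rewrite mulr_ge0// ltW.
have fi : `|f (i%:R * h n) - f t| < e.
  by apply: fd => //; rewrite ltr_norml; apply/andP; split; lra.
have ei : euler (h n) i <= euler_path n (t + del).
  have : (i <= k n (t + del))%N.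
    by apply: (leq_trans (ltnW ik)); apply: k_mono; exact: ltW.
  by move=> /(euler_mono (ltW (h0 n)))/andP[]; rewrite -/(euler_path n _); lra.
move: fi; rewrite ltr_norml => /andP[fi _].
by move: ei h1 fi; rewrite /e; lra.
Qed.

(** A limit superior gives no eventual lower bound on the scheme, so the previous argument does not
    carry over. Instead, by [euler_cap], the scheme cannot be pushed above a level close to [f t],
    which lies below [P s]; hence the limit does not rise. *)
Lemma euler_limit_flat t : 0 <= t -> f t < P t ->
  exists2 del, 0 < del & forall s s', 0 <= s -> s <= s' -> t - del < s ->
    s' < t + del -> P s' = P s.
Proof.
move=> t0 Pf; pose e : R := (P t - f t) / 4.
have e0 : 0 < e by rewrite /e; lra.
have [d1 d10 fd] := cf t0 e0.
have [del del0 [deld cdel]] := radius d10 e0.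
exists del => // s s' s0 ss ts st'.
have s'0 := le_trans s0 ss.
have Ps : f t + 2 * e <= P s.
  have [st|/ltW ts'] := leP s t.
    have /andP[_] := euler_limit_incr s0 st.
    have : c * (t - s) <= c * del by rewrite ler_wpM2l//; lra.
    by rewrite /e in cdel *; lra.
  by have /andP[] := euler_limit_incr t0 ts'; rewrite /e; lra.
apply/le_anti/andP; split; last by have /andP[] := euler_limit_incr s0 ss; lra.
apply/ler_addgt0Pr => e1 e10; apply: (limn_sup_le (bdd s'0)).
have Pe1 : P s < P s + e1 by rewrite ltrDl.
have h1 := limn_sup_lt (bdd s0) Pe1.
have h2 := chcvg e0.
have h3 := hcvg (_ : 0 < d1 / 2).
apply: filterS3 h1 h2 (h3 _); last by rewrite divr_gt0.
move=> n h1 h2' h3'.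
have H : forall i, (k n s <= i < k n s')%N -> f (i%:R * h n) <= f t + e.
  move=> i /andP[ki ik].
  have /andP[a1 a2] := kP n s0; have /andP[b1 b2] := kP n s'0.
  have i1 : i%:R * h n <= t + del.
    have : (i%:R : R) <= (k n s')%:R by rewrite ler_nat ltnW.
    by move=> /(ler_wpM2r (ltW (h0 n))); lra.
  have i2 : t - del - h n < i%:R * h n.
    have : ((k n s)%:R : R) <= i%:R by rewrite ler_nat.
    by move=> /(ler_wpM2r (ltW (h0 n))); lra.
  have i0 : 0 <= i%:R * h n by rewrite mulr_ge0// ltW.
  have : `|f (i%:R * h n) - f t| < e.
    by apply: fd => //; rewrite ltr_norml; apply/andP; split; lra.
  by rewrite ltr_norml => /andP[_]; lra.
apply: le_trans (euler_cap (ltW (h0 n)) (k_mono n ss) H) _.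
by rewrite ge_max -/(euler_path n s) h1/=; lra.
Qed.

End euler_scheme.

(** * Measurability of the Euler limit *)

Section euler_measurability.
Context {R : realType} {d : measure_display} {T : measurableType d}.
Variables (c p0 t : R) (F : R -> T -> R).
Hypotheses (c0 : 0 <= c) (t0 : 0 <= t)
  (mF : forall s, 0 <= s <= t -> measurable_fun setT (F s)).

Let measurable_euler h k : 0 <= h -> k%:R * h <= t ->
  measurable_fun setT (fun w => euler c p0 (F ^~ w) h k).
Proof.
move=> h0; elim: k => [|k IH] kt; first exact: measurable_cst.
have kt' : k%:R * h <= t.
  by apply: le_trans kt; rewrite ler_wpM2r// ler_nat.
have {}IH := IH kt'.
apply: measurable_funD => //.
apply: measurable_fun_ifT => //.
  by apply: measurable_fun_ltr => //; apply: mF; rewrite kt' mulr_ge0.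
Qed.

(** The scheme at time [s] reads [F] at grid times up to [s] only. With the sigma-algebra of the
    past on [T], this becomes adaptedness. *)
Lemma measurable_euler_limit s : 0 <= s <= t ->
  measurable_fun setT (fun w => euler_limit c p0 (F ^~ w) s).
Proof.
move=> /andP[s0 st]; apply: measurable_fun_limn_sup.
- by move=> w _; have [] := bounded_range_has_bounds
    (fun n => euler_path_bounded p0 (F ^~ w) c0 n s0).
- by move=> w _; have [] := bounded_range_has_bounds
    (fun n => euler_path_bounded p0 (F ^~ w) c0 n s0).
move=> n; apply: measurable_euler; first by rewrite invr_ge0.
apply: le_trans st; rewrite ler_pdivrMr// [leRHS]mulrC.
by have /truncn_itv/andP[] : 0 <= n.+1%:R * s by rewrite mulr_ge0.
Qed.

End euler_measurability.

(** * An admissible policy built from the Euler limit *)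

Section threshold_existence.
Context {R : realType} {d : measure_display} {T : measurableType d}.
Notation mu := (@lebesgue_measure R).
Variables (thu L p0 : R) (D : R -> T -> R).
Hypotheses (thu0 : 0 <= thu) (cD : forall w, continuous_path (D ^~ w)).

Let f w t := D t w + L.
Definition euler_limit_policy t w := euler_limit thu p0 (f w) t.
Notation P := euler_limit_policy.

Let cf w : continuous_path (f w).
Proof.
apply: continuous_pathD => // t t0 e e0; exists 1 => // s _ _.
by rewrite subrr normr0.
Qed.

Lemma euler_limit_policy_incr w s t : 0 <= s -> s <= t ->
  0 <= P t w - P s w <= thu * (t - s).
Proof. by move=> *; exact: euler_limit_incr. Qed.

Lemma euler_limit_policy_lip w s t : 0 <= s -> s <= t ->
  `|P t w - P s w| <= thu * (t - s).
Proof.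
by move=> s0 st; have /andP[h1 h2] := euler_limit_policy_incr w s0 st; rewrite ger0_norm.
Qed.

Let cP w : continuous_path (P ^~ w).
Proof.
by apply: (@lipschitz_continuous_path _ _ thu) => *; exact: euler_limit_policy_lip.
Qed.

Let low w := [set t : R | 0 <= t /\ P t w < D t w + L].

Let cgap w : continuous (fun t : R => P (Num.max t 0) w - D (Num.max t 0) w).
Proof.
apply: (@continuous_path_extend R (fun t => P t w - D t w)).
exact: continuous_pathB.
Qed.

Let gap_preimage w (A : set R) : measurable A ->
  measurable [set t : R | 0 <= t /\ A (P t w - D t w)].
Proof.
move=> mA; have -> : [set t : R | 0 <= t /\ A (P t w - D t w)] =
   `[0, +oo[%classic `&` (fun t : R => P (Num.max t 0) w - D (Num.max t 0) w) @^-1` A.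
  by apply/seteqP; split => t /=; rewrite in_itv/= andbT => -[t0];
    rewrite (max_idPl t0).
have mg : measurable_fun setT
    (fun t : R => P (Num.max t 0) w - D (Num.max t 0) w).
  exact: continuous_measurable_fun (@cgap w).
by apply: measurableI => //; rewrite -[X in measurable X]setTI; exact: mg.
Qed.

Let measurable_low w : measurable (low w).
Proof.
have := gap_preimage w (measurable_itv `]-oo, L[).
by congr (measurable _); apply/seteqP; split => t /=;
  rewrite in_itv/= => -[t0 h]; split => //; lra.
Qed.

(* Unlike [P], this path is differentiable at almost every time for all [w], even when
   [P] stays on the threshold for a set of times of positive measure. *)
Definition threshold_path (t : R) (w : T) : R :=
  p0 + thu * (\int[mu]_(u in `[0%R, t]) \1_(low w) u)%R.

Let indic_le1 (A : set R) x : `|\1_A x : R| <= 1.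
Proof. by rewrite indicE; case: (_ \in _); rewrite ?normr1 ?normr0. Qed.

Let mu_itv0 (t : R) : (mu `[0%R, t]%classic < +oo)%E.
Proof. by rewrite lebesgue_measure_itv/=; case: ifP => _; rewrite ?ltry. Qed.

Let integrable_low w t : mu.-integrable `[0%R, t] (EFin \o \1_(low w)).
Proof.
apply: measurable_bounded_integrable => //; first exact: mu_itv0.
  by apply: measurable_indic; exact: measurable_low.
exists 1; split; first exact: num_real.
by move=> x x1 u _ /=; apply: (le_trans (indic_le1 _ _)); exact: ltW.
Qed.

Lemma threshold_path_incr w s t : 0 <= s -> s <= t ->
  0 <= threshold_path t w - threshold_path s w <= thu * (t - s).
Proof.
move=> s0 st.
have -> : threshold_path t w - threshold_path s w =
    thu * (\int[mu]_(u in `]s, t]) \1_(low w) u)%R.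
  rewrite /threshold_path -(Rintegral_itvB (x := s) (integrable_low w t))//.
  by ring.
have ge0 : 0 <= (\int[mu]_(u in `]s, t]) \1_(low w) u)%R.
  by apply: Rintegral_ge0.
rewrite mulr_ge0//= ler_wpM2l//.
apply: (le_trans (ler_norm _)).
have mst : mu `]s, t]%classic = (t - s)%:E.
  rewrite lebesgue_measure_itv/= lte_fin; case: ltP => // ts.
  by have -> : t = s by [lra]; rewrite subrr.
have -> : t - s = 1 * fine (mu `]s, t]%classic) by rewrite mst mul1r.
apply: normr_Rintegral_le => //; last by rewrite mst ltry.
apply: integrableS (integrable_low w t) => //.
by apply: subset_itvr; rewrite bnd_simp.
Qed.

Lemma threshold_path_rate w : {ae mu, forall t : R, 0 <= t ->
  derivable (threshold_path ^~ w) t 1 /\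
  rate threshold_path t w = thu * \1_(low w) t}.
Proof.
have := @FTC1 R \1_(low w) (BLeft 0) (integrable_low w)
  (locally_integrable_indic openT (measurable_low w)).
(* Time 0 is excluded because [FTC1] differentiates at later times only. *)
have n0 : {ae mu, forall t : R, t != 0}.
  exists [set 0]; split => //; first exact: lebesgue_measure_set1.
  by move=> t /= /negP; rewrite negbK => /eqP.
have F := ae_filter_ringOfSetsType mu; apply: filterS2 n0 => t tn0 + t0.
move=> H; have {H} [|dF FE] := H; first by rewrite /= lte_fin lt_neqAle eq_sym tn0.
have dP : is_derive t 1 (threshold_path ^~ w) (thu * \1_(low w) t).
  rewrite -FE derive1E.
  have dF' := derivableP dF.
  have := is_deriveD (is_derive_cst p0 t 1) (is_deriveZ thu dF').
  by rewrite add0r.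
by split; [exact: ex_derive|rewrite /rate derive1E; exact: derive_val].
Qed.

(** Off its level set [P] is locally affine with slope [thu] or 0, the integrand that defines
    [threshold_path]. When the level set is null, [lipschitz_FTC] identifies the two paths. *)
Lemma threshold_path_euler w :
  mu [set t | 0 <= t /\ P t w - D t w = L] = 0%E ->
  forall t, 0 <= t -> threshold_path t w = P t w.
Proof.
move=> null t t0.
have mnull : measurable [set t | 0 <= t /\ P t w - D t w = L].
  exact: (gap_preimage w (measurable_set1 L)).
rewrite /threshold_path /=.
have -> : thu * (\int[mu]_(x in `[0%R, t]) \1_(low w) x)%R =
    (\int[mu]_(x in `[0%R, t]) (thu * \1_(low w) x))%R.
  by apply/esym; apply: RintegralZl => //; exact: (integrable_low w t).
have -> : (\int[mu]_(x in `[0%R, t]) (thu * \1_(low w) x))%R = P t w - P 0 w; last first.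
  by rewrite [P 0 w]euler_limit0; ring.
apply: (@lipschitz_FTC _ (P ^~ w) (fun u => thu * \1_(low w) u) 0 t thu
  ([set 0] `|` [set t | 0 <= t /\ P t w - D t w = L])) => //.
- by move=> x y x0 xy _; exact: euler_limit_policy_lip.
- by apply: measurable_funM => //; exact: measurable_indic.
- move=> u _; rewrite normrM (ger0_norm thu0) ler_piMr//; exact: indic_le1.
- exact: measurableU.
- apply/eqP; rewrite eq_le measure_ge0 andbT.
  apply: (le_trans (measureU2 _ _ _)) => //.
  have zero : mu [set 0] = 0%E by exact: lebesgue_measure_set1.
  by rewrite [X in (X + _)%E]zero [X in (_ + X)%E]null adde0.
- move=> u /andP[u0 ut] nN.
  have up : 0 < u.
    by rewrite lt_neqAle u0 andbT eq_sym; apply/eqP => u_0; apply: nN; left.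
  have lin (c : R) : (exists2 del, 0 < del & forall s s', 0 <= s -> s <= s' ->
      u - del < s -> s' < u + del -> P s' w = P s w + c * (s' - s)) ->
      is_derive u 1 (P ^~ w) c.
    move=> [del del0 H].
    have r0 : 0 < Num.min del u by rewrite lt_min del0.
    have E : \forall v \near u, (fun v : R => P u w + c * (v - u)) v = P v w.
      exists (Num.min del u) => //= v; rewrite /ball_/= lt_min => /andP[vd vu].
      have [h1 h2] : - del < u - v < del /\ - u < u - v < u.
        by rewrite -!ltr_norml.
      have v0 : 0 <= v by lra.
      by have [uv|/ltW vu'] := leP u v; [rewrite (H u v)|rewrite (H v u)]; lra.
    apply: (near_eq_is_derive E).
    have : is_derive u 1 (fun v : R => P u w + c * (v - u)) (0 + c *: (1 - 0)).
      apply: is_deriveD.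
    by rewrite add0r subr0 => /is_derive_eq; apply; rewrite /GRing.scale/= mulr1.
  have [lo|hi|eqL] := ltgtP (P u w) (D u w + L).
  + rewrite indicE mem_set/=; last by split.
    by rewrite mulr1; apply: lin; exact: (@euler_limit_up _ thu p0 _ thu0 (@cf w) u u0 lo).
  + rewrite indicE memNset/=; last by move=> [_]; rewrite ltNge (ltW hi).
    rewrite mulr0; apply: lin.
    have [del del0 H] := @euler_limit_flat _ thu p0 _ thu0 (@cf w) u u0 hi.
    by exists del => // s s' s0 ss h1 h2; rewrite mul0r addr0; exact: H.
  + by exfalso; apply: nN; right; split => //; rewrite eqL; ring.
Qed.

Let past t := \bigcup_(s in `[0, t]%classic)
  preimage_set_system [set: T] (D s) (@measurable _ R).

Let measurable_past s t : 0 <= s <= t ->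
  measurable_fun setT (D s : g_sigma_algebraType (past t) -> R).
Proof.
move=> st _ B mB; rewrite setTI; apply: sub_sigma_algebra.
by exists s => //=; exists B => //; rewrite setTI.
Qed.

Let measurable_euler_past s t : 0 <= s <= t ->
  measurable_fun setT (P s : g_sigma_algebraType (past t) -> R).
Proof.
move=> /andP[s0 st]; have t0 := le_trans s0 st.
apply: (@measurable_euler_limit _ _ (g_sigma_algebraType (past t)) thu p0 t
   (fun u w => D u w + L)) => //; last by rewrite s0.
by move=> u ut; apply: measurable_funD => //; exact: measurable_past.
Qed.

(** The integral up to [t] is the measure of a section of a set that is measurable jointly in the
    time and in the past of [t]. *)
Lemma adapted_threshold_path : adapted (natural_filtration D) threshold_path.
Proof.
move=> t t0; pose T' := g_sigma_algebraType (past t).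
suff mP : measurable_fun setT (threshold_path t : T' -> R).
  by move=> B mB; have := mP measurableT B mB; rewrite setTI.
(* Stopping the time at [t] makes [Y] measurable with respect to the past of [t] at every time. *)
pose Y (s : R) (w : T') : R := P (Num.min s t) w - D (Num.min s t) w.
have mY : measurable_fun setT (fun z : T' * R => Y (Num.max z.2 0) z.1).
  apply: measurable_joint.
    move=> s s0; have st : 0 <= Num.min s t <= t by rewrite le_min s0 t0 ge_min lexx orbT.
    apply: measurable_funB; first exact: measurable_euler_past.
    exact: measurable_past.
  move=> w s s0 e e0.
  have st : 0 <= Num.min s t by rewrite le_min s0.
  have cg : continuous_path (fun t => P t w - D t w) by exact: continuous_pathB.
  have [del del0 H] := cg _ st e e0; exists del => // r r0 rs; apply: H.
    by rewrite le_min r0.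
  apply: le_lt_trans rs.
  by case: (leP r t) => ?; case: (leP s t) => ?; rewrite ?subrr ?normr0 ?normr_ge0//;
    rewrite ler_norml; have := ler_norm (r - s); have := ler_norm (s - r);
    rewrite (distrC s r) => *; apply/andP; split; lra.
pose S : set (T' * R) := (setT `*` `[0, t]%classic) `&`
  (fun z : T' * R => Y (Num.max z.2 0) z.1) @^-1` `]-oo, L[%classic.
have mS : measurable S.
  apply: measurableI; first exact: measurableX.
  by rewrite -[X in measurable X]setTI; apply: mY.
have SE w : xsection S w = low w `&` `[0, t]%classic.
  rewrite /xsection; apply/seteqP; split => u /=; rewrite inE /S/= !in_itv/=.
    move=> [[_ /andP[u0 ut]]]; rewrite /Y (max_idPl u0) (min_idPl ut) => h.
    by split; [split => //; lra|rewrite u0].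
  move=> [[u0 h] /andP[_ ut]]; split; first by rewrite u0.
  by rewrite /Y (max_idPl u0) (min_idPl ut); lra.
have mmu : measurable_fun setT (fun w : T' => mu (xsection S w)).
  exact: measurable_fun_xsection.
apply: measurable_funD => //; apply: measurable_funM => //.
have -> : (fun w : T' => (\int[mu]_(u in `[0%R, t]) \1_(low w) u)%R) =
    (fun w : T' => fine (mu (xsection S w))).
  by apply/funext => w; rewrite SE /Rintegral integral_indic//; exact: measurable_low.
exact: measurableT_comp mmu.
Qed.

Lemma threshold_path_control_policy (thl : R) : thl < 0 ->
  control_policy thl thu D p0 threshold_path.
Proof.
move=> thl0; split.
- move=> w; rewrite /threshold_path set_itv1 Rintegral_set1 mulr0 addr0 //.
- exact: adapted_threshold_path.
- move=> w M M0; apply: (@lipschitz_abs_continuous _ _ _ _ thu) => // x y x0 xy _.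
  by have /andP[h1 h2] := threshold_path_incr w x0 xy; rewrite ger0_norm.
- move=> w; have F := ae_filter_ringOfSetsType mu; apply: filterS (threshold_path_rate w) => t H t0.
  have [dt ->] := H t0; split => //.
  rewrite indicE; case: (_ \in _); rewrite ?mulr1 ?mulr0; apply/andP; split=> //;
    exact: le_trans (ltW thl0) _.
Qed.

End threshold_existence.

(** * Existence of a threshold policy *)

Section threshold_policy_existence.
Context {R : realType} {d : measure_display} {T : measurableType d}.
Notation mu := (@lebesgue_measure R).
Variables (Pr : probability T R) (W : R -> T -> R).
Hypothesis hW : standard_brownian_motion Pr W.

Lemma demand_continuous_path (b sigma d0 : R) w :
  continuous_path (demand b sigma d0 W ^~ w).
Proof.
apply: continuous_pathD; last first.
  by apply: continuous_pathZ; exact: (brownian_continuous_path hW).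
apply: (@lipschitz_continuous_path _ _ `|b|) => s t s0 st.
have -> : d0 + b * t - (d0 + b * s) = b * (t - s) by ring.
by rewrite normrM (@ger0_norm _ (t - s))// subr_ge0.
Qed.

Lemma threshold_policy_exists (b sigma d0 thl thu L p0 : R) :
  0 < sigma -> thl < 0 -> 0 <= thu ->
  exists P, control_policy thl thu (demand b sigma d0 W) p0 P /\
    threshold_policy thu L Pr (demand b sigma d0 W) P.
Proof.
move=> sigma0 thl0 thu0; pose D := demand b sigma d0 W.
have cD w : continuous_path (D ^~ w) by exact: demand_continuous_path.
exists (threshold_path thu L p0 D); split.
  exact: threshold_path_control_policy.
pose P := euler_limit_policy thu L p0 D.
(* Solved for [W], sitting on the threshold reads [W t w = g t w], and [g] inherits a Lipschitz
   constant from [P]. *)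
pose g t w := (P t w - L - d0 - b * t) / sigma.
have gK w s t : 0 <= s -> s <= t ->
    `|g t w - g s w| <= (thu + `|b|) / sigma * (t - s).
  move=> s0 st; rewrite /g.
  have -> : (P t w - L - d0 - b * t) / sigma - (P s w - L - d0 - b * s) / sigma =
     ((P t w - P s w) - b * (t - s)) / sigma by field; rewrite gt_eqF.
  rewrite normrM [`|sigma^-1|]gtr0_norm ?invr_gt0// mulrAC ler_wpM2r// ?invr_ge0 ?(ltW sigma0)//.
  apply: (le_trans (ler_normB _ _)); rewrite mulrDl lerD//.
    exact: euler_limit_policy_lip.
  by rewrite normrM (@ger0_norm _ (t - s))// subr_ge0.
have K0 : 0 <= (thu + `|b|) / sigma by rewrite divr_ge0 ?addr_ge0// ltW//.
have := brownian_level_null hW K0 gK; apply: filterS => w null.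
have null' : mu [set t | 0 <= t /\ P t w - D t w = L] = 0%E.
  rewrite -null; congr (mu _); apply/seteqP; split => t /= [t0 E]; split => //.
    by rewrite /g -E /D /demand; field; rewrite gt_eqF.
  by rewrite /D /demand E /g; field; rewrite gt_eqF.
have PE := threshold_path_euler thu0 cD null'.
have F := ae_filter_ringOfSetsType mu.
apply: filterS (threshold_path_rate L p0 thu0 cD w) => t H t0.
have [_ ->] := H t0.
rewrite (PE t t0) indicE -/P; case: ifPn => h.
  by rewrite mem_set ?mulr1//=; split => //; move: h; rewrite ltrBlDl.
rewrite memNset ?mulr0//= => -[_ h']; move/negP: h; apply.
by rewrite ltrBlDl.
Qed.

End threshold_policy_existence.

(** * Discounted sums over time steps *)

Section discounted_sums.
Context {R : realType}.

(** A right-endpoint Riemann sum of a decreasing exponential is at most its integral. *)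
Lemma geometric_expR_sum (beta h : R) n : 0 < beta -> 0 <= h ->
  \sum_(k < n) h * expR (- (beta * (k.+1%:R * h))) <= beta^-1.
Proof.
move=> b0 h0.
suff : \sum_(k < n) h * expR (- (beta * (k.+1%:R * h))) <=
    (1 - expR (- (beta * (n%:R * h)))) / beta.
  move=> H; apply: (le_trans H); apply: ler_piMl; first by rewrite invr_ge0 ltW.
  by rewrite gerBl expR_ge0.
elim: n => [|n IH].
  by rewrite big_ord0 mul0r mulr0 oppr0 expR0 subrr mul0r.
rewrite big_ord_recr /=; apply: (le_trans (lerD IH (lexx _))).
set E := expR (- (beta * (n.+1%:R * h))).
have -> : expR (- (beta * (n%:R * h))) = E * expR (beta * h).
  by rewrite /E -expRD -natr1; congr expR; ring.
have E0 : 0 <= E by exact: expR_ge0.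
have H : beta * h <= expR (beta * h) - 1.
  by have := expR_ge1Dx (beta * h); lra.
rewrite ler_pdivlMr// mulrDl divfK ?gt_eqF//.
by have := ler_wpM2l E0 H; lra.
Qed.

(** Half of the discount rate absorbs the linear growth; the other half remains for summation. *)
Lemma discount_linear_le (alpha x : R) : 0 < alpha -> 0 <= x ->
  (1 + x) * expR (- (alpha * x)) <= (1 + 2 / alpha) * expR (- (alpha / 2 * x)).
Proof.
move=> a0 x0.
have -> : - (alpha * x) = - (alpha / 2 * x) + - (alpha / 2 * x) by field.
rewrite expRD mulrA ler_wpM2r ?expR_ge0// expRN.
rewrite ler_pdivrMr ?expR_gt0//.
have H := expR_ge1Dx (alpha / 2 * x).
have c0 : 0 <= 1 + 2 / alpha by rewrite addr_ge0 ?divr_ge0 ?ltW.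
apply: le_trans (ler_wpM2l c0 H).
have -> : (1 + 2 / alpha) * (1 + alpha / 2 * x) =
  1 + x + 2 / alpha + alpha / 2 * x by field; rewrite gt_eqF.
have i0 : 0 <= 2 / alpha by rewrite divr_ge0 ?ltW.
have j0 : 0 <= alpha / 2 * x by rewrite mulr_ge0// divr_ge0 ?ltW.
by lra.
Qed.

(** Here [y k] stands for the expected value after [k] steps and [a k] for the expected cost of a
    step. Replacing [1 + alpha * h] by [expR (alpha * h)] makes the discounted sum telescope, at the
    price of O(h^2) times [y k]. Errors of order [eta ^+ 3] per step sum, under the discount, to
    order [eta ^+ 3 / h = eta]. *)
Lemma discounted_telescoping (alpha C : R) : 0 < alpha -> 0 <= C ->
  exists2 C', 0 <= C' & forall (eta : R) (y a : nat -> R) (n : nat),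
    0 < eta <= 1 ->
    let h := eta ^+ 2 in
    (forall k, `|y k| <= C * (1 + k%:R * h)) ->
    (forall k, `|a k - ((1 + alpha * h) * y k - y k.+1)| <= C * eta ^+ 3) ->
    `|\sum_(k < n) expR (- (alpha * (k.+1%:R * h))) * a k -
      (y 0%N - expR (- (alpha * (n%:R * h))) * y n)| <= C' * eta.
Proof.
move=> a0 C0.
(* The second summand pays for the replacement of [1 + alpha * h]. Its factor [expR (alpha / 2)]
   moves the remaining half of the discount from step [k] to step [k.+1], as [h <= 1]. *)
pose C3 := C + alpha ^+ 2 * (C * (1 + 2 / alpha)) * expR (alpha / 2).
have c20 : 0 <= 1 + 2 / alpha by rewrite addr_ge0 ?divr_ge0 ?ltW.
have C30 : 0 <= C3 by rewrite addr_ge0// !mulr_ge0 ?expR_ge0// ltW.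
have b0 : 0 < alpha / 2 by rewrite divr_gt0.
exists (C3 * (alpha / 2)^-1); first by rewrite mulr_ge0// invr_ge0 ltW.
move=> eta y a n /andP[e0 e1] h yC aC.
have h0 : 0 < h by rewrite exprn_gt0.
have h1 : h <= 1 by rewrite expr_le1// (ltW e0).
have eta4 : h ^+ 2 <= eta ^+ 3.
  by rewrite /h -exprM (exprS eta 3); apply: ler_piMl; rewrite ?exprn_ge0// ltW.
pose B k := C3 * eta ^+ 3 * expR (- (alpha / 2 * (k.+1%:R * h))).
have step k : `|expR (- (alpha * (k.+1%:R * h))) * a k -
    (expR (- (alpha * (k%:R * h))) * y k -
     expR (- (alpha * (k.+1%:R * h))) * y k.+1)| <= B k.
  set E1 := expR (- (alpha * (k.+1%:R * h))).
  set E0 := expR (- (alpha * (k%:R * h))).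
  have EE : E0 = E1 * expR (alpha * h).
    by rewrite /E1 /E0 -expRD -natr1; congr expR; ring.
  have -> : E1 * a k - (E0 * y k - E1 * y k.+1) =
      E1 * (a k - ((1 + alpha * h) * y k - y k.+1)) -
      E1 * y k * (expR (alpha * h) - 1 - alpha * h) by rewrite EE; ring.
  have E10 : 0 <= E1 by exact: expR_ge0.
  have E00 : 0 <= E0 by exact: expR_ge0.
  have ah0 : 0 <= alpha * h by rewrite mulr_ge0 ?ltW.
  have T1 : `|expR (alpha * h) - 1 - alpha * h| <= (alpha * h) ^+ 2 * expR (alpha * h).
    have := expR_taylor1 ah0 (lexx (alpha * h)).
    by rewrite (ger0_norm ah0).
  have H0 : E0 * `|y k| <= C * (1 + 2 / alpha) * expR (- (alpha / 2 * (k%:R * h))).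
    apply: (le_trans (ler_wpM2l E00 (yC k))).
    rewrite mulrCA -(mulrA C) ler_wpM2l// mulrC.
    by apply: discount_linear_le; rewrite ?mulr_ge0// ltW.
  have E1B : E1 <= expR (- (alpha / 2 * (k.+1%:R * h))).
    have aa : alpha / 2 <= alpha by have := a0; lra.
    by rewrite ler_expR lerN2 ler_wpM2r// mulr_ge0// ltW.
  have E2B : expR (- (alpha / 2 * (k%:R * h))) <=
      expR (alpha / 2) * expR (- (alpha / 2 * (k.+1%:R * h))).
    rewrite -expRD ler_expR -[k.+1%:R]natr1.
    have : alpha / 2 * h <= alpha / 2 by apply: ler_piMr => //; exact: ltW.
    by lra.
  apply: (le_trans (ler_normB _ _)).
  rewrite normrM (ger0_norm E10) (normrM (E1 * _)) (normrM E1) (ger0_norm E10).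
  have P1 : E1 * `|a k - ((1 + alpha * h) * y k - y k.+1)| <=
      C * eta ^+ 3 * expR (- (alpha / 2 * (k.+1%:R * h))).
    rewrite mulrC; apply: ler_pM => //; exact: aC.
  have P2 : E1 * `|y k| * `|expR (alpha * h) - 1 - alpha * h| <=
      alpha ^+ 2 * h ^+ 2 * (E0 * `|y k|).
    rewrite EE; apply: (@le_trans _ _ (E1 * `|y k| * ((alpha * h) ^+ 2 * expR (alpha * h)))).
      by rewrite ler_wpM2l// mulr_ge0.
    by rewrite le_eqVlt; apply/orP; left; apply/eqP; ring.
  have P3 : alpha ^+ 2 * h ^+ 2 * (E0 * `|y k|) <= alpha ^+ 2 * eta ^+ 3 *
      (C * (1 + 2 / alpha) * (expR (alpha / 2) *
        expR (- (alpha / 2 * (k.+1%:R * h))))).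
    apply: ler_pM; [by rewrite mulr_ge0// ?sqr_ge0|by rewrite mulr_ge0| |].
      by rewrite ler_wpM2l// sqr_ge0.
    by apply: (le_trans H0); rewrite ler_wpM2l// mulr_ge0.
  apply: (le_trans (lerD P1 (le_trans P2 P3))).
  by rewrite le_eqVlt; apply/orP; left; apply/eqP; rewrite /B /C3; ring.
have sum_le : forall m, `|\sum_(k < m) expR (- (alpha * (k.+1%:R * h))) * a k -
      (y 0%N - expR (- (alpha * (m%:R * h))) * y m)| <= \sum_(k < m) B k.
  elim=> [|m IH].
    by rewrite !big_ord0 mul0r mulr0 oppr0 expR0 mul1r subrr subrr normr0.
  rewrite !big_ord_recr /=.
  apply: le_trans (lerD IH (step m)).
  apply: le_trans (ler_normD _ _).
  by rewrite le_eqVlt; apply/orP; left; apply/eqP; congr `|_|; ring.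
apply: (le_trans (sum_le n)).
have -> : \sum_(k < n) B k = C3 * eta *
    \sum_(k < n) h * expR (- (alpha / 2 * (k.+1%:R * h))).
  by rewrite mulr_sumr; apply: eq_bigr => k _; rewrite /B /h; ring.
apply: (le_trans (ler_wpM2l _ (geometric_expR_sum n b0 (ltW h0)))).
  by rewrite mulr_ge0// ltW.
by rewrite mulrAC.
Qed.

(** This removes the boundary term of the telescoped sum. *)
Lemma discount_linear_cvg (alpha C h : R) (y : nat -> R) : 0 < alpha -> 0 < h ->
  (forall k, `|y k| <= C * (1 + k%:R * h)) ->
  forall e, 0 < e -> \forall n \near \oo, `|expR (- (alpha * (n%:R * h))) * y n| <= e.
Proof.
move=> a0 h0 yC e e0.
have C0 : 0 <= C.
  by have := yC 0%N; rewrite mul0r addr0 mulr1; exact: le_trans.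
have c20 : 0 <= 1 + 2 / alpha by rewrite addr_ge0 ?divr_ge0 ?ltW.
pose c := C * (1 + 2 / alpha).
have c0 : 0 <= c by rewrite mulr_ge0.
have bh : 0 < alpha / 2 * h by rewrite !mulr_gt0 ?invr_gt0.
exists (Num.truncn (c / (e * (alpha / 2 * h)))).+1 => // n /= nN.
have n1 : c / (e * (alpha / 2 * h)) <= n%:R.
  by apply: (le_trans (ltW (truncnS_gt _))); rewrite ler_nat.
rewrite normrM ger0_norm ?expR_ge0//.
apply: (le_trans (ler_wpM2l (expR_ge0 _) (yC n))).
rewrite mulrCA [expR _ * _]mulrC.
have nh0 : 0 <= n%:R * h by rewrite mulr_ge0// (ltW h0).
apply: (le_trans (ler_wpM2l C0 (discount_linear_le a0 nh0))).
rewrite [X in X <= _]mulrA -/c (expRN (alpha / 2 * (n%:R * h))).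
rewrite ler_pdivrMr ?expR_gt0//.
have H := expR_ge1Dx (alpha / 2 * (n%:R * h)).
apply: le_trans (ler_wpM2l (ltW e0) H).
move: n1; rewrite ler_pdivrMr ?mulr_gt0// => n1.
by apply: (le_trans n1); rewrite mulrDr mulr1; lra.
Qed.

End discounted_sums.

Lemma policy_lip {R : realType} {d : measure_display} {T : measurableType d}
    (thl thu p0 : R) (D P : R -> T -> R) : thl < 0 -> 0 < thu ->
  control_policy thl thu D p0 P ->
  forall w s t, 0 <= s -> s <= t -> `|P t w - P s w| <= (thu - thl) * (t - s).
Proof.
move=> thl0 thu0 hP w s t s0 st.
have /andP[h1 h2] := policy_increment w hP s0 st.
have ts : 0 <= t - s by rewrite subr_ge0.
have l1 : 0 <= thu * (t - s) by rewrite mulr_ge0// ltW.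
have l2 : 0 <= - thl * (t - s) by rewrite mulr_ge0// oppr_ge0 ltW.
by rewrite ler_norml mulrBl; apply/andP; split; lra.
Qed.

Lemma policy_continuous_path {R : realType} {d : measure_display} {T : measurableType d}
    (thl thu p0 : R) (D P : R -> T -> R) (w : T) : thl < 0 -> 0 < thu ->
  control_policy thl thu D p0 P -> continuous_path (P ^~ w).
Proof.
move=> thl0 thu0 hP; apply: (@lipschitz_continuous_path _ _ (thu - thl)).
exact: (policy_lip thl0 thu0 hP).
Qed.

Section brownian_increment_moment.
Context {R : realType} {d : measure_display} {T : measurableType d}.
Variables (Pr : probability T R) (W : R -> T -> R).
Hypothesis hW : standard_brownian_motion Pr W.
Notation "''E[' f ]" := (\int[Pr]_w f w)%R (at level 0, format "''E[' f ]").

Lemma brownian_increment_abs s t : 0 <= s -> s <= t ->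
  L1 Pr (fun w => `|W t w - W s w|) /\
  'E[fun w => `|W t w - W s w|] <= 2 * expR 1 * Num.sqrt (t - s).
Proof.
move=> s0; rewrite le_eqVlt => /predU1P[<-|st].
  have -> : (fun w => `|W s w - W s w|) = fun=> 0.
    by apply/funext => w; rewrite subrr normr0.
  by rewrite E_cst subrr sqrtr0 mulr0; split => //; exact: L1_cst.
have r0 : 0 < Num.sqrt (t - s) by rewrite sqrtr_gt0 subr_gt0.
have mY := measurable_increment hW s0 (ltW st).
have lawY := bm_gaussian hW s0 st.
split; first exact: L1_norm (L1_gaussian r0 mY lawY).
exact: E_gaussian_abs r0 mY lawY.
Qed.

End brownian_increment_moment.

(** * Expected value along an arbitrary policy *)

Section value_along_policy.
Context {R : realType} {d : measure_display} {T : measurableType d}.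
Variables (Pr : probability T R) (W : R -> T -> R).
Hypothesis hW : standard_brownian_motion Pr W.
Notation "''E[' f ]" := (\int[Pr]_w f w)%R (at level 0, format "''E[' f ]").
Variables (alpha b sigma thl thu Ip Cplus Cminus L K : R) (V v z : R -> R).
Hypotheses (a0 : 0 < alpha) (sg0 : 0 < sigma) (thl0 : thl < 0) (thu0 : 0 < thu)
  (Ip0 : 0 <= Ip).
Hypothesis hS : hjb_solution alpha b sigma thu Ip Cplus Cminus L K V v z.
Notation hold := (holding_cost Cplus Cminus).

Let K0 : 0 <= K.
Proof. exact: le_trans (normr_ge0 _) (hjb_v_bound hS 0). Qed.

Lemma measurable_hjb_v : measurable_fun setT v.
Proof.
apply: continuous_measurable_fun; exact: lipschitz_continuous_fun (hjb_v_lip hS).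
Qed.

Lemma measurable_hjb_z : measurable_fun setT z.
Proof.
apply: continuous_measurable_fun; exact: lipschitz_continuous_fun (hjb_z_lip hS).
Qed.

Lemma measurable_holding_cost : measurable_fun setT (hold : R -> R).
Proof.
rewrite /holding_cost; apply: measurable_funD; apply: measurable_funM => //.
  exact: measurable_maxr.
by apply: measurableT_comp => //; exact: measurable_minr.
Qed.

Let hjb_V x : V x = alpha^-1 * (sigma ^+ 2 / 2 * z x - b * v x +
    hold x + thu * Num.min (v x + Ip) 0).
Proof. by rewrite -(hjb_eq hS) mulrA mulVf ?mul1r// gt_eqF. Qed.

Lemma measurable_hjb_V : measurable_fun setT V.
Proof.
rewrite (_ : V = fun x => alpha^-1 * (sigma ^+ 2 / 2 * z x - b * v x +
    hold x + thu * Num.min (v x + Ip) 0)); last exact/funext.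
have mv := measurable_hjb_v; have mz := measurable_hjb_z.
apply: measurable_funM => //; apply: measurable_funD; last first.
  apply: measurable_funM => //; apply: measurable_minr => //.
  exact: measurable_funD.
apply: measurable_funD; last exact: measurable_holding_cost.
by apply: measurable_funB; exact: measurable_funM.
Qed.

Lemma holding_cost_norm_le x : `|hold x| <= (`|Cplus| + `|Cminus|) * `|x|.
Proof.
have h1 : `|Num.max x 0| <= `|x|.
  by case: (leP x 0) => h; rewrite ?normr0.
have h2 : `|Num.min x 0| <= `|x|.
  by case: (leP x 0) => h; rewrite ?normr0.
rewrite /holding_cost (le_trans (ler_normD _ _))// mulrDl !normrM normrN.
by rewrite lerD// ler_wpM2l.
Qed.

Lemma holding_cost_lip x y : `|hold y - hold x| <= (`|Cplus| + `|Cminus|) * `|y - x|.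
Proof.
have h1 : `|Num.max y 0 - Num.max x 0| <= `|y - x|.
  have n1 := ler_norm (y - x); have n2 := ler_norm (x - y); rewrite distrC in n2.
  by case: (leP x 0) => h; case: (leP y 0) => h'; rewrite ler_norml;
    apply/andP; split; lra.
have h2 : `|Num.min y 0 - Num.min x 0| <= `|y - x|.
  have n1 := ler_norm (y - x); have n2 := ler_norm (x - y); rewrite distrC in n2.
  by case: (leP x 0) => h; case: (leP y 0) => h'; rewrite ler_norml;
    apply/andP; split; lra.
rewrite /holding_cost; have -> : forall a b c d : R, Cplus * a + Cminus * - b -
  (Cplus * c + Cminus * - d) = Cplus * (a - c) - Cminus * (b - d) by move=> *; ring.
by rewrite (le_trans (ler_normB _ _))// mulrDl !normrM lerD// ler_wpM2l.
Qed.

(** The equation expresses [V] through the bounded functions [v] and [z] and the holding cost, which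
    grows linearly. *)
Lemma hjb_V_growth : exists2 c, 0 <= c & forall x, `|V x| <= c * (1 + `|x|).
Proof.
pose c1 := sigma ^+ 2 / 2 * K + `|b| * K + thu * (K + Ip).
have c10 : 0 <= c1.
  by rewrite !addr_ge0 ?mulr_ge0 ?addr_ge0 ?divr_ge0 ?sqr_ge0// ltW.
exists (alpha^-1 * (c1 + (`|Cplus| + `|Cminus|))).
  by rewrite mulr_ge0 ?invr_ge0 ?(ltW a0)// addr_ge0// addr_ge0.
move=> x; rewrite hjb_V normrM ger0_norm ?invr_ge0 ?(ltW a0)// -(mulrA alpha^-1).
rewrite ler_wpM2l ?invr_ge0 ?(ltW a0)//.
have t1 : `|sigma ^+ 2 / 2 * z x| <= sigma ^+ 2 / 2 * K.
  rewrite normrM ger0_norm ?divr_ge0 ?sqr_ge0// ler_wpM2l ?divr_ge0 ?sqr_ge0//.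
  exact: hjb_z_bound hS x.
have t2 : `|b * v x| <= `|b| * K.
  by rewrite normrM ler_wpM2l//; exact: hjb_v_bound hS x.
have t3 : `|thu * Num.min (v x + Ip) 0| <= thu * (K + Ip).
  rewrite normrM gtr0_norm// ler_wpM2l ?(ltW thu0)//.
  have := hjb_v_bound hS x; rewrite ler_norml => /andP[k1 k2].
  have := K0; have := Ip0.
  by case: (leP (v x + Ip) 0) => h *; rewrite ?normr0 ?addr_ge0//
    ler_norml; apply/andP; split; lra.
have t4 := holding_cost_norm_le x.
apply: (le_trans (ler_normD _ _)); apply: (le_trans (lerD (ler_normD _ _) (lexx _))).
apply: (le_trans (lerD (lerD (ler_normB _ _) (lexx _)) (lexx _))).
have t5 : `|sigma ^+ 2 / 2 * z x| + `|b * v x| + `|thu * Num.min (v x + Ip) 0| <= c1.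
  by rewrite /c1; lra.
have t6 := mulr_ge0 c10 (normr_ge0 x).
have c20 : 0 <= `|Cplus| + `|Cminus| by rewrite addr_ge0.
move: t4 t5 t6 c20; clear c10; move: c1 (`|Cplus| + `|Cminus|) => c1 c2.
by rewrite !mulrDl !mulrDr !mulr1; lra.
Qed.

Variables (d0 p0 : R) (Q : R -> T -> R).
Notation D := (demand b sigma d0 W).
Hypothesis hQ : control_policy thl thu D p0 Q.
Let X t w := Q t w - D t w.
Let M := thu - thl.
Let M0 : 0 <= M. Proof. by rewrite subr_ge0 ltW// (lt_trans thl0). Qed.

Let Qlip w s t : 0 <= s -> s <= t -> `|Q t w - Q s w| <= M * (t - s).
Proof. exact: (policy_lip thl0 thu0 hQ). Qed.

Lemma policy_measurable t : 0 <= t -> measurable_fun setT (Q t).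
Proof.
move=> t0 _ B mB; rewrite setTI.
exact: (natural_filtration_measurable hW (policy_adapted hQ t0 mB)).
Qed.

Let mD t : 0 <= t -> measurable_fun setT (D t).
Proof.
move=> t0; rewrite /demand; apply: measurable_funD => //.
by apply: measurable_funM => //; exact: bm_measurable hW _ t0.
Qed.

Lemma surplus_measurable t : 0 <= t -> measurable_fun setT (X t).
Proof. by move=> t0; apply: measurable_funB; [exact: policy_measurable|exact: mD]. Qed.

Let surplus_increment s t w : X t w - X s w =
  (Q t w - Q s w) - b * (t - s) - sigma * (W t w - W s w).
Proof. by rewrite /X /demand; ring. Qed.

Lemma surplus_increment_norm_le s t w : 0 <= s -> s <= t ->
  `|X t w - X s w| <= (M + `|b|) * (t - s) + sigma * `|W t w - W s w|.
Proof.
move=> s0 st; rewrite surplus_increment.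
apply: (le_trans (ler_normB _ _)); rewrite (normrM sigma) gtr0_norm// lerD2r.
apply: (le_trans (ler_normB _ _)); rewrite mulrDl lerD ?Qlip//.
by rewrite normrM (@ger0_norm _ (t - s))// subr_ge0.
Qed.

Lemma surplus_moment : exists2 c, 0 <= c & forall t, 0 <= t ->
  L1 Pr (X t) /\ 'E[fun w => `|X t w|] <= c * (1 + t).
Proof.
pose c := `|p0 - d0| + (M + `|b|) + sigma * (2 * expR 1).
have cb0 : 0 <= M + `|b| by rewrite addr_ge0.
have se : 0 <= sigma * (2 * expR 1) by rewrite !mulr_ge0 ?expR_ge0// ltW.
exists c; first by rewrite addr_ge0// addr_ge0.
move=> t t0; have [L1W EW] := brownian_increment_abs hW (lexx 0) t0.
pose g w := (`|p0 - d0| + (M + `|b|) * t) + sigma * `|W t w - W 0 w|.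
have L1g : L1 Pr g by apply: L1D; [exact: L1_cst|exact: L1Z].
have Xg w : `|X t w| <= g w.
  have X0 : X 0 w = p0 - d0.
    by rewrite /X (policy_init hQ) /demand (bm_zero hW); ring.
  have -> : X t w = (p0 - d0) + (X t w - X 0 w) by rewrite -X0; ring.
  apply: (le_trans (ler_normD _ _)).
  by have := surplus_increment_norm_le w (lexx 0) t0; rewrite subr0 /g; lra.
have L1X : L1 Pr (X t) by apply: (L1_le _ L1g) => //; exact: surplus_measurable.
split => //; apply: (le_trans (E_le (L1_norm L1X) L1g Xg)).
have -> : 'E[g] = (`|p0 - d0| + (M + `|b|) * t) + sigma * 'E[fun w => `|W t w - W 0 w|].
  have -> : 'E[g] = 'E[fun=> `|p0 - d0| + (M + `|b|) * t] +
     'E[fun w => sigma * `|W t w - W 0 w|] by apply: ED; [exact: L1_cst|exact: L1Z].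
  by rewrite E_cst EZ.
rewrite subr0 in EW.
have sq : Num.sqrt t <= 1 + t.
  have q0 := sqrtr_ge0 t; have := sqr_sqrtr t0.
  by move: (Num.sqrt t) q0 => q q0 <-; nra.
have e20 : 0 <= 2 * expR 1 :> R by rewrite mulr_ge0 ?expR_ge0.
have EW2 : sigma * 'E[fun w => `|W t w - W 0 w|] <= sigma * (2 * expR 1) * (1 + t).
  rewrite -mulrA ler_wpM2l ?(ltW sg0)//; apply: (le_trans EW).
  by rewrite ler_wpM2l.
have pd0 := normr_ge0 (p0 - d0).
have q1 : 0 <= `|p0 - d0| * t by rewrite mulr_ge0.
move: EW2 cb0 pd0 q1; rewrite /c.
move: (sigma * (\int[Pr]_w `|W t w - W 0 w|)%R) (M + `|b|) (sigma * (2 * expR 1))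
  `|p0 - d0| => e A u P.
by lra.
Qed.

Lemma value_moment : exists2 c, 0 <= c & forall t, 0 <= t ->
  L1 Pr (fun w => V (X t w)) /\ `|'E[fun w => V (X t w)]| <= c * (1 + t).
Proof.
have [c1 c10 Vc] := hjb_V_growth; have [c2 c20 Xc] := surplus_moment.
exists (c1 * (1 + c2)); first by rewrite mulr_ge0// addr_ge0.
move=> t t0; have [L1X EX] := Xc t t0.
pose g w := c1 * (1 + `|X t w|).
have L1g1 : L1 Pr (fun w => 1 + `|X t w|) by apply: L1D; [exact: L1_cst|exact: L1_norm].
have L1g : L1 Pr g by exact: L1Z.
have L1V : L1 Pr (fun w => V (X t w)).
  apply: (L1_le _ L1g) => [|w]; last exact: Vc.
  apply: measurableT_comp; [exact: measurable_hjb_V|exact: surplus_measurable].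
split => //; apply: (le_trans (E_norm_le L1V L1g (fun w => Vc (X t w)))).
have -> : 'E[g] = c1 * (1 + 'E[fun w => `|X t w|]).
  rewrite EZ//; congr (_ * _).
  have -> : 'E[fun w => 1 + `|X t w|] = 'E[fun=> 1] + 'E[fun w => `|X t w|].
    by apply: ED; [exact: L1_cst|exact: L1_norm].
  by rewrite E_cst.
rewrite -mulrA ler_wpM2l//.
have : 0 <= t + c2 by rewrite addr_ge0.
by move: EX; rewrite !mulrDl !mulrDr !mulr1 !mul1r; lra.
Qed.

Let past t := \bigcup_(s in `[0, t]%classic)
  preimage_set_system [set: T] (D s) (@measurable _ R).

Lemma surplus_adapted s (f : R -> R) : 0 <= s -> measurable_fun setT f ->
  forall B : set R, measurable B ->
    natural_filtration D s ((fun w => f (X s w)) @^-1` B).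
Proof.
move=> s0 mf; pose T' := g_sigma_algebraType (past s).
suff mX : measurable_fun setT (fun w : T' => f (X s w)).
  by move=> B mB; have := mX measurableT B mB; rewrite setTI.
apply: measurableT_comp => //; apply: measurable_funB => _ B mB; rewrite setTI.
  exact: (policy_adapted hQ s0 mB).
apply: sub_sigma_algebra; exists s; first by rewrite /= in_itv/= s0 lexx.
by exists B => //; rewrite setTI.
Qed.

(** This takes the place of the martingale property: the surplus at time [s] is known at [s], and
    the later increment is independent of it. *)
Lemma E_surplus_mul s t (f g : R -> R) : 0 <= s -> s < t ->
  measurable_fun setT f -> (forall x, `|f x| <= K) -> measurable_fun setT g ->
  L1 Pr (fun w => g (W t w - W s w)) ->
  'E[fun w => f (X s w) * g (W t w - W s w)] =
    'E[fun w => f (X s w)] * 'E[fun w => g (W t w - W s w)].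
Proof.
move=> s0 st mf fK mg L1g.
apply: (@E_indep_mul _ _ _ Pr (natural_filtration D s)
  (fun w => f (X s w)) (fun w => W t w - W s w) K) => //.
- exact: (natural_filtration_measurable hW).
- exact: surplus_adapted.
- exact: (measurable_increment hW s0 (ltW st)).
- by apply: (natural_filtration_indep hW) => //; exact: ltW.
Qed.

(** The adjustment cost at rate [q] is at least [- v * q + thu * min (v + Ip) 0], by
    [adjustment_cost_ge]. Integrating this and the holding cost over the step, with the surplus
    frozen at [s], gives the formula. *)
Definition step_cost s h w :=
  h * (hold (X s w) + thu * Num.min (v (X s w) + Ip) 0) -
  v (X s w) * (Q (s + h) w - Q s w).

(* The time step is [eta ^+ 2], so that [eta] is the standard deviation of the
   Brownian increment. *)
Lemma step_cost_expectation : exists2 C, 0 <= C &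
  forall s eta, 0 <= s -> 0 < eta <= 1 -> let h := eta ^+ 2 in
    L1 Pr (step_cost s h) /\
    `|'E[step_cost s h] - ((1 + alpha * h) * 'E[fun w => V (X s w)] -
       'E[fun w => V (X (s + h) w)])| <= C * eta ^+ 3.
Proof.
have [N NE N0] : exists2 N, N = M + `|b| & 0 <= N.
  by exists (M + `|b|) => //; rewrite addr_ge0.
have [e1 e1E e10] : exists2 e1 : R, e1 = expR 1 & 0 <= e1.
  by exists (expR 1) => //; exact: expR_ge0.
have sg0' := ltW sg0.
pose C := 2 * e1 * K * sigma * N + K * N ^+ 2 / 2 +
  4 * K * (N ^+ 3 + 54 * sigma ^+ 3 * e1).
have C0 : 0 <= C.
  by rewrite /C; do ?[apply: addr_ge0|apply: mulr_ge0|apply: exprn_ge0].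
exists C => // s eta s0 /andP[eta0 eta1] h.
have h0 : 0 < h by rewrite exprn_gt0.
have ss : s < s + h by rewrite ltrDl.
have sh0 : 0 <= s + h by rewrite addr_ge0// ltW.
have hE : s + h - s = h by ring.
pose Y w := W (s + h) w - W s w.
have mY : measurable_fun setT Y by exact: (measurable_increment hW s0 (ltW ss)).
have lawY B : measurable B -> Pr (Y @^-1` B) = normal_prob 0 eta B.
  by move=> mB; rewrite (bm_gaussian hW s0 ss mB) hE sqrtr_sqr gtr0_norm.
have L1Y := L1_gaussian eta0 mY lawY.
have L1Y2 := L1_gaussian_sqr eta0 mY lawY.
have L1Y3 := L1_gaussian_abs3 eta0 mY lawY.
have [EY EY2] := E_gaussian_moments eta0 mY lawY.
have := E_gaussian_abs eta0 mY lawY; rewrite -e1E => EY1.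
have := E_gaussian_abs3 eta0 mY lawY; rewrite -e1E => EY3.
have [c _ Vmom] := value_moment.
have [L1V0 _] := Vmom s s0; have [L1V1 _] := Vmom (s + h) sh0.
have [c' _ Xmom] := surplus_moment.
have [L1X _] := Xmom s s0.
have mX := surplus_measurable s0.
have mv : measurable_fun setT (fun w => v (X s w)).
  exact: measurableT_comp measurable_hjb_v mX.
have mz : measurable_fun setT (fun w => z (X s w)).
  exact: measurableT_comp measurable_hjb_z mX.
have vK w : `|v (X s w)| <= K by exact: hjb_v_bound hS _.
have zK w : `|z (X s w)| <= K by exact: hjb_z_bound hS _.
have L1dQ : L1 Pr (fun w => Q (s + h) w - Q s w).
  apply: (@L1_bounded _ _ _ Pr _ (M * h)).
    by apply: measurable_funB; exact: policy_measurable.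
  by move=> w; have := Qlip w s0 (ltW ss); rewrite hE.
have L1hold : L1 Pr (fun w => hold (X s w)).
  apply: (L1_le (g := fun w => (`|Cplus| + `|Cminus|) * `|X s w|)).
  - exact: measurableT_comp measurable_holding_cost mX.
  - by apply: L1Z; exact: L1_norm.
  - by move=> w; exact: holding_cost_norm_le.
have L1min : L1 Pr (fun w => Num.min (v (X s w) + Ip) 0).
  apply: (@L1_bounded _ _ _ Pr _ (K + Ip)).
    by apply: measurable_minr => //; exact: measurable_funD.
  move=> w; have := vK w; rewrite ler_norml => /andP[k1 k2].
  have := K0; have := Ip0.
  by case: (leP (v (X s w) + Ip) 0) => ? *; rewrite ?normr0 ?addr_ge0//
    ler_norml; apply/andP; split; lra.
have L1A : L1 Pr (step_cost s h).
  apply: L1B; last exact: (L1_mul_bounded mv vK).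
  by apply: L1Z; apply: L1D => //; exact: L1Z.
split => //.
pose F1 w := step_cost s h w + V (X (s + h) w).
pose F2 w := F1 w - (1 + alpha * h) * V (X s w).
(* [G1] and [G2] have mean zero by independence; once they are subtracted, what remains of the
   expansion has mean of order [eta ^+ 3]. *)
pose G1 w := z (X s w) * (Y w ^+ 2 - h).
pose G2 w := v (X s w) * Y w.
pose G3 w := sigma ^+ 2 / 2 * G1 w - sigma * G2 w.
pose G w := F2 w - G3 w.
have L1Yh : L1 Pr (fun w => Y w ^+ 2 - h) by apply: L1B => //; exact: L1_cst.
have L1G1 : L1 Pr G1 by exact: (L1_mul_bounded mz zK).
have L1G2 : L1 Pr G2 by exact: (L1_mul_bounded mv vK).
have L1G3 : L1 Pr G3 by apply: L1B; exact: L1Z.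
have L1F1 : L1 Pr F1 by exact: L1D.
have L1F2 : L1 Pr F2 by apply: L1B => //; exact: L1Z.
have L1G : L1 Pr G by exact: L1B.
have EG1 : 'E[G1] = 0.
  have -> : 'E[G1] = 'E[fun w => z (X s w)] * 'E[fun w => Y w ^+ 2 - h].
    apply: (@E_surplus_mul s (s + h) z (fun y => y ^+ 2 - h)) => //.
    - exact: measurable_hjb_z.
    - exact: hjb_z_bound hS.
    - by apply: measurable_funB => //; exact: measurable_funX.
  have -> : 'E[fun w => Y w ^+ 2 - h] = 'E[fun w => Y w ^+ 2] - 'E[fun=> h].
    by apply: EB => //; exact: L1_cst.
  by rewrite EY2 E_cst subrr mulr0.
have EG2 : 'E[G2] = 0.
  have -> : 'E[G2] = 'E[fun w => v (X s w)] * 'E[Y].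
    apply: (@E_surplus_mul s (s + h) v id) => //.
    - exact: measurable_hjb_v.
    - exact: hjb_v_bound hS.
  by rewrite EY mulr0.
have EG3 : 'E[G3] = 0.
  have -> : 'E[G3] = 'E[fun w => sigma ^+ 2 / 2 * G1 w] - 'E[fun w => sigma * G2 w].
    by apply: EB; exact: L1Z.
  by rewrite !EZ// EG1 EG2 !mulr0 subrr.
have EG : 'E[G] = 'E[step_cost s h] - ((1 + alpha * h) * 'E[fun w => V (X s w)] -
       'E[fun w => V (X (s + h) w)]).
  have -> : 'E[G] = 'E[F2] - 'E[G3] by exact: EB.
  rewrite EG3 subr0.
  have -> : 'E[F2] = 'E[F1] - 'E[fun w => (1 + alpha * h) * V (X s w)].
    by apply: EB => //; exact: L1Z.
  have -> : 'E[F1] = 'E[step_cost s h] + 'E[fun w => V (X (s + h) w)] by exact: ED.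
  by rewrite EZ//; ring.
rewrite -EG.
(* With [h = eta ^+ 2] and [Y] of size [eta], each of the four terms has mean O(eta ^+ 3). *)
pose g w := (K * N ^+ 2 / 2 * h ^+ 2 + 4 * K * N ^+ 3 * h ^+ 3) +
  (K * sigma * N * h * `|Y w| + 4 * K * sigma ^+ 3 * `|Y w| ^+ 3).
have L1g : L1 Pr g.
  apply: L1D; first exact: L1_cst.
  by apply: L1D; apply: L1Z => //; exact: L1_norm.
have Gg w : `|G w| <= g w.
  pose x := X s w; pose y := X (s + h) w.
  pose dQ := Q (s + h) w - Q s w - b * h.
  pose rem := V y - V x - v x * (y - x) - z x * (y - x) ^+ 2 / 2.
  have yx : y - x = dQ - sigma * Y w.
    by rewrite /y /x surplus_increment hE.
  (* The equation for [V] cancels all terms of first order in [h]. *)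
  have GE : G w = z x / 2 * (dQ ^+ 2 - 2 * sigma * dQ * Y w) + rem.
    have HJB := hjb_eq hS x.
    have -> : G w = h * (sigma ^+ 2 / 2 * z x - b * v x +
        hold x + thu * Num.min (v x + Ip) 0) - alpha * h * V x +
       z x / 2 * (dQ ^+ 2 - 2 * sigma * dQ * Y w) + rem.
      rewrite /rem yx /G /F2 /F1 /G3 /G1 /G2 /step_cost -/x -/y /dQ.
      by field.
    by rewrite -HJB; ring.
  have dQN : `|dQ| <= N * h.
    apply: (le_trans (ler_normB _ _)); rewrite NE mulrDl lerD//.
      by have := Qlip w s0 (ltW ss); rewrite hE.
    by rewrite normrM (gtr0_norm h0).
  have remK : `|rem| <= 4 * K * (N ^+ 3 * h ^+ 3 + sigma ^+ 3 * `|Y w| ^+ 3).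
    apply: (le_trans (hjb_taylor hS x y)).
    have -> : 4 * K * (N ^+ 3 * h ^+ 3 + sigma ^+ 3 * `|Y w| ^+ 3) =
       K * (4 * ((N * h) ^+ 3 + (sigma * `|Y w|) ^+ 3)) by ring.
    rewrite ler_wpM2l//.
    have yxN : `|y - x| <= N * h + sigma * `|Y w|.
      rewrite yx; apply: (le_trans (ler_normB _ _)).
      by rewrite (normrM sigma) (gtr0_norm sg0) lerD2r.
    have n0 : 0 <= N * h by rewrite mulr_ge0// ltW.
    have n1 : 0 <= sigma * `|Y w| by rewrite mulr_ge0// ltW.
    apply: (@le_trans _ _ ((N * h + sigma * `|Y w|) ^+ 3)).
      by rewrite lerXn2r// nnegrE addr_ge0.
    move: n0 n1; move: (N * h) (sigma * `|Y w|) => p q p0' q0'.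
    rewrite -subr_ge0.
    have -> : 4 * (p ^+ 3 + q ^+ 3) - (p + q) ^+ 3 = 3 * ((p + q) * (p - q) ^+ 2) by ring.
    by rewrite mulr_ge0// mulr_ge0 ?addr_ge0 ?sqr_ge0.
  rewrite GE; apply: (le_trans (ler_normD _ _)).
  have -> : g w = (K / 2 * ((N * h) ^+ 2 + 2 * sigma * (N * h) * `|Y w|)) +
      4 * K * (N ^+ 3 * h ^+ 3 + sigma ^+ 3 * `|Y w| ^+ 3) by rewrite /g; field.
  rewrite lerD// normrM; apply: ler_pM => //.
    by rewrite normrM [`|2^-1|]gtr0_norm// ler_wpM2r//; exact: zK.
  apply: (le_trans (ler_normB _ _)); apply: lerD.
    by rewrite normrX lerXn2r ?nnegrE// mulr_ge0// ltW.
  rewrite !normrM (gtr0_norm sg0) normr_nat ler_wpM2r// ler_wpM2l//.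
  by rewrite mulr_ge0// ltW.
apply: (le_trans (E_norm_le L1G L1g Gg)).
have -> : 'E[g] = (K * N ^+ 2 / 2 * h ^+ 2 + 4 * K * N ^+ 3 * h ^+ 3) +
  (K * sigma * N * h * 'E[fun w => `|Y w|] + 4 * K * sigma ^+ 3 * 'E[fun w => `|Y w| ^+ 3]).
  have -> : 'E[g] = 'E[fun=> K * N ^+ 2 / 2 * h ^+ 2 + 4 * K * N ^+ 3 * h ^+ 3] +
      'E[fun w => K * sigma * N * h * `|Y w| + 4 * K * sigma ^+ 3 * `|Y w| ^+ 3].
    apply: ED; first exact: L1_cst.
    by apply: L1D; apply: L1Z => //; exact: L1_norm.
  rewrite E_cst; congr (_ + _).
  have -> : 'E[fun w => K * sigma * N * h * `|Y w| + 4 * K * sigma ^+ 3 * `|Y w| ^+ 3] =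
    'E[fun w => K * sigma * N * h * `|Y w|] + 'E[fun w => 4 * K * sigma ^+ 3 * `|Y w| ^+ 3].
    by apply: ED; apply: L1Z => //; exact: L1_norm.
  by rewrite !EZ//; exact: L1_norm.
have p2 : h ^+ 2 <= eta ^+ 3.
  by rewrite /h -exprM (exprS eta 3); apply: ler_piMl; rewrite ?exprn_ge0// ltW.
have p3 : h ^+ 3 <= eta ^+ 3.
  by rewrite lerXn2r ?nnegrE ?(ltW h0) ?(ltW eta0)// /h expr2; apply: ler_piMl => //; exact: ltW.
have q1 : K * N ^+ 2 / 2 * h ^+ 2 <= K * N ^+ 2 / 2 * eta ^+ 3.
  by rewrite ler_wpM2l// !mulr_ge0// ?exprn_ge0 ?invr_ge0.
have q2 : 4 * K * N ^+ 3 * h ^+ 3 <= 4 * K * N ^+ 3 * eta ^+ 3.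
  by rewrite ler_wpM2l// !mulr_ge0// exprn_ge0.
have q3 : K * sigma * N * h * 'E[fun w => `|Y w|] <= K * sigma * N * h * (2 * e1 * eta).
  by rewrite ler_wpM2l// !mulr_ge0// ltW.
have q4 : 4 * K * sigma ^+ 3 * 'E[fun w => `|Y w| ^+ 3] <=
    4 * K * sigma ^+ 3 * (54 * e1 * eta ^+ 3).
  by rewrite ler_wpM2l// !mulr_ge0// exprn_ge0// ltW.
apply: (le_trans (lerD (lerD q1 q2) (lerD q3 q4))).
by rewrite le_eqVlt; apply/orP; left; apply/eqP; rewrite /C /h; field.
Qed.

End value_along_policy.

(** * Comparison of integrals almost everywhere *)

Section integral_comparison_ae.
Context {d : measure_display} {T : measurableType d} {R : realType}.
Variable mu : {measure set T -> \bar R}.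
Local Open Scope ereal_scope.

(* Only one of the two functions has to be measurable. *)
Lemma ge0_le_integral_ae_l (D : set T) (f g : T -> \bar R) : measurable D ->
  measurable_fun D f -> (forall x, D x -> 0 <= f x) -> (forall x, D x -> 0 <= g x) ->
  {ae mu, forall x, D x -> f x <= g x} ->
  \int[mu]_(x in D) f x <= \int[mu]_(x in D) g x.
Proof.
move=> mD mf f0 g0 [N [mN N0 fg]].
rewrite (ge0_negligible_integral mN mD mf f0 N0).
rewrite [leLHS]integral_mkcond [leRHS]integral_mkcond.
apply: ge0_le_integral_nonmeas => x _; rewrite !patchE.
  by case: ifPn => //; rewrite inE => -[Dx _]; exact: f0.
case: ifPn => [|_]; last by case: ifPn => //; rewrite inE => Dx; exact: g0.
rewrite inE => -[Dx nN]; rewrite mem_set//.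
by apply: contrapT => h; apply: nN; apply: fg => /(_ Dx).
Qed.

(** As [f] may fail to be measurable, it is left unchanged on the null set [N]; [g] is raised to
    [+oo] there instead, which keeps it measurable and preserves its integral. *)
Lemma ge0_le_integral_ae_r (D : set T) (f g : T -> \bar R) : measurable D ->
  measurable_fun D g -> (forall x, D x -> 0 <= f x) -> (forall x, D x -> 0 <= g x) ->
  {ae mu, forall x, D x -> f x <= g x} ->
  \int[mu]_(x in D) f x <= \int[mu]_(x in D) g x.
Proof.
move=> mD mg f0 g0 [N [mN N0 fg]].
pose g' x := if x \in N then +oo else g x.
have mg' : measurable_fun D g'.
  apply: measurable_fun_if => //.
  - apply: (measurable_fun_bool true).
    have -> : (fun x => x \in N) @^-1` [set true] = N.
      by apply/seteqP; split => x; [exact: set_mem|exact: mem_set].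
    exact: measurableI.
  - exact: measurable_funS mg.
apply: (@le_trans _ _ (\int[mu]_(x in D) g' x)).
  apply: ge0_le_integral_nonmeas => // x Dx; rewrite /g'.
  case: ifPn => [_|/negP xN]; first by rewrite leey.
  by apply: contrapT => h; apply: xN; rewrite inE; apply: fg => /(_ Dx).
have g'0 x : D x -> 0 <= g' x by rewrite /g'; case: ifPn => // _; exact: g0.
rewrite (ge0_negligible_integral mN mD mg' g'0 N0).
rewrite (ge0_negligible_integral mN mD mg g0 N0).
apply: ge0_le_integral_nonmeas => x [Dx Nx]; first exact: g'0.
by rewrite /g' memNset.
Qed.

End integral_comparison_ae.

(** * Measurable versions of the rate *)

Section policy_rates.
Context {d : measure_display} {T : measurableType d} {R : realType}.
Notation mu := (@lebesgue_measure R).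
Variables (thl thu p0 : R) (D Q : R -> T -> R).
Hypotheses (thl0 : thl < 0) (thu0 : 0 < thu)
  (hQ : control_policy thl thu D p0 Q).
Variable w : T.

Let Qlip x y : 0 <= x -> x <= y -> `|Q y w - Q x w| <= (thu - thl) * (y - x).
Proof. exact: (policy_lip thl0 thu0 hQ). Qed.

(** [derive1] is uncontrolled on the exceptional null set. Setting the rate to 0 there, an
    admissible value since [thl < 0 < thu], gives a function that is measurable and bounded
    everywhere. *)
Lemma policy_rate_version : exists p : R -> R, [/\ measurable_fun setT p,
  forall t, thl <= p t <= thu & {ae mu, forall t, 0 <= t -> rate Q t w = p t}].
Proof.
have [N [mN N0 HN]] := policy_rate hQ w.
have dQ t : 0 <= t -> ~ N t -> derivable (Q ^~ w) t 1 /\ thl <= rate Q t w <= thu.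
  by move=> t0 nN; apply: contrapT => h; apply: nN; apply: HN => /(_ t0).
have mE : measurable (`[0, +oo[%classic `\` N : set R) by exact: measurableD.
exists (derive1 (Q ^~ w) \_ (`[0, +oo[%classic `\` N)); split.
- apply/(measurable_restrictT _ mE).
  by apply: (measurable_derive1 Qlip mN) => t t0 nN; have [] := dQ t t0 nN.
- move=> t; rewrite patchE; case: ifPn => [|_]; last by rewrite !ltW.
  by rewrite inE/= in_itv/= andbT => -[t0 nN]; have [] := dQ t t0 nN.
- exists N; split => // t /= H; apply: contrapT => nN; apply: H => t0.
  by rewrite patchE mem_set//=; split => //; rewrite in_itv/= t0.
Qed.

Lemma policy_rate_FTC (p : R -> R) s s' : measurable_fun setT p ->
  (forall t, thl <= p t <= thu) -> {ae mu, forall t, 0 <= t -> rate Q t w = p t} ->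
  0 <= s -> s <= s' -> (\int[mu]_(t in `[s, s']) p t = Q s' w - Q s w)%R.
Proof.
move=> mp pM [N [mN N0 HN]] s0 ss.
have [N' [mN' N'0 HN']] := policy_rate hQ w.
apply: (@lipschitz_FTC _ (Q ^~ w) p s s' (thu - thl) (N `|` N')) => //.
- by rewrite subr_ge0 ltW// (lt_trans thl0).
- by move=> x y sx xy _; apply: Qlip => //; exact: le_trans sx.
- exact: measurable_funTS.
- move=> t _; have /andP[h1 h2] := pM t; have := thl0; have := thu0.
  by rewrite ler_norml => *; apply/andP; split; lra.
- exact: measurableU.
- apply/eqP; rewrite eq_le measure_ge0 andbT.
  apply: (le_trans (measureU2 _ _ _)) => //.
  by rewrite [X in (X + _)%E]N0 [X in (_ + X)%E]N'0 adde0.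
- move=> t /andP[st _] nN; have t0 := le_trans s0 st.
  have [dt _] : derivable (Q ^~ w) t 1 /\ thl <= rate Q t w <= thu.
    by apply: contrapT => h; apply: nN; right; apply: HN' => /(_ t0).
  have <- : rate Q t w = p t.
    by apply: contrapT => h; apply: nN; left; apply: HN => /(_ t0).
  by rewrite /rate derive1E; exact: derivableP.
Qed.

End policy_rates.

(** * Cost of a step along one path *)

Section pathwise_cost.
Context {d : measure_display} {T : measurableType d} {R : realType}.
Notation mu := (@lebesgue_measure R).
Variables (alpha b sigma thl thu Ip Dp Cplus Cminus L K : R) (V v z : R -> R).
Hypotheses (a0 : 0 < alpha) (thl0 : thl < 0) (thu0 : 0 < thu)
  (Ip0 : 0 <= Ip) (Dp0 : 0 <= Dp) (Cplus0 : 0 <= Cplus) (Cminus0 : 0 <= Cminus)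
  (CpDp : Cplus / alpha <= Dp).
Hypothesis hS : hjb_solution alpha b sigma thu Ip Cplus Cminus L K V v z.
Notation hold := (holding_cost Cplus Cminus).

Definition adjustment_cost (q : R) := (Ip * (0 < q)%R%:R - Dp * (q < 0)%R%:R) * q.

Let K0 : 0 <= K.
Proof. exact: le_trans (normr_ge0 _) (hjb_v_bound hS 0). Qed.

Lemma adjustment_cost_ge0 q : 0 <= adjustment_cost q.
Proof.
rewrite /adjustment_cost; case: (ltgtP 0 q) => h /=.
- by rewrite mulr1 mulr0 subr0 mulr_ge0// ltW.
- by rewrite mulr1 mulr0 sub0r mulNr -mulrN mulr_ge0// oppr_ge0 ltW.
- by rewrite -h mulr0.
Qed.

Lemma adjustment_cost_le q : thl <= q <= thu ->
  adjustment_cost q <= (Ip + Dp) * (thu - thl).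
Proof.
move=> /andP[h1 h2]; have u0 := thu0; have l0 := thl0.
have I0 := Ip0; have D0 := Dp0; rewrite /adjustment_cost.
case: (ltgtP 0 q) => h /=.
- by rewrite mulr1 mulr0 subr0; apply: ler_pM => //; lra.
- by rewrite mulr1 mulr0 sub0r mulNr -mulrN; apply: ler_pM => //; lra.
- by rewrite -h mulr0 mulr_ge0 ?addr_ge0//; lra.
Qed.

Lemma measurable_adjustment_cost : measurable_fun setT adjustment_cost.
Proof.
have -> : adjustment_cost = fun q => Ip * Num.max q 0 - Dp * Num.min q 0.
  apply/funext => q; rewrite /adjustment_cost; case: (ltgtP 0 q) => h /=.
  - by rewrite mulr1 !mulr0 !subr0.
  - by rewrite mulr1 !mulr0 !sub0r mulNr.
  - by rewrite -h !mulr0 subrr.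
apply: measurable_funB; apply: measurable_funM => //.
  exact: measurable_maxr.
exact: measurable_minr.
Qed.

(* The Hamiltonian [q |-> adjustment_cost q + v x * q] is minimized over [thl, thu]
   at 0 or at [thu], because [v x <= Cplus / alpha <= Dp] rules out [q < 0]. *)
Lemma adjustment_cost_ge x q : thl <= q <= thu ->
  - v x * q + thu * Num.min (v x + Ip) 0 <= adjustment_cost q.
Proof.
move=> /andP[h1 h2]; have vD := le_trans (hjb_v_ub hS x) CpDp.
have m0 : thu * Num.min (v x + Ip) 0 <= 0.
  by rewrite pmulr_rle0// ge_min lexx orbT.
rewrite /adjustment_cost; case: (ltgtP 0 q) => h /=.
- rewrite mulr1 mulr0 subr0 -lerBrDl.
  have -> : Ip * q - (- v x * q) = q * (v x + Ip) by ring.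
  case: (leP (v x + Ip) 0) => vI; last by rewrite mulr0 mulr_ge0// ltW.
  by rewrite ler_wnM2r.
- rewrite mulr1 mulr0 sub0r !mulNr.
  have : Dp * q <= v x * q by rewrite ler_wnM2r// ltW.
  lra.
- by rewrite -h !mulr0 add0r.
Qed.

Lemma adjustment_cost_threshold x y q : q = (if y < L then thu else 0) ->
  adjustment_cost q <= - v x * q + thu * Num.min (v x + Ip) 0 + 2 * thu * K * `|y - x|.
Proof.
move=> qE; have lip := hjb_v_lip hS x y.
have -> : adjustment_cost q = - v y * q + thu * Num.min (v y + Ip) 0.
  rewrite /adjustment_cost qE; case: ifPn => [yL|].
    rewrite thu0 (ltNge thu 0) (ltW thu0)/= mulr1 mulr0 subr0.
    have := hjb_v_below hS yL => vI; rewrite (min_idPl _); last by lra.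
    by ring.
  rewrite -leNgt => yL; rewrite !mulr0 add0r.
  have := hjb_v_above hS yL => vI; rewrite (min_idPr _); last by lra.
  by rewrite mulr0.
have q0 : 0 <= q <= thu by rewrite qE; case: ifP => _; rewrite ?lexx ltW.
have e1 : - v y * q <= - v x * q + thu * (K * `|y - x|).
  have -> : - v y * q = - v x * q + (v x - v y) * q by ring.
  rewrite lerD2l; case/andP: q0 => q0 q1.
  apply: (@le_trans _ _ (`|v x - v y| * q)).
    by rewrite ler_wpM2r// ler_norm.
  by rewrite mulrC distrC; apply: ler_pM.
have e2 : Num.min (v y + Ip) 0 <= Num.min (v x + Ip) 0 + K * `|y - x|.
  have : 0 <= K * `|y - x| by rewrite mulr_ge0.
  move: lip; rewrite ler_norml => /andP[l1 l2].
  by case: (leP (v y + Ip) 0) => h; case: (leP (v x + Ip) 0) => h'; lra.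
have := ler_wpM2l (ltW thu0) e2; rewrite mulrDr.
have -> : 2 * thu * K * `|y - x| = thu * (K * `|y - x|) + thu * (K * `|y - x|) by ring.
lra.
Qed.

Lemma holding_cost_ge0 x : 0 <= hold x.
Proof.
rewrite /holding_cost addr_ge0// mulr_ge0// ?oppr_ge0; first by rewrite le_max lexx orbT.
by rewrite ge_min lexx orbT.
Qed.

Variables (D Q : R -> T -> R) (p0 : R).
Hypothesis hQ : control_policy thl thu D p0 Q.
Variable w : T.
Hypothesis cD : continuous_path (D ^~ w).
Let x t := Q t w - D t w.

Let cx : continuous (fun t : R => x (Num.max t 0)).
Proof.
apply: (@continuous_path_extend R x); rewrite /x.
by apply: continuous_pathB => //; exact: policy_continuous_path hQ.
Qed.

Let cons_integrable (g : R -> R) s s' : 0 <= s -> continuous g ->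
  mu.-integrable `[s, s'] (EFin \o (fun t => g (x t))).
Proof.
move=> s0 cg.
have H : mu.-integrable `[s, s'] (EFin \o (fun t : R => g (x (Num.max t 0)))).
  apply: continuous_compact_integrable; first exact: segment_compact.
  apply: continuous_subspaceT => t.
  exact: (continuous_comp (@cx t) (cg _)).
apply: eq_integrable H => // t; rewrite inE/= in_itv/= => /andP[st _].
by rewrite (max_idPl (le_trans s0 st)).
Qed.

Variable p : R -> R.
Hypotheses (mp : measurable_fun setT p) (pM : forall t, thl <= p t <= thu)
  (pE : {ae mu, forall t, 0 <= t -> rate Q t w = p t}).

Let measurable_x (s s' : R) : 0 <= s -> measurable_fun `[s, s'] x.
Proof.
move=> s0; have : measurable_fun `[s, s'] (fun t : R => x (Num.max t 0)).
  by apply: measurable_funTS; exact: continuous_measurable_fun (@cx).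
apply: eq_measurable_fun => t; rewrite inE/= in_itv/= => /andP[st _].
by rewrite (max_idPl (le_trans s0 st)).
Qed.

Let itv_fin s s' : (mu `[s, s']%classic < +oo)%E.
Proof. by rewrite lebesgue_measure_itv/=; case: ifP => _; rewrite ?ltry// -EFinD ltry. Qed.

Let bounded_integrable (g : R -> R) (s s' B : R) : measurable_fun setT g ->
  (forall t, `|g t| <= B) -> mu.-integrable `[s, s'] (EFin \o g).
Proof.
move=> mg gB; apply: measurable_bounded_integrable => //; first exact: itv_fin.
  exact: measurable_funTS.
exists B; split; first exact: num_real.
by move=> y By t _ /=; apply: (le_trans (gB t)); exact: ltW.
Qed.

Let itv_integrableD (f g : R -> R) s s' : mu.-integrable `[s, s'] (EFin \o f) ->
  mu.-integrable `[s, s'] (EFin \o g) ->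
  mu.-integrable `[s, s'] (EFin \o (fun t => f t + g t)).
Proof.
move=> i1 i2.
have : mu.-integrable `[s, s'] ((EFin \o f) \+ (EFin \o g))%E.
  by apply: integrableD.
by apply: eq_integrable => // t _; rewrite /= EFinD.
Qed.

Let itv_integrableZ (f : R -> R) c s s' : mu.-integrable `[s, s'] (EFin \o f) ->
  mu.-integrable `[s, s'] (EFin \o (fun t => c * f t)).
Proof.
move=> i1.
exact: (@integrableZl _ _ _ mu `[s, s'] (measurable_itv _) c (EFin \o f) i1).
Qed.

Let integrable_p s s' : mu.-integrable `[s, s'] (EFin \o p).
Proof.
apply: (@bounded_integrable _ _ _ (thu - thl)) => //.
move=> t; have /andP[h1 h2] := pM t; have := thl0; have := thu0.
by rewrite ler_norml => *; apply/andP; split; lra.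
Qed.

Definition path_deviation s h := (\int[mu]_(t in `[s, s + h]) `|x t - x s|)%R.

Let integrable_dev s s' c : 0 <= s ->
  mu.-integrable `[s, s'] (EFin \o (fun t => `|x t - c|)).
Proof.
move=> s0; apply: (@cons_integrable (fun y => `|y - c|)) => // t.
apply: (lipschitz_continuous_fun (M := 1)) => y1 y2; rewrite mul1r.
have -> : y2 - y1 = (y2 - c) - (y1 - c) by ring.
exact: ler_dist_dist.
Qed.

(** With the surplus frozen at [s], the bounds on the cost rate are affine in [p t] and in the
    deviation, so that they integrate explicitly: [p] gives the increment of [Q]. *)
Let lin_integral s h k0 k1 k2 : 0 <= s -> 0 <= h ->
  mu.-integrable `[s, s + h]
    (EFin \o (fun t => k0 + k1 * p t + k2 * `|x t - x s|)) /\
  (\int[mu]_(t in `[s, s + h]) (k0 + k1 * p t + k2 * `|x t - x s|))%R =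
    k0 * h + k1 * (Q (s + h) w - Q s w) + k2 * path_deviation s h.
Proof.
move=> s0 h0; have ss : s <= s + h by rewrite lerDl.
have mI : measurable (`[s, s + h]%classic : set R) by exact: measurable_itv.
have i0 : mu.-integrable `[s, s + h] (EFin \o (fun=> k0)).
  by apply: (@bounded_integrable _ _ _ `|k0|).
have i1 : mu.-integrable `[s, s + h] (EFin \o (fun t => k1 * p t)).
  by apply: itv_integrableZ; exact: integrable_p.
have i2 : mu.-integrable `[s, s + h] (EFin \o (fun t => k2 * `|x t - x s|)).
  by apply: itv_integrableZ; exact: integrable_dev.
have i01 : mu.-integrable `[s, s + h] (EFin \o (fun t => k0 + k1 * p t)).
  exact: itv_integrableD.
split; first exact: itv_integrableD.
have -> : (\int[mu]_(t in `[s, s + h]) (k0 + k1 * p t + k2 * `|x t - x s|))%R =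
  ((\int[mu]_(t in `[s, s + h]) (k0 + k1 * p t)) +
   (\int[mu]_(t in `[s, s + h]) (k2 * `|x t - x s|)))%R by exact: RintegralD.
have -> : (\int[mu]_(t in `[s, s + h]) (k0 + k1 * p t))%R =
  ((\int[mu]_(t in `[s, s + h]) k0) + (\int[mu]_(t in `[s, s + h]) (k1 * p t)))%R.
  exact: RintegralD.
have -> : (\int[mu]_(t in `[s, s + h]) k0)%R = k0 * fine (mu `[s, s + h]%classic).
  exact: Rintegral_cst.
have -> : mu `[s, s + h]%classic = h%:E.
  rewrite lebesgue_measure_itv/= lte_fin; case: ltP => h'.
    by rewrite -EFinD addrAC subrr add0r.
  by have -> : h = 0 by lra.
have -> : (\int[mu]_(t in `[s, s + h]) (k1 * p t))%R =
    k1 * (\int[mu]_(t in `[s, s + h]) p t)%R.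
  by apply: RintegralZl => //; exact: (integrable_p s (s + h)).
have -> : (\int[mu]_(t in `[s, s + h]) (k2 * `|x t - x s|))%R =
    k2 * path_deviation s h.
  by apply: RintegralZl => //; exact: (integrable_dev (s + h) (x s) s0).
by rewrite (policy_rate_FTC thl0 thu0 hQ mp pM pE s0 ss).
Qed.

Let run t := expR (- (alpha * t)) * (hold (x t) + adjustment_cost (p t)).

Let flow_ge0 t : 0 <= hold (x t) + adjustment_cost (p t).
Proof. by rewrite addr_ge0 ?holding_cost_ge0 ?adjustment_cost_ge0. Qed.

Let run_ge0 t : 0 <= run t.
Proof. by rewrite mulr_ge0 ?expR_ge0. Qed.

Let measurable_run (s s' : R) : 0 <= s -> measurable_fun `[s, s'] run.
Proof.
move=> s0; apply: measurable_funM; last apply: measurable_funD.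
- by apply: measurableT_comp => //; apply: measurableT_comp => //.
- apply: measurableT_comp; [exact: measurable_holding_cost|exact: measurable_x].
- apply: measurable_funTS; apply: measurableT_comp => //.
  exact: measurable_adjustment_cost.
Qed.

Let integrable_run s s' : 0 <= s -> mu.-integrable `[s, s'] (EFin \o run).
Proof.
move=> s0; have mI : measurable (`[s, s']%classic : set R) by exact: measurable_itv.
have ih : mu.-integrable `[s, s'] (EFin \o (fun t => hold (x t))).
  apply: (@cons_integrable hold) => // t.
  apply: (lipschitz_continuous_fun (M := `|Cplus| + `|Cminus|)) => y1 y2.
  exact: holding_cost_lip.
have ia : mu.-integrable `[s, s'] (EFin \o (fun t => adjustment_cost (p t))).
  apply: (@bounded_integrable _ _ _ ((Ip + Dp) * (thu - thl))).
    by apply: measurableT_comp => //; exact: measurable_adjustment_cost.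
  by move=> t; rewrite ger0_norm ?adjustment_cost_ge0// adjustment_cost_le.
apply: le_integrable (itv_integrableD ih ia) => //.
  by apply/measurable_EFinP; exact: measurable_run.
move=> t; rewrite /= in_itv/= => /andP[st _]; rewrite lee_fin.
rewrite !ger0_norm ?run_ge0 ?flow_ge0//.
rewrite /run ler_piMl ?flow_ge0//.
by rewrite -expR0 ler_expR oppr_le0 mulr_ge0 ?(ltW a0)// (le_trans s0).
Qed.

(** Lipschitz constant of the holding cost plus the constant of [adjustment_cost_threshold]. *)
Let C := `|Cplus| + `|Cminus| + 2 * thu * K.
Let A s h := h * (hold (x s) + thu * Num.min (v (x s) + Ip) 0) -
  v (x s) * (Q (s + h) w - Q s w).

Let run_Rintegral s s' : 0 <= s ->
  (\int[mu]_(t in `[s, s']) (run t)%:E = (\int[mu]_(t in `[s, s']) run t)%R%:E)%E.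
Proof.
move=> s0; rewrite /Rintegral fineK//.
exact: (integrable_fin_num _ (integrable_run s' s0)).
Qed.

(** Since the cost rate is nonnegative, the discount factor may be lowered to its value at the end
    of the step; the upper bound below uses the value at the start. *)
Lemma step_running_cost_ge s h : 0 <= s -> 0 <= h ->
  ((expR (- (alpha * (s + h))) * (A s h - C * path_deviation s h))%:E <=
    \int[mu]_(t in `[s, (s + h)%R]) (run t)%:E)%E.
Proof.
move=> s0 h0; rewrite run_Rintegral// lee_fin.
set r := expR _; have r0 : 0 <= r by exact: expR_ge0.
pose c0 := hold (x s) + thu * Num.min (v (x s) + Ip) 0.
have [il El] := lin_integral (r * c0) (r * - v (x s)) (r * - C) s0 h0.
have -> : r * (A s h - C * path_deviation s h) =
    r * c0 * h + r * - v (x s) * (Q (s + h) w - Q s w) + r * - C * path_deviation s h.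
  by rewrite /A /c0; ring.
rewrite -El; apply: le_Rintegral => //; first exact: integrable_run.
move=> t; rewrite /= in_itv/= => /andP[st tsh].
apply: (@le_trans _ _ (r * (hold (x t) + adjustment_cost (p t)))); last first.
  rewrite ler_wpM2r ?flow_ge0//.
  by rewrite ler_expR lerN2 ler_wpM2l// ltW.
have -> : r * c0 + r * - v (x s) * p t + r * - C * `|x t - x s| =
  r * (c0 - v (x s) * p t - C * `|x t - x s|) by ring.
rewrite ler_wpM2l//.
have := adjustment_cost_ge (x s) (pM t).
have := holding_cost_lip Cplus Cminus (x s) (x t); rewrite ler_norml => /andP[h1 _].
have : 0 <= 2 * thu * K * `|x t - x s| by rewrite !mulr_ge0// ltW.
rewrite /c0 /C mulrDl; lra.
Qed.

Lemma step_running_cost_le s h : 0 <= s -> 0 <= h ->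
  (forall t, 0 <= t -> p t = if x t < L then thu else 0) ->
  (\int[mu]_(t in `[s, (s + h)%R]) (run t)%:E <=
    (expR (- (alpha * s)) * (A s h + C * path_deviation s h))%:E)%E.
Proof.
move=> s0 h0 pT; rewrite run_Rintegral// lee_fin.
set r := expR _; have r0 : 0 <= r by exact: expR_ge0.
pose c0 := hold (x s) + thu * Num.min (v (x s) + Ip) 0.
have [il El] := lin_integral (r * c0) (r * - v (x s)) (r * C) s0 h0.
have -> : r * (A s h + C * path_deviation s h) =
    r * c0 * h + r * - v (x s) * (Q (s + h) w - Q s w) + r * C * path_deviation s h.
  by rewrite /A /c0; ring.
rewrite -El; apply: le_Rintegral => //; first exact: integrable_run.
move=> t; rewrite /= in_itv/= => /andP[st tsh].
apply: (@le_trans _ _ (r * (hold (x t) + adjustment_cost (p t)))).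
  rewrite ler_wpM2r ?flow_ge0//.
  by rewrite ler_expR lerN2 ler_wpM2l// ltW.
have -> : r * c0 + r * - v (x s) * p t + r * C * `|x t - x s| =
  r * (c0 - v (x s) * p t + C * `|x t - x s|) by ring.
rewrite ler_wpM2l//.
have := adjustment_cost_threshold (x s) (pT t (le_trans s0 st)).
have := holding_cost_lip Cplus Cminus (x s) (x t); rewrite ler_norml => /andP[_ h1].
rewrite /c0 /C mulrDl; lra.
Qed.

Lemma measurable_running_cost : measurable_fun (`[0, +oo[%classic : set R) run.
Proof.
apply: measurable_funM; last apply: measurable_funD.
- by apply: measurableT_comp => //; apply: measurableT_comp => //.
- apply: measurableT_comp; first exact: measurable_holding_cost.
  have : measurable_fun (`[0, +oo[%classic : set R) (fun t : R => x (Num.max t 0)).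
    by apply: measurable_funTS; exact: continuous_measurable_fun (@cx).
  apply: eq_measurable_fun => t; rewrite inE/= in_itv/= andbT => t0.
  by rewrite (max_idPl t0).
- apply: measurable_funTS; apply: measurableT_comp => //.
  exact: measurable_adjustment_cost.
Qed.

(** Half-open steps partition the half-line; closing them on the right adds only null sets. *)
Lemma running_cost_series h : 0 < h ->
  (\int[mu]_(t in `[0%R, +oo[) (run t)%:E =
   \sum_(0 <= k <oo) \int[mu]_(t in `[(k%:R * h)%R, (k%:R * h + h)%R]) (run t)%:E)%E.
Proof.
move=> h0; pose F (k : nat) := `[(k%:R * h)%R, (k.+1%:R * h)%R[%classic : set R.
have FE : `[0%R, +oo[%classic = \bigcup_k F k.
  apply/seteqP; split => t /=.
    rewrite in_itv/= andbT => t0; exists (Num.truncn (t / h)) => //.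
    have /truncn_itv/andP[h1 h2] : 0 <= t / h by rewrite divr_ge0// ltW.
    by rewrite /F/= in_itv/= -ler_pdivlMr// h1 -ltr_pdivrMr.
  move=> [k _]; rewrite /F/= !in_itv/= andbT => /andP[h1 _].
  by apply: le_trans h1; rewrite mulr_ge0// ltW.
have kh0 (k : nat) : 0 <= k%:R * h by rewrite mulr_ge0// ltW.
have tF : trivIset [set: nat] F.
  have disj i j t : (i < j)%N -> F i t -> F j t -> False.
    move=> ij; rewrite /F/= !in_itv/= => /andP[_ h1] /andP[h2 _].
    have : (i.+1%:R : R) * h <= j%:R * h by rewrite ler_wpM2r ?ler_nat// ltW.
    by lra.
  apply/trivIsetP => i j _ _; rewrite neq_ltn => /orP[] ij;
    apply/seteqP; split => // t [h1 h2]; exact: (disj _ _ t ij).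
have mrun : measurable_fun (`[0, +oo[%classic : set R) (fun t => (run t)%:E).
  by apply/measurable_EFinP; exact: measurable_running_cost.
have mF k : measurable (F k) by exact: measurable_itv.
rewrite FE in mrun *.
have run0 t : (\bigcup_k F k) t -> (0 <= (run t)%:E)%E by rewrite lee_fin.
rewrite (@ge0_integral_bigcup _ _ _ mu F (fun t => (run t)%:E) mF mrun run0 tF).
apply: eq_eseriesr => k _; rewrite /F integral_itv_bndo_bndc.
  by rewrite -natr1 mulrDl mul1r.
apply/measurable_EFinP; apply: (measurable_funS (E := `[k%:R * h, k.+1%:R * h])) => //.
  by apply: subset_itvl; rewrite bnd_simp.
exact: measurable_run.
Qed.

End pathwise_cost.

(** * Expected deviation of the surplus during a step *)

Section path_deviation_moment.
Context {R : realType} {d : measure_display} {T : measurableType d}.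
Notation mu := (@lebesgue_measure R).
Variables (Pr : probability T R) (W : R -> T -> R).
Hypothesis hW : standard_brownian_motion Pr W.
Notation "''E[' f ]" := (\int[Pr]_w f w)%R (at level 0, format "''E[' f ]").
Variables (b sigma thl thu d0 p0 : R) (Q : R -> T -> R).
Hypotheses (sg0 : 0 < sigma) (thl0 : thl < 0) (thu0 : 0 < thu).
Notation D := (demand b sigma d0 W).
Hypothesis hQ : control_policy thl thu D p0 Q.
Let X t w := Q t w - D t w.

Let mX : measurable_fun setT (fun z : T * R => X (Num.max z.2 0) z.1).
Proof.
apply: measurable_joint; first by move=> t t0; exact: (surplus_measurable hW hQ).
move=> w; apply: continuous_pathB; first exact: policy_continuous_path hQ.
exact: (demand_continuous_path hW).
Qed.

(** Within a step the surplus moves by O(eta) in mean, because of the Brownian part; the time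
    integral contributes the factor [eta ^+ 2]. *)
Lemma path_deviation_expectation : exists2 C, 0 <= C &
  forall s eta, 0 <= s -> 0 < eta <= 1 ->
    L1 Pr (fun w => path_deviation D Q w s (eta ^+ 2)) /\
    'E[fun w => path_deviation D Q w s (eta ^+ 2)] <= C * eta ^+ 3.
Proof.
pose N := thu - thl + `|b|.
have N0 : 0 <= N by rewrite addr_ge0// subr_ge0 ltW// (lt_trans thl0).
have e0 : 0 <= expR 1 :> R by exact: expR_ge0.
exists (N + sigma * (2 * expR 1)).
  by rewrite addr_ge0// !mulr_ge0// ltW.
move=> s eta s0 /andP[eta0 eta1]; set h := eta ^+ 2.
have h0 : 0 < h by rewrite exprn_gt0.
have ss : s <= s + h by rewrite lerDl ltW.
set C := N + _.
have bound t : s <= t <= s + h ->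
    (\int[Pr]_w (`|X t w - X s w|)%:E <= (C * eta)%:E)%E.
  move=> /andP[st tsh].
  have [L1W EW] := brownian_increment_abs hW s0 st.
  pose g w := N * h + sigma * `|W t w - W s w|.
  have L1g : L1 Pr g by apply: L1D; [exact: L1_cst|exact: L1Z].
  apply: (@le_trans _ _ (\int[Pr]_w (g w)%:E)%E).
    apply: ge0_le_integral_nonmeas => w _; first by rewrite lee_fin.
    rewrite lee_fin.
    apply: (le_trans (surplus_increment_norm_le sg0 thl0 thu0 hQ w s0 st)).
    by rewrite /g lerD2r ler_wpM2l// lerBlDl.
  have -> : (\int[Pr]_w (g w)%:E = ('E[g])%:E)%E.
    by rewrite /Rintegral fineK//; exact: (integrable_fin_num _ L1g).
  rewrite lee_fin.
  have -> : 'E[g] = N * h + sigma * 'E[fun w => `|W t w - W s w|].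
    have -> : 'E[g] = 'E[fun=> N * h] + 'E[fun w => sigma * `|W t w - W s w|].
      by apply: ED; [exact: L1_cst|exact: L1Z].
    by rewrite E_cst EZ.
  have sq : Num.sqrt (t - s) <= eta.
    rewrite -[leRHS](gtr0_norm eta0) -sqrtr_sqr ler_wsqrtr// -/h.
    by rewrite lerBlDl.
  rewrite /C [leRHS]mulrDl; apply: lerD.
    by rewrite ler_wpM2l// /h expr2; apply: ler_piMl => //; exact: ltW.
  rewrite -!mulrA ler_wpM2l ?(ltW sg0)//; apply: (le_trans EW).
  by rewrite -mulrA; do 2 (rewrite ler_wpM2l//).
have [mF FC] := ge0_path_integral_le s0 ss mX bound.
have {}FC : (\int[Pr]_w \int[mu]_(t in `[s, (s + h)%R]) (`|X t w - X s w|)%:E <=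
    (C * eta ^+ 3)%:E)%E.
  apply: (le_trans FC); rewrite addrAC subrr add0r /h lee_fin.
  by rewrite le_eqVlt; apply/orP; left; apply/eqP; ring.
pose F w := (\int[mu]_(t in `[s, (s + h)%R]) (`|X t w - X s w|)%:E)%E.
have F0 w : (0 <= F w)%E by apply: integral_ge0 => t _; rewrite lee_fin.
have dE w : path_deviation D Q w s h = fine (F w) by [].
have d0' w : 0 <= path_deviation D Q w s h by rewrite dE fine_ge0.
have dF w : ((path_deviation D Q w s h)%:E <= F w)%E.
  by rewrite dE; have := F0 w; case: (F w) => [r| |]//= _; rewrite leey.
have mdev : measurable_fun setT (fun w => path_deviation D Q w s h).
  by apply: measurableT_comp mF.
have le1 : (\int[Pr]_w (path_deviation D Q w s h)%:E <= (C * eta ^+ 3)%:E)%E.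
  apply: le_trans FC; apply: ge0_le_integral_nonmeas => w _; last exact: dF.
  by rewrite lee_fin.
have L1d : L1 Pr (fun w => path_deviation D Q w s h).
  apply/integrableP; split; first exact/measurable_EFinP.
  apply: (le_lt_trans _ (ltry (C * eta ^+ 3))); apply: le_trans le1.
  apply: ge0_le_integral_nonmeas => w _ //=.
  by rewrite lee_fin ger0_norm.
split => //; rewrite -lee_fin; apply: le_trans le1.
by rewrite /Rintegral fineK//; exact: (integrable_fin_num _ L1d).
Qed.

End path_deviation_moment.

(** * Comparison of the cost with the value function *)

Section verification.
Context {R : realType} {d : measure_display} {T : measurableType d}.
Notation mu := (@lebesgue_measure R).
Variables (Pr : probability T R) (W : R -> T -> R).
Hypothesis hW : standard_brownian_motion Pr W.
Notation "''E[' f ]" := (\int[Pr]_w f w)%R (at level 0, format "''E[' f ]").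
Variables (alpha b sigma thl thu Ip Dp Cplus Cminus L K : R) (V v z : R -> R).
Hypotheses (a0 : 0 < alpha) (sg0 : 0 < sigma) (thl0 : thl < 0) (thu0 : 0 < thu)
  (Ip0 : 0 <= Ip) (Dp0 : 0 <= Dp) (Cplus0 : 0 <= Cplus) (Cminus0 : 0 <= Cminus)
  (CpDp : Cplus / alpha <= Dp).
Hypothesis hS : hjb_solution alpha b sigma thu Ip Cplus Cminus L K V v z.
Variables (d0 p0 : R) (Q : R -> T -> R).
Notation D := (demand b sigma d0 W).
Hypothesis hQ : control_policy thl thu D p0 Q.

Let C := `|Cplus| + `|Cminus| + 2 * thu * K.
Let A h (k : nat) w := step_cost W b sigma thu Ip Cplus Cminus v d0 Q (k%:R * h) h w.
Let dev h (k : nat) w := path_deviation D Q w (k%:R * h) h.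
Let rho h (k : nat) := expR (- (alpha * (k%:R * h))).

Let K0 : 0 <= K.
Proof. exact: le_trans (normr_ge0 _) (hjb_v_bound hS 0). Qed.

Let C0 : 0 <= C.
Proof. by rewrite /C !addr_ge0// !mulr_ge0// ltW. Qed.

Let kh0 (k : nat) (h : R) : 0 < h -> 0 <= k%:R * h.
Proof. by move=> h0; rewrite mulr_ge0// ltW. Qed.

Let rhoS h k : expR (- (alpha * (k%:R * h + h))) = rho h k.+1.
Proof. by rewrite /rho -natr1 mulrDl mul1r. Qed.

Let L1_step eta k : 0 < eta <= 1 -> L1 Pr (A (eta ^+ 2) k) /\ L1 Pr (dev (eta ^+ 2) k).
Proof.
move=> eta1; have h0 : 0 < eta ^+ 2 by rewrite exprn_gt0//; case/andP: eta1.
have [c1 _ H1] := step_cost_expectation hW a0 sg0 thl0 thu0 Ip0 hS hQ.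
have [c2 _ H2] := path_deviation_expectation hW sg0 thl0 thu0 hQ.
by split; [case: (H1 _ _ (kh0 k h0) eta1)|case: (H2 _ _ (kh0 k h0) eta1)].
Qed.

(** Expected deviations have the order of the errors that [discounted_telescoping] allows, so any
    multiple [c] of them may be added; [- C] and [C] serve the lower and the upper bound. The term
    [e] absorbs the discounted value after [n] steps. *)
Let expected_sum (c : R) : exists2 C', 0 <= C' & forall eta, 0 < eta <= 1 ->
  forall e, 0 < e -> \forall n \near \oo,
    `|\sum_(k < n) rho (eta ^+ 2) k.+1 * ('E[A (eta ^+ 2) k] + c * 'E[dev (eta ^+ 2) k])
      - V (p0 - d0)| <= C' * eta + e.
Proof.
have [c1 c10 H1] := step_cost_expectation hW a0 sg0 thl0 thu0 Ip0 hS hQ.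
have [c2 c20 H2] := path_deviation_expectation hW sg0 thl0 thu0 hQ.
have [c3 c30 H3] := value_moment hW a0 sg0 thl0 thu0 Ip0 hS hQ.
pose cc := c1 + c3 + `|c| * c2.
have cc0 : 0 <= cc by rewrite !addr_ge0// mulr_ge0.
have [C' C'0 HC] := discounted_telescoping a0 cc0.
exists C' => // eta eta1 e e0; pose h := eta ^+ 2.
have /andP[eta_gt0 _] := eta1.
have h0 : 0 < h by rewrite exprn_gt0.
pose y (k : nat) := 'E[fun w => V (Q (k%:R * h) w - D (k%:R * h) w)].
pose a k := 'E[A h k] + c * 'E[dev h k].
have yC k : `|y k| <= cc * (1 + k%:R * h).
  have [_ Hy] := H3 _ (kh0 k h0); apply: (le_trans Hy).
  have : 0 <= c1 + `|c| * c2 by rewrite addr_ge0// mulr_ge0.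
  by move=> ?; apply: ler_wpM2r; [rewrite addr_ge0 ?kh0|rewrite /cc; lra].
have aC k : `|a k - ((1 + alpha * h) * y k - y k.+1)| <= cc * eta ^+ 3.
  have [_ Ha] := H1 _ _ (kh0 k h0) eta1; have [Ld Hd] := H2 _ _ (kh0 k h0) eta1.
  have yS : y k.+1 = 'E[fun w => V (Q (k%:R * h + h) w - D (k%:R * h + h) w)].
    by rewrite /y -natr1 mulrDl mul1r.
  have dev0 : 0 <= 'E[dev h k].
    by apply: Rintegral_ge0 => w _; apply: Rintegral_ge0.
  have -> : a k - ((1 + alpha * h) * y k - y k.+1) =
      ('E[A h k] - ((1 + alpha * h) * y k - y k.+1)) + c * 'E[dev h k].
    by rewrite /a; ring.
  apply: (le_trans (ler_normD _ _)).
  have Ha' : `|'E[A h k] - ((1 + alpha * h) * y k - y k.+1)| <= c1 * eta ^+ 3.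
    by rewrite yS; exact: Ha.
  have Hd' : `|c * 'E[dev h k]| <= `|c| * c2 * eta ^+ 3.
    by rewrite normrM (ger0_norm dev0) -mulrA ler_wpM2l.
  have : 0 <= c3 * eta ^+ 3 by rewrite mulr_ge0// exprn_ge0// ltW.
  by rewrite /cc; lra.
have y0E : y 0%N = V (p0 - d0).
  rewrite /y mul0r; have -> : (fun w => V (Q 0 w - D 0 w)) = fun=> V (p0 - d0).
    apply/funext => w; rewrite (policy_init hQ) /demand (bm_zero hW).
    by rewrite !mulr0 !addr0.
  exact: E_cst.
have := discount_linear_cvg a0 h0 yC e0; apply: filterS => n yn.
have := HC eta y a n eta1 yC aC; rewrite -/h y0E => H.
have -> : \sum_(k < n) rho h k.+1 * a k - V (p0 - d0) =
  (\sum_(k < n) rho h k.+1 * a k - (V (p0 - d0) - rho h n * y n)) - rho h n * y n.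
  by ring.
by apply: (le_trans (ler_normB _ _)); apply: lerD.
Qed.

(** The inner integral of [cost]; it is only ever compared with functions that are measurable in
    [w]. *)
Let J w := (\int[mu]_(t in `[0%R, +oo[)
    (let X := (Q t w - D t w)%R in
     let p := rate Q t w in
     (expR (- (alpha * t)) *
       ((Cplus * Num.max X 0 + Cminus * - Num.min X 0) +
        (Ip * (0 < p)%R%:R - Dp * (p < 0)%R%:R) * p))%R)%:E)%E.

Let run (p : R -> R) w t := expR (- (alpha * t)) *
  (holding_cost Cplus Cminus (Q t w - D t w) + adjustment_cost Ip Dp (p t)).

Let JE w : J w = (\int[mu]_(t in `[0%R, +oo[) (run (rate Q ^~ w) w t)%:E)%E.
Proof. by []. Qed.

Let run_ge0 p w t : 0 <= run p w t.
Proof. by rewrite mulr_ge0 ?expR_ge0// addr_ge0 ?holding_cost_ge0 ?adjustment_cost_ge0. Qed.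

Let J_ge0 w : (0 <= J w)%E.
Proof. by rewrite JE; apply: integral_ge0 => t _; rewrite lee_fin. Qed.

Let cD w : continuous_path (D ^~ w).
Proof. exact: (demand_continuous_path hW). Qed.

Let measurable_run p w : measurable_fun setT p ->
  measurable_fun (`[0, +oo[%classic : set R) (fun t => (run p w t)%:E).
Proof.
move=> mp; apply/measurable_EFinP.
exact: (measurable_running_cost alpha Ip Dp Cplus Cminus thl0 thu0 hQ (@cD w) mp).
Qed.

Let nneseries_ge (u : nat -> \bar R) n : (forall k, 0 <= u k)%E ->
  (\sum_(k < n) u k <= \sum_(0 <= k <oo) u k)%E.
Proof.
by move=> u0; rewrite -(big_mkord xpredT); apply: nneseries_lim_ge => k *; exact: u0.
Qed.

Lemma path_cost_ge_sum h n w : 0 < h ->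
  ((\sum_(k < n) rho h k.+1 * (A h k w - C * dev h k w))%:E <= J w)%E.
Proof.
move=> h0; have [p [mp pM pE]] := policy_rate_version thl0 thu0 hQ w.
apply: (@le_trans _ _ (\int[mu]_(t in `[0%R, +oo[) (run p w t)%:E)%E); last first.
  rewrite JE; apply: ge0_le_integral_ae_l => //.
  - exact: measurable_run.
  - by move=> t _; rewrite lee_fin.
  - by move=> t _; rewrite lee_fin.
  - have F := ae_filter_ringOfSetsType mu; apply: filterS pE => t pt.
    by rewrite /= in_itv/= andbT => t0; rewrite /run pt.
rewrite (running_cost_series alpha thl0 thu0 Ip0 Dp0 Cplus0 Cminus0 hQ (cD w) mp h0).
apply: le_trans (nneseries_ge n _); last first.
  by move=> k; apply: integral_ge0 => t _; rewrite lee_fin; exact: run_ge0.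
rewrite -sumEFin; apply: lee_sum => k _.
rewrite -rhoS.
exact: (step_running_cost_ge a0 thl0 thu0 Ip0 Dp0 Cplus0 Cminus0 CpDp hS hQ (cD w)
  mp pM pE (kh0 k h0) (ltW h0)).
Qed.

Lemma value_le_cost :
  ((V (p0 - d0))%:E <= cost alpha Cplus Cminus Ip Dp Pr D Q)%E.
Proof.
have [C' C'0 HC] := expected_sum (- C).
have main eta : 0 < eta <= 1 ->
    ((V (p0 - d0) - (C' + 1) * eta)%:E <= cost alpha Cplus Cminus Ip Dp Pr D Q)%E.
  move=> eta1; have /andP[eta_gt0 _] := eta1.
  have h0 : 0 < eta ^+ 2 by rewrite exprn_gt0.
  have [N _ /(_ N (leqnn N)) /= HN] := HC eta eta1 eta eta_gt0.
  pose S w := \sum_(k < N) rho (eta ^+ 2) k.+1 * (A (eta ^+ 2) k w - C * dev (eta ^+ 2) k w).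
  have L1t k : L1 Pr (fun w => A (eta ^+ 2) k w - C * dev (eta ^+ 2) k w).
    by have [l1 l2] := L1_step k eta1; apply: L1B => //; exact: L1Z.
  have L1S : L1 Pr S by apply: L1_sum => k; exact: L1Z.
  have ES : 'E[S] = \sum_(k < N) rho (eta ^+ 2) k.+1 *
      ('E[A (eta ^+ 2) k] + - C * 'E[dev (eta ^+ 2) k]).
    rewrite /S E_sum; last by move=> k; exact: L1Z.
    apply: eq_bigr => k _; rewrite EZ//; congr (_ * _).
    have [l1 l2] := L1_step k eta1.
    have -> : 'E[fun w => A (eta ^+ 2) k w - C * dev (eta ^+ 2) k w] =
      'E[A (eta ^+ 2) k] - 'E[fun w => C * dev (eta ^+ 2) k w].
      by apply: EB => //; exact: L1Z.
    by rewrite EZ// mulNr.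
  apply: (@le_trans _ _ ('E[S])%:E).
    rewrite lee_fin ES; move: HN; rewrite ler_norml => /andP[h1 _].
    by move: h1; rewrite mulrDl mul1r; lra.
  (* The comparison with [J] requires nonnegative functions; as [J] is nonnegative, it also
     dominates the positive part of [S]. *)
  pose S' w := Num.max (S w) 0.
  have L1S' : L1 Pr S'.
    apply: (L1_le _ (L1_norm L1S)).
      by apply: measurable_maxr => //; exact: L1_meas L1S.
    by move=> w; rewrite /S'; case: (leP (S w) 0) => h; rewrite ?normr0.
  apply: (@le_trans _ _ ('E[S'])%:E).
    by rewrite lee_fin; apply: E_le => // w; rewrite /S' le_max lexx.
  rewrite /Rintegral fineK; last exact: (integrable_fin_num _ L1S').
  apply: ge0_le_integral_nonmeas => w _.
    by rewrite lee_fin /S' le_max lexx orbT.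
  rewrite /S'; case: (leP (S w) 0) => h; first exact: J_ge0.
  exact: path_cost_ge_sum.
apply/lee_addgt0Pr => e e0.
pose eta := Num.min 1 (e / (C' + 1)).
have C1 : 0 < C' + 1 by rewrite ltr_wpDl.
have eta1 : 0 < eta <= 1 by rewrite lt_min ltr01 divr_gt0//= ge_min lexx.
rewrite -leeBlDr// -EFinB; apply: le_trans (main eta eta1); rewrite lee_fin.
have : eta <= e / (C' + 1) by rewrite ge_min lexx orbT.
by rewrite ler_pdivlMr// mulrC; lra.
Qed.

Hypothesis hT : threshold_policy thu L Pr D Q.

Let U h k w := rho h k * (A h k w + C * dev h k w).

Let ae_path_cost_le h : 0 < h -> {ae Pr, forall w,
  (forall k, 0 <= U h k w) /\ (J w <= \sum_(0 <= k <oo) (U h k w)%:E)%E}.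
Proof.
move=> h0; apply: filterS hT => w rT.
(* The feedback formula itself serves as version of the rate, so that it holds at every time and not
   only at almost every one. *)
pose p (t : R) := if Q (Num.max t 0) w - D (Num.max t 0) w < L then thu else 0.
have mp : measurable_fun setT p.
  apply: measurable_fun_ifT => //; apply: measurable_fun_ltr => //.
  apply: continuous_measurable_fun.
  apply: (@continuous_path_extend R (fun t => Q t w - D t w)).
  by apply: continuous_pathB; [exact: policy_continuous_path hQ|exact: cD].
have pM t : thl <= p t <= thu.
  by rewrite /p; case: ifP => _; rewrite ?lexx ?ltW// (lt_trans thl0).
have pT t : 0 <= t -> p t = if Q t w - D t w < L then thu else 0.
  by move=> t0; rewrite /p (max_idPl t0).
have F := ae_filter_ringOfSetsType mu.
have pE : {ae mu, forall t, 0 <= t -> rate Q t w = p t}.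
  by apply: filterS rT => t rt t0; rewrite rt// pT.
have step k := step_running_cost_le a0 thl0 thu0 Ip0 Dp0 Cplus0 Cminus0 hS hQ
  (@cD w) mp pM pE (kh0 k h0) (ltW h0) pT.
have I0 k : (0 <= \int[mu]_(t in `[(k%:R * h)%R, (k%:R * h + h)%R]) (run p w t)%:E)%E.
  by apply: integral_ge0 => t _; rewrite lee_fin; exact: run_ge0.
split=> [k|].
  by rewrite -lee_fin; apply: le_trans (I0 k) _; exact: step.
apply: (@le_trans _ _ (\int[mu]_(t in `[0%R, +oo[) (run p w t)%:E)%E).
  rewrite JE; apply: ge0_le_integral_ae_r => //.
  - exact: measurable_run.
  - by move=> t _; rewrite lee_fin.
  - by move=> t _; rewrite lee_fin.
  - apply: filterS pE => t pt.
    by rewrite /= in_itv/= andbT => t0; rewrite /run pt.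
rewrite (running_cost_series alpha thl0 thu0 Ip0 Dp0 Cplus0 Cminus0 hQ (@cD w) mp h0).
by apply: lee_nneseries => [k _ _|k _]; [exact: I0|exact: step].
Qed.

(** [U] is discounted from the start of each step, whence a factor [expR (alpha * h)] against
    [expected_sum], which tends to 1 with [h]. Expectation and infinite sum are exchanged by
    monotone convergence. *)
Lemma cost_le_value :
  (cost alpha Cplus Cminus Ip Dp Pr D Q <= (V (p0 - d0))%:E)%E.
Proof.
have [C' C'0 HC] := expected_sum C.
have main eta : 0 < eta <= 1 -> (cost alpha Cplus Cminus Ip Dp Pr D Q <=
    (expR (alpha * eta ^+ 2) * (V (p0 - d0) + (C' + 1) * eta))%:E)%E.
  move=> eta1; have /andP[eta_gt0 _] := eta1.
  set h := eta ^+ 2; have h0 : 0 < h by rewrite exprn_gt0.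
  have good := ae_path_cost_le h0.
  have L1U k : L1 Pr (U h k).
    have [l1 l2] := L1_step k eta1.
    by apply: L1Z; apply: L1D => //; exact: L1Z.
  have EU k : 'E[U h k] = expR (alpha * h) *
      (rho h k.+1 * ('E[A h k] + C * 'E[dev h k])).
    have [l1 l2] := L1_step k eta1.
    have -> : 'E[U h k] = rho h k * 'E[fun w => A h k w + C * dev h k w].
      by apply: EZ; apply: L1D => //; exact: L1Z.
    have -> : 'E[fun w => A h k w + C * dev h k w] = 'E[A h k] + 'E[fun w => C * dev h k w].
      by apply: ED => //; exact: L1Z.
    rewrite EZ// mulrA; congr (_ * _).
    by rewrite /rho -expRD -natr1; congr expR; ring.
  (* [U] is nonnegative almost surely only; its positive part is so everywhere and has the same
     expectation. *)
  pose M k w := Num.max (U h k w) 0.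
  have mM k : measurable_fun setT (fun w => (M k w)%:E).
    by apply/measurable_EFinP; apply: measurable_maxr => //; exact: L1_meas (L1U k).
  have M0 k w : (0 <= (M k w)%:E)%E by rewrite lee_fin /M le_max lexx orbT.
  have EM k : (\int[Pr]_w (M k w)%:E = ('E[U h k])%:E)%E.
    rewrite /Rintegral fineK; last exact: (integrable_fin_num _ (L1U k)).
    apply: ae_eq_integral => //; first exact/measurable_EFinP/(L1_meas (L1U k)).
    by apply: filterS good => w [U0 _] _; rewrite /M (max_idPl (U0 k)).
  have leS : (cost alpha Cplus Cminus Ip Dp Pr D Q <=
      \int[Pr]_w \sum_(0 <= k <oo) (M k w)%:E)%E.
    apply: ge0_le_integral_ae_r => //.
    - by apply: ge0_emeasurable_sum => // k w _ _; exact: M0.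
    - by move=> w _; exact: J_ge0.
    - by move=> w _; apply: nneseries_ge0 => k _ _; exact: M0.
    - apply: filterS good => w [U0 JU] _; apply: (le_trans JU).
      by apply: lee_nneseries => [k _ _|k _]; rewrite lee_fin// /M le_max lexx.
  apply: (le_trans leS); rewrite integral_nneseries//.
  under eq_eseriesr do rewrite EM.
  have EU0 k : (0 <= ('E[U h k])%:E)%E by rewrite -EM; apply: integral_ge0 => w _; exact: M0.
  apply: lime_le; first by apply: is_cvg_nneseries => k _ _; exact: EU0.
  have := HC eta eta1 eta eta_gt0; apply: filterS => n; rewrite -/h ler_norml => /andP[_ Hn].
  rewrite sumEFin lee_fin big_mkord.
  under eq_bigr do rewrite EU.
  rewrite -mulr_sumr ler_wpM2l ?expR_ge0//.
  by move: Hn; rewrite mulrDl mul1r; lra.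
apply/lee_addgt0Pr => e e0.
(* [c * eta] collects the error [(C' + 1) * eta] and the one from [expR (alpha * eta ^+ 2) - 1],
   which is at most [alpha * eta * expR alpha]. *)
pose c := expR alpha * (alpha * `|V (p0 - d0)| + (C' + 1)) + 1.
have C1 : 0 < C' + 1 by rewrite ltr_wpDl.
have c0 : 0 < c.
  by rewrite ltr_wpDl// mulr_ge0 ?expR_ge0// addr_ge0 ?(ltW C1)// mulr_ge0// ltW.
pose eta := Num.min 1 (e / c).
have eta0 : 0 < eta by rewrite lt_min ltr01 divr_gt0.
have eta1 : eta <= 1 by rewrite ge_min lexx.
have etae : c * eta <= e.
  have : eta <= e / c by rewrite ge_min lexx orbT.
  by rewrite ler_pdivlMr// mulrC.
apply: (le_trans (main eta _)); first by rewrite eta0.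
rewrite -EFinD lee_fin; apply: le_trans (lerD (lexx _) etae).
have eta2 : eta ^+ 2 <= eta by rewrite expr2 ler_piMl// ltW.
have eta20 : 0 <= eta ^+ 2 by rewrite sqr_ge0.
have u0 : 0 <= alpha * eta ^+ 2 by rewrite mulr_ge0// ltW.
have ua : alpha * eta ^+ 2 <= alpha by rewrite ler_piMr ?(ltW a0)// (le_trans eta2).
have t0 := expR_taylor0 (ltW a0) ua; rewrite (ger0_norm u0) in t0.
set E := expR (alpha * eta ^+ 2) in t0 *.
have EE : E <= expR alpha by rewrite /E ler_expR.
have e1 : E * ((C' + 1) * eta) <= expR alpha * ((C' + 1) * eta).
  by rewrite ler_wpM2r// mulr_ge0// ltW.
have e2 : (E - 1) * V (p0 - d0) <= alpha * eta * expR alpha * `|V (p0 - d0)|.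
  apply: (le_trans (ler_norm _)); rewrite normrM ler_wpM2r//.
  apply: (le_trans t0); rewrite ler_wpM2r ?expR_ge0// ler_wpM2l ?(ltW a0)//.
have -> : E * (V (p0 - d0) + (C' + 1) * eta) =
  V (p0 - d0) + (E - 1) * V (p0 - d0) + E * ((C' + 1) * eta) by ring.
rewrite -addrA lerD2l; apply: (le_trans (lerD e2 e1)).
have -> : c * eta = alpha * eta * expR alpha * `|V (p0 - d0)| +
  expR alpha * ((C' + 1) * eta) + eta by rewrite /c; ring.
by rewrite lerDl ltW.
Qed.

End verification.

Theorem theorem3 (R : realType) (d : measure_display) (T : measurableType d)
  (Pr : probability T R) (W : R -> T -> R)
  (alpha b sigma thl thu Ip Dp Rp Cp Rs Cs : R)
  (hW : standard_brownian_motion Pr W)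
  (halpha : 0 < alpha) (hsigma : 0 < sigma) (hthl : thl < 0) (hthu : 0 < thu)
  (hIp : 0 <= Ip) (hDp : 0 <= Dp)
  (hCp : 0 <= Cp) (hRp : Cp < Rp) (hCs : 0 <= Cs) (hRs : Cs < Rs)
  (hCpCs : Cs < Cp) :
  let Np := Rp - Cp in
  let Ns := Rs - Cs in
  let Cplus := Cp in
  let Cminus := Np - Ns in
  let r1 := (b + Num.sqrt (b ^+ 2 + 2 * alpha * sigma ^+ 2)) / sigma ^+ 2 in
  let r2 := (b - Num.sqrt (b ^+ 2 + 2 * alpha * sigma ^+ 2)) / sigma ^+ 2 in
  let s1 := (b - thu + Num.sqrt ((b - thu) ^+ 2 + 2 * alpha * sigma ^+ 2))
              / sigma ^+ 2 in
  let s2 := (b - thu - Num.sqrt ((b - thu) ^+ 2 + 2 * alpha * sigma ^+ 2))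
              / sigma ^+ 2 in
  let B2 := (Cminus - alpha * Ip) * (s1 - r2) in
  let B3 := (Cplus + Cminus) * (- r2) in
  Cplus / alpha <= Dp -> Ip < Cminus / alpha ->
  exists L : R,
    (forall d0 p0 : R,
      let D := demand b sigma d0 W in
      (exists P : R -> T -> R,
        control_policy thl thu D p0 P /\ threshold_policy thu L Pr D P) /\
      (forall P : R -> T -> R,
        control_policy thl thu D p0 P -> threshold_policy thu L Pr D P ->
        optimal_policy alpha Cplus Cminus Ip Dp thl thu Pr D p0 P)) /\
    (B3 <= B2 ->
      L = s2^-1 * ln ((alpha * Ip + Cplus) * (s1 - r2) / ((Cplus + Cminus) * s1))
      /\ 0 <= L) /\
    (B2 < B3 ->
      L = (- r1)^-1 * ln ((Cplus + Cminus) * (- r2)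
                           / ((Cminus - alpha * Ip) * (s1 - r2)))
      /\ L < 0).
Proof.
move=> Np Ns Cplus Cminus r1 r2 s1 s2 B2 B3 hD hI.
have Cp0 : 0 < Cp := le_lt_trans hCs hCpCs.
have aI : alpha * Ip < Cminus by move: hI; rewrite ltr_pdivlMr// mulrC.
have Cm0 : 0 <= Cminus by apply: (le_trans _ (ltW aI)); rewrite mulr_ge0// ltW.
have [L [[K [V [v [z hS]]]] [LB3 LB2]]] :=
  hjb_solution_exists b halpha hsigma hthu hIp Cp0 aI.
exists L; split; last by split.
move=> d0 p0 D; split.
  exact: (threshold_policy_exists hW b d0 L p0 hsigma hthl (ltW hthu)).
move=> P hP hT; split; first exact: hP.
move=> Q hQ.
(* The initial surplus is [p0 - d0], and the value there separates the cost of [P] from that of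
   every competitor. *)
apply: (@le_trans _ _ (V (p0 - d0))%:E).
  exact: (cost_le_value hW halpha hsigma hthl hthu hIp hDp (ltW Cp0) Cm0 hS hP hT).
exact: (value_le_cost hW halpha hsigma hthl hthu hIp hDp (ltW Cp0) Cm0 hD hS hQ).
Qed.
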